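(* Let $p\in(2,3)$, let $K\subset\widehat{\mathscr C}^p([0,T];\mathbb R^{\hat d})$ be a compact subset, bounded with respect to the rough path norm, and let $f\colon K\to\mathbb R$ be continuous. For $L>0$ let $$K_L:=\{\widehat{\mathbf X}=(\widehat X,\widehat{\mathbb X}^{(2)})\in K:\ \|(\widehat X,\widehat{\mathbb X}^{(2)})\|_p+\|[\widehat{\mathbf X}]\|_{p/2}\le L\}.$$ Then for every $\varepsilon>0$ there exists $\ell\in T(\mathbb R^{\hat d})$ such that $$\sup_{\widehat{\mathbf X}\in K_L}\big|f(\widehat{\mathbf X})-\langle \ell,\widehat{\mathbb X}_T\rangle\big|<\varepsilon,$$ where $\widehat{\mathbb X}$ denotes the signature of $\widehat{\mathbf X}$ given by Lyons' extension of $\widehat{\mathbf X}$ to $T((\mathbb R^{\hat d}))$.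
   Context: Fix $T>0$, $d\in\mathbb N$; $\Delta_T=\{(s,t)\in[0,T]^2:s\le t\}$, $X_{s,t}:=X_t-X_s$. Tensor algebras: $T(\mathbb R^m)=\bigoplus_{n\ge0}(\mathbb R^m)^{\otimes n}$, $T((\mathbb R^m))=\prod_{n\ge0}(\mathbb R^m)^{\otimes n}$, with tensor product $\otimes$. For a multi-index $I=(i_1,\dots,i_n)$, $e_I=e_{i_1}\otimes\cdots\otimes e_{i_n}$, $e_\emptyset=1$; for $\ell=\sum_I\ell_Ie_I\in T(\mathbb R^m)$ (finite sum) and $\mathbf a\in T((\mathbb R^m))$, $\langle\ell,\mathbf a\rangle=\sum_I\ell_I a_I$, where $a_I=\langle e_I,\mathbf a\rangle$ is the $e_I$-coordinate of $\mathbf a$. Variation: for a path $X$, $\|X\|_p=(\sup_{\mathcal P}\sum_{[u,v]\in\mathcal P}|X_{u,v}|^p)^{1/p}$, the sup being over partitions of $[0,T]$; for a two-parameter function $A\colon\Delta_T\to E$, $\|A\|_r=(\sup_{\mathcal P}\sum_{[u,v]\in\mathcal P}|A_{u,v}|^r)^{1/r}$. Rough paths: for $p\in[2,3)$, $\mathscr C^p([0,T];\mathbb R^m)$ is the space of (continuous) rough paths $\mathbf X=(X,\mathbb X^{(2)})$: $X\colon[0,T]\to\mathbb R^m$ continuous with $\|X\|_p<\infty$, $\mathbb X^{(2)}\colon\Delta_T\to\mathbb R^{m\times m}$ continuous with $\|\mathbb X^{(2)}\|_{p/2}<\infty$, and Chen's relation $\mathbb X^{(2)}_{s,t}=\mathbb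 X^{(2)}_{s,u}+\mathbb X^{(2)}_{u,t}+X_{s,u}\otimes X_{u,t}$ for $s\le u\le t$. The rough path (semi)norm is $\|\mathbf X\|_p=\|X\|_p+\|\mathbb X^{(2)}\|_{p/2}$; the topology (for compactness and continuity) is induced by the distance $\|X-Y\|_p+\|\mathbb X^{(2)}-\mathbb Y^{(2)}\|_{p/2}$. The rough path bracket is the path $[\mathbf X]_t:=X_{0,t}\otimes X_{0,t}-(\mathbb X^{(2)}_{0,t}+(\mathbb X^{(2)}_{0,t})^\top)$. Extended rough paths: for $(X,\mathbb X^{(2)})\in\mathscr C^p([0,T];\mathbb R^d)$, $p\in(2,3)$, let $Q(X)=([\mathbf X]^{ij})_{1\le i\le j\le d}$ (listed as $11,\dots,1d,22,\dots,2d,\dots,dd$), $\hat d=1+d+\frac{d(d+1)}2$, and $\widehat X_t:=(t,X_t,Q(X)_t)\in\mathbb R^{\hat d}$, with coordinates indexed $0,1,\dots,\hat d-1$ ($0$ for time, $1,\dots,d$ for $X$, the rest for $Q(X)$). It is lifted canonically to $\widehat{\mathbf X}=(\widehat X,\widehat{\mathbb X}^{(2)})\in\mathscr C^p([0,T];\mathbb R^{\hat d})$ by $(\widehat{\mathbb X}^{(2)}_{s,t})^{ij}=(\mathbb X^{(2)}_{s,t})^{ij}$ for $i,j\in\{1,\dots,d\}$ and by the Young integral $(\widehat{\mathbb X}^{(2)}_{s,t})^{ij}=\int_s^t\widehat X^i_{s,r}\,\mathrm d\widehat X^j_r$ if $i$ and $j$ are not both in $\{1,\dots,d\}$. $\widehat{\mathscr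 C}^p([0,T];\mathbb R^{\hat d})$ is the set of all such $\widehat{\mathbf X}$, a subspace of $\mathscr C^p([0,T];\mathbb R^{\hat d})$. Lyons' extension of $(X,\mathbb X^{(2)})\in\mathscr C^p([0,T];\mathbb R^m)$ is the unique continuous $\mathbb X=(1,X_{s,t},\mathbb X^{(2)}_{s,t},\mathbb X^{(3)}_{s,t},\dots)\colon\Delta_T\to T((\mathbb R^m))$ with $\mathbb X_{s,u}\otimes\mathbb X_{u,t}=\mathbb X_{s,t}$ for $s\le u\le t$ and with $\mathbb X^{(n)}$ of finite $p/n$-variation for every $n\ge1$; one writes $\mathbb X_t:=\mathbb X_{0,t}$. *)

(* Defs.v *)
From HB Require Import structures.
From mathcomp Require Import all_boot all_order all_algebra.
From mathcomp Require Import finmap.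
From mathcomp Require Import all_classical all_reals all_analysis.
From mathcomp Require Import ring lra.

Set Implicit Arguments.
Unset Strict Implicit.
Unset Printing Implicit Defensive.

Import Order.TTheory GRing.Theory Num.Theory.
Import numFieldNormedType.Exports.

Local Open Scope classical_set_scope.
Local Open Scope ring_scope.

(* The norm |.| on R^m and on R^(m x n) is the Euclidean (Hilbert-Schmidt) one,
   not the max-norm that MathComp-Analysis puts on matrices. *)
Definition enorm {R : realType} {m n : nat} (A : 'M[R]_(m, n)) : R :=
  Num.sqrt (\sum_i \sum_j A i j ^+ 2).

Definition outer {R : realType} {m : nat} (u v : 'rV[R]_m) : 'M[R]_m :=
  u^T *m v.

Definition Delta {R : realType} (T : R) : set (R * R) :=
  [set z | 0 <= z.1 /\ z.1 <= z.2 /\ z.2 <= T].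

(* A list s with itv_partition a b s stands for the partition
   a = t_0 < t_1 < ... < t_(size s) = b, where a is not listed in s. *)
Definition partition_sum {R : realType} (a b : R) (s : seq R)
    (F : R -> R -> R) : R :=
  \sum_(0 <= k < size s) F (nth b (a :: s) k) (nth b (a :: s) k.+1).

(* pvar T r a is the r-variation over [0, T] of a two-parameter function A
   with a u v = |A_(u,v)|; the value +oo is allowed. *)
Definition pvar {R : realType} (T r : R) (a : R -> R -> R) : \bar R :=
  (ereal_sup [set (partition_sum 0 T s (fun u v => (a u v `^ r)%R))%:E
             | s in itv_partition 0%R T] `^ r^-1)%E.

Section minkowski.
Context {R : realType}.

Lemma minkowski_sum_le (I : Type) (s : seq I) (a b c : I -> R) (p x y : R) :
  1 <= p -> 0 < x -> 0 < y ->
  (forall i, 0 <= a i) -> (forall i, 0 <= b i) ->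
  (forall i, 0 <= c i <= a i + b i) ->
  \sum_(i <- s) a i `^ p <= x `^ p -> \sum_(i <- s) b i `^ p <= y `^ p ->
  \sum_(i <- s) c i `^ p <= (x + y) `^ p.
Proof.
move=> p1 x0 y0 a0 b0 c0 ax bY.
have p0 : 0 <= p by rewrite (le_trans ler01).
have xy0 : 0 < x + y by rewrite addr_gt0.
have xp0 : 0 < x `^ p by rewrite powR_gt0.
have yp0 : 0 < y `^ p by rewrite powR_gt0.
pose w := x / (x + y).
have w0 : 0 <= w by rewrite divr_ge0 ?ltW.
have w1 : w <= 1 by rewrite ler_pdivrMr// mul1r lerDl ltW.
have w'E : 1 - w = y / (x + y) by rewrite /w; field; rewrite lt0r_neq0.
have w'0 : 0 <= 1 - w by rewrite subr_ge0.
have key i : c i `^ p <= (x + y) `^ p *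
    (w * (a i `^ p / x `^ p) + (1 - w) * (b i `^ p / y `^ p)).
  have [ci0 ciab] := andP (c0 i).
  apply: (@le_trans _ _ ((a i + b i) `^ p)).
    by apply: ge0_ler_powR => //; rewrite nnegrE ?addr_ge0.
  have -> : a i + b i = (x + y) * (w * (a i / x) + (1 - w) * (b i / y)).
    by rewrite w'E /w; field; rewrite !lt0r_neq0.
  have ax0 : 0 <= a i / x by rewrite divr_ge0// ltW.
  have by0 : 0 <= b i / y by rewrite divr_ge0// ltW.
  rewrite powRM ?(ltW xy0)//; last by rewrite addr_ge0// mulr_ge0.
  rewrite ler_wpM2l ?powR_ge0//.
  have divp u v : 0 <= u -> 0 < v -> u `^ p / v `^ p = (u / v) `^ p.
    move=> u0 v0; rewrite powRM ?invr_ge0 ?(ltW v0)//; congr (_ * _).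
    by rewrite -powR_inv1 ?powR_ge0// powRAC powR_inv1 ?(ltW v0).
  rewrite !divp//.
  by apply: (convex_powR p1 (Itv01 w0 w1)); rewrite inE/= in_itv/= andbT.
apply: le_trans (ler_sum _ (fun i _ => key i)) _.
rewrite -mulr_sumr -[leRHS]mulr1 ler_wpM2l ?powR_ge0//.
rewrite big_split/= -!mulr_sumr -!mulr_suml.
apply: (@le_trans _ _ (w * 1 + (1 - w) * 1)); last by rewrite !mulr1 subrKC.
by apply: lerD; rewrite ler_wpM2l// ler_pdivrMr// mul1r.
Qed.

Lemma minkowski_sum (I : Type) (s : seq I) (a b c : I -> R) (p : R) :
  1 <= p ->
  (forall i, 0 <= a i) -> (forall i, 0 <= b i) ->
  (forall i, 0 <= c i <= a i + b i) ->
  (\sum_(i <- s) c i `^ p) `^ p^-1 <=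
  (\sum_(i <- s) a i `^ p) `^ p^-1 + (\sum_(i <- s) b i `^ p) `^ p^-1.
Proof.
move=> p1 a0 b0 c0.
have p0 : 0 < p by rewrite (lt_le_trans ltr01).
have sum0 (h : I -> R) : 0 <= \sum_(i <- s) h i `^ p.
  by apply: sumr_ge0 => i _; exact: powR_ge0.
have pK (z : R) : 0 <= z -> (z `^ p) `^ p^-1 = z.
  by move=> z0; rewrite -powRrM mulfV ?gt_eqF// powRr1.
have Kp (z : R) : 0 <= z -> (z `^ p^-1) `^ p = z.
  by move=> z0; rewrite -powRrM mulVf ?gt_eqF// powRr1.
apply/ler_addgt0Pr => e e0.
have e20 : 0 < e / 2 by rewrite divr_gt0.
have leK (h : I -> R) (z : R) : (\sum_(i <- s) h i `^ p) `^ p^-1 = z ->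
    0 < z + e / 2 /\ \sum_(i <- s) h i `^ p <= (z + e / 2) `^ p.
  move=> hz; have z0 : 0 <= z by rewrite -hz powR_ge0.
  have ze0 : 0 < z + e / 2 by rewrite ltr_wpDl.
  split=> //; rewrite -[leLHS]Kp// hz.
  by apply: ge0_ler_powR; rewrite ?nnegrE ?(ltW p0)// ?(ltW ze0)// lerDl ltW.
have [A0 aA] := leK a _ erefl; have [B0 bB] := leK b _ erefl.
move: A0 B0 aA bB.
move: ((\sum_(i <- s) a i `^ p) `^ _) => A.
move: ((\sum_(i <- s) b i `^ p) `^ _) => B A0 B0 aA bB.
have -> : A + B + e = (A + e / 2) + (B + e / 2) by field.
have AB0 : 0 <= (A + e / 2) + (B + e / 2) by rewrite addr_ge0// ltW.
rewrite -[leRHS]pK//; apply: ge0_ler_powR; rewrite ?nnegrE ?powR_ge0//.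
  by rewrite invr_ge0 ltW.
exact: (@minkowski_sum_le _ _ a b).
Qed.

End minkowski.

Section enorm_theory.
Context {R : realType} {m n : nat}.
Implicit Types A B : 'M[R]_(m, n).

Lemma enorm_ge0 A : 0 <= enorm A.
Proof. exact: sqrtr_ge0. Qed.

Lemma enorm0 : enorm (0 : 'M[R]_(m, n)) = 0.
Proof.
rewrite /enorm big1 ?sqrtr0// => i _; rewrite big1// => j _.
by rewrite mxE expr0n.
Qed.

Lemma enormN A : enorm (- A) = enorm A.
Proof.
by congr Num.sqrt; apply: eq_bigr => i _; apply: eq_bigr => j _;
  rewrite mxE sqrrN.
Qed.

Lemma enormE_powR A :
  enorm A = (\sum_(ij : 'I_m * 'I_n) `|A ij.1 ij.2| `^ 2) `^ 2^-1.
Proof.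
rewrite powR12_sqrt; last by apply: sumr_ge0 => ij _; exact: powR_ge0.
congr Num.sqrt; rewrite pair_big/=; apply: eq_bigr => ij _.
by rewrite (powR_mulrn 2)// real_normK// num_real.
Qed.

Lemma ler_enormD A B : enorm (A + B) <= enorm A + enorm B.
Proof.
rewrite !enormE_powR.
apply: minkowski_sum => // [|ij]; first by rewrite ler1n.
by rewrite normr_ge0/= mxE ler_normD.
Qed.

End enorm_theory.

Section pvar_theory.
Context {R : realType}.
Implicit Types (T r : R) (a b c : R -> R -> R).

Lemma partition_sum_ge0 (u v : R) (s : seq R) (F : R -> R -> R) :
  (forall x y, 0 <= F x y) -> 0 <= partition_sum u v s F.
Proof. by move=> F0; apply: sumr_ge0. Qed.

Lemma pvar_ge0 T r a : (0 <= pvar T r a)%E.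
Proof. exact: poweR_ge0. Qed.

Lemma eq_pvar T r a b : (forall u v, a u v = b u v) -> pvar T r a = pvar T r b.
Proof. by move=> ab; congr pvar; apply/funext => u; apply/funext => v. Qed.

Lemma partition_sum_le_pvar T r a s : 0 < r -> itv_partition 0 T s ->
  ((partition_sum 0 T s (fun u v => a u v `^ r) `^ r^-1)%:E <= pvar T r a)%E.
Proof.
move=> r0 Ts; rewrite -poweR_EFin.
set x := (partition_sum _ _ _ _)%:E.
have xS : (x <= ereal_sup [set (partition_sum 0 T s
    (fun u v => (a u v `^ r)%R))%:E | s in itv_partition 0%R T])%E.
  by apply: ereal_sup_ubound; exists s.
have x0 : (0 <= x)%E.
  by rewrite lee_fin partition_sum_ge0// => u v; exact: powR_ge0.
apply: gt0_ler_poweR => //; rewrite ?invr_ge0 ?(ltW r0)//.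
  by rewrite in_itv/= x0 leey.
by rewrite in_itv/= (le_trans x0 xS) leey.
Qed.

Lemma pvar_le T r a (x : R) : 0 < r -> 0 <= x ->
  (forall s, itv_partition 0 T s ->
    partition_sum 0 T s (fun u v => a u v `^ r) `^ r^-1 <= x) ->
  (pvar T r a <= x%:E)%E.
Proof.
move=> r0 x0 ax; rewrite /pvar.
set S := ereal_sup _.
have Sx : (S <= (x `^ r)%:E)%E.
  apply: ge_ereal_sup => _ [s Ts <-]; rewrite lee_fin.
  have := ax _ Ts; set y := partition_sum _ _ _ _ => yx.
  have y0 : 0 <= y by rewrite partition_sum_ge0// => u v; exact: powR_ge0.
  have -> : y = (y `^ r^-1) `^ r by rewrite -powRrM mulVf ?gt_eqF// powRr1.
  by apply: ge0_ler_powR => //; rewrite ?nnegrE ?powR_ge0// ltW.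
have -> : x%:E = ((x `^ r)%:E `^ r^-1)%E.
  by rewrite poweR_EFin -powRrM mulfV ?gt_eqF// powRr1.
have [S0|] := leP 0%E S.
  apply: gt0_ler_poweR => //; rewrite ?invr_ge0 ?(ltW r0)//.
    by rewrite in_itv/= S0 leey.
  by rewrite in_itv/= lee_fin powR_ge0 leey.
rewrite {1}/S; set D := [set _ | _ in _] => S0.
suff D0 : D = set0.
  rewrite /S -/D D0 ereal_sup0 poweRNyr ?invr_eq0 ?gt_eqF//.
  by rewrite poweR_EFin lee_fin powR_ge0.
rewrite -subset0 => y Dy; have yS := ereal_sup_ubound Dy.
have : (y < 0)%E by exact: le_lt_trans S0.
case: Dy => s Ts <-; rewrite lte_fin ltNge.
by rewrite partition_sum_ge0// => u v; exact: powR_ge0.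
Qed.

Lemma pvar_triangle T r a b c : 1 <= r ->
  (forall u v, 0 <= a u v) -> (forall u v, 0 <= b u v) ->
  (forall u v, 0 <= c u v <= a u v + b u v) ->
  (pvar T r c <= pvar T r a + pvar T r b)%E.
Proof.
move=> r1 a0 b0 c0.
have r0 : 0 < r by rewrite (lt_le_trans ltr01).
have := pvar_ge0 T r a; have := pvar_ge0 T r b.
case Ea : (pvar T r a) => [x| |]//; last first.
  by rewrite addye ?leey// gt_eqF// (lt_le_trans (ltNyr 0)) ?pvar_ge0.
case Eb : (pvar T r b) => [y| |]//; last first.
  by rewrite addey ?leey// ltNyr.
rewrite !lee_fin => y0 x0; rewrite -EFinD; apply: pvar_le => //.
  by rewrite addr_ge0.
move=> s Ts.
have := partition_sum_le_pvar a r0 Ts; rewrite Ea lee_fin => sx.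
have := partition_sum_le_pvar b r0 Ts; rewrite Eb lee_fin => sy.
apply: le_trans (lerD sx sy).
by apply: minkowski_sum.
Qed.

Lemma pvar0 T r : 0 < r -> pvar T r (fun _ _ => 0) = 0%E.
Proof.
move=> r0; apply/eqP; rewrite eq_le pvar_ge0 andbT.
apply: pvar_le => // s Ts; rewrite /partition_sum big1.
  by rewrite powR0// invr_eq0 gt_eqF.
by move=> k _; rewrite powR0// gt_eqF.
Qed.

End pvar_theory.

(* Elements of C^p([0, T]; R^m).  The components are total functions, whose
   values outside [0, T] and Delta T never matter: no definition below, in
   particular not the pseudometric, looks at them. *)
Record rough_path {R : realType} (T p : R) (m : nat) := RoughPath {
  rp_path : R -> 'rV[R]_m ;
  rp_area : R -> R -> 'M[R]_m ;
  rp_exponent : 2 <= p < 3 ;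
  rp_path_continuous : {within `[0, T], continuous rp_path} ;
  rp_area_continuous :
    {within Delta T, continuous (fun z : R * R => rp_area z.1 z.2)} ;
  rp_path_pvar :
    (pvar T p (fun u v => enorm (rp_path v - rp_path u)) < +oo)%E ;
  rp_area_pvar : (pvar T (p / 2) (fun u v => enorm (rp_area u v)) < +oo)%E ;
  rp_chen : forall s u t, 0 <= s -> s <= u -> u <= t -> t <= T ->
    rp_area s t = rp_area s u + rp_area u t
                  + outer (rp_path u - rp_path s) (rp_path t - rp_path u)
}.

Section rough_path_pseudometric.
Context {R : realType} {T p : R} {m : nat}.
Implicit Types X Y Z : rough_path T p m.

Definition rp_norm X : \bar R :=
  (pvar T p (fun u v => enorm (rp_path X v - rp_path X u)%R)
   + pvar T (p / 2) (fun u v => enorm (rp_area X u v)))%E.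

Definition rp_dist X Y : \bar R :=
  (pvar T p (fun u v => enorm ((rp_path X v - rp_path Y v)
                               - (rp_path X u - rp_path Y u))%R)
   + pvar T (p / 2) (fun u v => enorm (rp_area X u v - rp_area Y u v)%R))%E.

Definition rp_ball X (e : R) : set (rough_path T p m) :=
  [set Y | (rp_dist X Y < e%:E)%E].

Lemma rp_dist_refl X : rp_dist X X = 0%E.
Proof.
have /andP[p2 _] := rp_exponent X.
have p0 : 0 < p by rewrite (lt_le_trans _ p2).
rewrite /rp_dist -[RHS]adde0; congr (_ + _)%E.
  by rewrite -[RHS](pvar0 T p0); apply: eq_pvar => u v; rewrite !subrr enorm0.
rewrite -[RHS](pvar0 T (divr_gt0 p0 (ltr0n _ 2))).
by apply: eq_pvar => u v; rewrite subrr enorm0.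
Qed.

Lemma rp_dist_sym X Y : rp_dist X Y = rp_dist Y X.
Proof.
have dS (A B : 'M[R]_m) : enorm (A - B) = enorm (B - A).
  by rewrite -enormN opprB.
have vS (a b a' b' : 'rV[R]_m) :
    enorm ((a - b) - (a' - b')) = enorm ((b - a) - (b' - a')).
  by rewrite -enormN opprD !opprB.
rewrite /rp_dist.
refine (f_equal2 _ (eq_pvar _ _ _) (eq_pvar _ _ _)) => u v.
  exact: vS.
exact: dS.
Qed.

Lemma rp_dist_triangle X Y Z : (rp_dist X Z <= rp_dist X Y + rp_dist Y Z)%E.
Proof.
have /andP[p2 _] := rp_exponent X.
have p1 : 1 <= p by rewrite (le_trans _ p2)// ler1n.
have p21 : 1 <= p / 2 by rewrite ler_pdivlMr// mul1r.
have dD (A B C : 'M[R]_m) : enorm (A - C) <= enorm (A - B) + enorm (B - C).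
  by rewrite -{1}(subrK B A) -addrA ler_enormD.
have vD (a b c a' b' c' : 'rV[R]_m) : enorm ((a - c) - (a' - c')) <=
    enorm ((a - b) - (a' - b')) + enorm ((b - c) - (b' - c')).
  apply: le_trans (ler_enormD _ _); rewrite addrACA subrKA.
  by rewrite -opprD subrKA.
rewrite /rp_dist addeACA; apply: leeD.
  apply: pvar_triangle => // u v; rewrite ?enorm_ge0//=; exact: vD.
apply: pvar_triangle => // u v; rewrite ?enorm_ge0//=; exact: dD.
Qed.

Lemma rp_ball_center X e : 0 < e -> rp_ball X e X.
Proof. by move=> e0; rewrite /rp_ball/= rp_dist_refl lte_fin. Qed.

Lemma rp_ball_sym X Y e : rp_ball X e Y -> rp_ball Y e X.
Proof. by rewrite /rp_ball/= rp_dist_sym. Qed.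

Lemma rp_ball_triangle X Y Z e1 e2 :
  rp_ball X e1 Y -> rp_ball Y e2 Z -> rp_ball X (e1 + e2) Z.
Proof.
rewrite /rp_ball/= => XY YZ; apply: le_lt_trans (rp_dist_triangle X Y Z) _.
by rewrite EFinD lteD.
Qed.

Lemma rp_nbhsE :
  nbhs_ball_ rp_ball = nbhs_ (entourage_ rp_ball).
Proof.
rewrite predeq2E => X P; split.
  move=> [e e0 eP]; exists [set XY | rp_ball XY.1 e XY.2]; first by exists e.
  by move=> Y /xsectionP/eP.
move=> [A [e e0 eA] AP]; exists e => // Y XY.
by apply/AP/xsectionP; exact: eA.
Qed.

HB.instance Definition _ := gen_eqMixin (rough_path T p m).
HB.instance Definition _ := gen_choiceMixin (rough_path T p m).
HB.instance Definition _ := hasNbhs.Build (rough_path T p m)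
  (nbhs_ball_ rp_ball).
HB.instance Definition _ := Nbhs_isPseudoMetric.Build R (rough_path T p m)
  rp_nbhsE rp_ball_center rp_ball_sym rp_ball_triangle erefl.

End rough_path_pseudometric.

Definition bracket {R : realType} {T p : R} {m : nat}
    (X : rough_path T p m) (t : R) : 'M[R]_m :=
  outer (rp_path X t - rp_path X 0) (rp_path X t - rp_path X 0)
  - (rp_area X 0 t + (rp_area X 0 t)^T).

Definition bracket_norm {R : realType} {T p : R} {m : nat}
    (X : rough_path T p m) : \bar R :=
  pvar T (p / 2) (fun u v => enorm (bracket X v - bracket X u)).

(* The Young integral of f against g over [s, t], as the limit of left-point
   Riemann sums when the mesh of the partition tends to 0. *)
Definition is_young_integral {R : realType} (f g : R -> R) (s t I : R) : Prop :=
  forall e : R, 0 < e -> exists2 delta : R, 0 < delta &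
    forall P : seq R, itv_partition s t P ->
      (forall k, (k < size P)%N ->
         nth t (s :: P) k.+1 - nth t (s :: P) k < delta) ->
      `|partition_sum s t P (fun u v => f u * (g v - g u)) - I| < e.

Definition hatd (d : nat) : nat := (1 + d + (d * d.+1)./2)%N.

(* 11, ..., 1d, 22, ..., 2d, ..., dd *)
Definition upper_pairs (d : nat) : seq ('I_d * 'I_d) :=
  [seq ij : 'I_d * 'I_d <- [seq (i, j) | i <- enum 'I_d, j <- enum 'I_d]
     | (ij.1 <= ij.2)%N].

Lemma size_upper_pairs d : size (upper_pairs d) = (d * d.+1)./2.
Proof.
rewrite /upper_pairs size_filter -sum1_count big_mkcond big_allpairs/=.
rewrite big_enum/=; under eq_bigr do rewrite big_enum/=.
rewrite exchange_big/=.
transitivity (\sum_(j < d) j.+1)%N.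
  apply: eq_bigr => j _; rewrite -big_mkcond/=.
  transitivity (\sum_(i < d | true && (i < j.+1)) 1)%N; first by [].
  by rewrite -(big_ord_widen_cond _ xpredT (fun=> 1%N))// sum1_card card_ord.
rewrite -(big_mkord xpredT S) -[LHS]add0n -(big_nat_recl d 0 id)//.
by rewrite bin2_sum bin2 mulnC.
Qed.

Section extended.
Context {R : realType} {T p : R} {d : nat}.

Definition bracket_row (X : rough_path T p d) (t : R) : 'rV[R]_((d * d.+1)./2) :=
  \row_k [seq bracket X t ij.1 ij.2 | ij <- upper_pairs d]`_k.

Definition extended_path (X : rough_path T p d) (t : R) : 'rV[R]_(hatd d) :=
  row_mx (row_mx (const_mx t : 'rV_1) (rp_path X t)) (bracket_row X t).

Definition space_index (i : 'I_d) : 'I_(hatd d) :=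
  lshift _ (rshift 1 i).

(* Xh is the canonical lift of the extended path (t, X_t, Q(X)_t). *)
Definition is_extension (X : rough_path T p d) (Xh : rough_path T p (hatd d)) :
    Prop :=
  [/\ (forall t, 0 <= t <= T -> rp_path Xh t = extended_path X t),
      (forall s t, Delta T (s, t) -> forall i j : 'I_d,
         rp_area Xh s t (space_index i) (space_index j) = rp_area X s t i j) &
      (forall s t, Delta T (s, t) -> forall i j : 'I_(hatd d),
         ~ ((exists i', i = space_index i') /\
            (exists j', j = space_index j')) ->
         is_young_integral
           (fun r => rp_path Xh r ord0 i - rp_path Xh s ord0 i)
           (fun r => rp_path Xh r ord0 j) s t (rp_area Xh s t i j))].

Definition extended_rough_path : set (rough_path T p (hatd d)) :=
  [set Xh | exists X : rough_path T p d, is_extension X Xh].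

End extended.

(* T((R^m)): a formal tensor series is given by its coordinates a_I, indexed by
   the words I over 'I_m.  T(R^m): those with finitely many nonzero
   coordinates. *)
Definition tensor_series (R : realType) (m : nat) : Type := seq 'I_m -> R.

Definition tensor_algebra (R : realType) (m : nat) : Type :=
  {fsfun seq 'I_m -> R with 0}.

Section tensors.
Context {R : realType} {m : nat}.
Implicit Types a b : tensor_series R m.

Definition tensor_mul a b : tensor_series R m :=
  fun I => \sum_(k < (size I).+1) a (take k I) * b (drop k I).

Definition tensor_pairing (l : tensor_algebra R m) a : R :=
  \sum_(I <- finsupp l) l I * a I.

Definition level_norm (n : nat) a : R :=
  Num.sqrt (\sum_(I : n.-tuple 'I_m) a I ^+ 2).

End tensors.

Section lyons.
Context {R : realType} {T p : R} {m : nat}.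

(* Continuity into T((R^m)), which carries the product topology, is stated
   coordinatewise. *)
Definition is_lyons_extension (X : rough_path T p m)
    (S : R -> R -> tensor_series R m) : Prop :=
  [/\ (forall s t, Delta T (s, t) ->
         [/\ S s t [::] = 1,
             forall i, S s t [:: i] = (rp_path X t - rp_path X s) ord0 i &
             forall i j, S s t [:: i; j] = rp_area X s t i j]),
      (forall s u t, 0 <= s -> s <= u -> u <= t -> t <= T ->
         S s t = tensor_mul (S s u) (S u t)),
      (forall I, {within Delta T, continuous (fun z : R * R => S z.1 z.2 I)}) &
      (forall n : nat, (0 < n)%N ->
         (pvar T (p / n%:R) (fun u v => level_norm n (S u v)) < +oo)%E)].

(* Lyons' extension of X, which is determined on Delta T; the zero function is
   an irrelevant default. *)
Definition lyons_extension (X : rough_path T p m) :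
    R -> R -> tensor_series R m :=
  xget (fun _ _ _ => 0) [set S | is_lyons_extension X S].

Definition signature (X : rough_path T p m) (t : R) : tensor_series R m :=
  lyons_extension X 0 t.

End lyons.

(* Main.v *)
(* The signature coordinates, restricted to K, form an algebra of continuous
   functions that contains the constants and separates points at positive
   distance, so Stone-Weierstrass applies on the compact pseudometric space K,
   which contains K_L.

   Give the space letters weight 1, and the time and bracket letters weight 2.
   Tensor products of the local increments along a partition satisfy
   |S(w)| <= C_w omega^(weight w / q), uniformly in the partition, by cutting
   the partition where the control omega is halved; a word of weight at least 3
   is therefore negligible on fine partitions.  Together with Chen's relation
   this makes the products converge along refinement (Lyons' extension), makes
   them depend continuously on the rough path, and kills every additive
   functional of weight at least 3, which yields the quasi-shuffle identity
   S(I) S(J) = sum of S(w), where X^i X^j = X^ij + X^ji + Q^ij is the length-one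
   case.

   For separation, S(w 0) is the time integral of S(w), so the words w 0...0
   evaluated at T give the moments of the path t |-> S_(0,t)(w), hence the path
   itself, and words of length one and two give back the rough path. *)
Require Import Defs.
From mathcomp Require Import all_boot all_order all_algebra.
From mathcomp Require Import finmap.
From mathcomp Require Import all_classical all_reals all_analysis.
From mathcomp Require Import ring lra zify.

Set Implicit Arguments.
Unset Strict Implicit.
Unset Printing Implicit Defensive.

Import Order.TTheory GRing.Theory Num.Theory.
Import numFieldNormedType.Exports.

Local Open Scope classical_set_scope.
Local Open Scope ring_scope.

(** * Words and tensor series *)

(** A rough path that is not geometric violates the shuffle identity: products of coordinates
    acquire bracket terms. Giving a bracket letter the weight of the two space letters it contracts
    makes all words of a quasi-shuffle product equally heavy, so that a single threshold, weight 3 >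
    [p], governs every estimate. The control is an increment [V v - V u] of a variation function,
    and [V] may jump. Estimates therefore use an exponent [q] strictly between [p] and 3: a power of
    the largest local size comes out and supplies smallness, while [V] only has to supply
    summability. Constants and thresholds depend on the path through a bound on its variation alone,
    so one partition serves a whole neighbourhood in [K]. This is why one criterion,
    [multiplicative_cvg], stated for an arbitrary filter, yields both the convergence of products
    along refinements and the continuity in the rough path. It needs no rate: at weight 3 or more, a
    coordinate is a polynomial in shorter ones up to a small partition sum. Integrals against time
    are never formed; primitives and the mean value theorem replace them. *)

Section tensors.
Context {R : realType} {m : nat}.
Implicit Types (a b c : tensor_series R m) (w : seq 'I_m).

Lemma tensor_mul_nil a b : tensor_mul a b [::] = a [::] * b [::].
Proof. by rewrite /tensor_mul big_ord1. Qed.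

Lemma tensor_mul_cons a b i w : tensor_mul a b (i :: w) =
  a [::] * b (i :: w) + tensor_mul (fun v => a (i :: v)) b w.
Proof. by rewrite /tensor_mul big_ord_recl. Qed.

Lemma tensor_mulDl a a' b w :
  tensor_mul (fun v => a v + a' v) b w = tensor_mul a b w + tensor_mul a' b w.
Proof. by rewrite -big_split; apply: eq_bigr => k _; rewrite mulrDl. Qed.

Lemma tensor_mulZl x a b w :
  tensor_mul (fun v => x * a v) b w = x * tensor_mul a b w.
Proof. by rewrite mulr_sumr; apply: eq_bigr => k _; rewrite mulrA. Qed.

Lemma tensor_mulA a b c :
  tensor_mul a (tensor_mul b c) = tensor_mul (tensor_mul a b) c.
Proof.
apply/funext => w; elim: w a b => [|i w IHw] a b.
  by rewrite !tensor_mul_nil mulrA.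
rewrite !tensor_mul_cons IHw tensor_mul_nil mulrDr mulrA -addrA; congr (_ + _).
rewrite -tensor_mulZl -tensor_mulDl.
by congr tensor_mul; apply/funext => v; rewrite tensor_mul_cons.
Qed.

Definition tensor1 : tensor_series R m := fun w => (w == [::])%:R.

Lemma tensor_mul1 a : tensor_mul tensor1 a = a.
Proof.
apply/funext => -[|i w]; first by rewrite tensor_mul_nil mul1r.
rewrite tensor_mul_cons mul1r (_ : tensor_mul _ _ _ = 0) ?addr0//.
by rewrite /tensor_mul big1// => k _; rewrite /tensor1/= mul0r.
Qed.

(* The two improper splits are isolated: they are the only ones involving the
   full word. *)
Definition proper_mul a b w : R :=
  \sum_(1 <= k < size w) a (take k w) * b (drop k w).

Lemma tensor_mul_proper a b w : w != [::] -> a [::] = 1 -> b [::] = 1 ->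
  tensor_mul a b w = a w + b w + proper_mul a b w.
Proof.
case: w => // i w _ a1 b1.
rewrite /tensor_mul -(big_mkord xpredT (fun k => a (take k (i :: w)) * b (drop k (i :: w)))).
rewrite big_nat_recr// big_nat_recl// drop0 take0 take_oversize// drop_oversize//.
rewrite a1 b1 mul1r mulr1 /proper_mul big_add1/= addrC addrA; congr (_ + _).
Qed.

Lemma ler_proper_mul a b w (y : R) :
  (forall k, (0 < k < size w)%N ->
    `|a (take k w)| * `|b (drop k w)| <= y) -> 0 <= y ->
  `|proper_mul a b w| <= (size w)%:R * y.
Proof.
move=> aby y0; rewrite /proper_mul (le_trans (ler_norm_sum _ _ _))//.
rewrite (@le_trans _ _ (\sum_(1 <= k < size w) y))//.
  rewrite big_nat_cond [leRHS]big_nat_cond ler_sum// => k /andP[kw _].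
  by rewrite normrM aby.
by rewrite sumr_const_nat mulr_natl ler_wpMn2l// leq_subr.
Qed.

End tensors.

(** * Partition sums *)

Section partitions.
Context {R : realType}.
Implicit Types (a b u v delta : R) (s : seq R) (F G D : R -> R -> R).

Lemma partition_sum_nil a b F : partition_sum a b [::] F = 0.
Proof. by rewrite /partition_sum big_geq. Qed.

Lemma partition_sum_cons a b u s F :
  partition_sum a b (u :: s) F = F a u + partition_sum u b s F.
Proof. by rewrite /partition_sum /= big_nat_recl. Qed.

Lemma partition_sumD a b s F G :
  partition_sum a b s (fun u v => F u v + G u v) =
  partition_sum a b s F + partition_sum a b s G.
Proof. exact: big_split. Qed.

Lemma partition_sumZ a b s c F :
  partition_sum a b s (fun u v => c * F u v) = c * partition_sum a b s F.
Proof. by rewrite mulr_sumr. Qed.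

Lemma ler_norm_partition_sum a b s F :
  `|partition_sum a b s F| <= partition_sum a b s (fun u v => `|F u v|).
Proof. exact: ler_norm_sum. Qed.

Definition fine_partition delta a b s : bool :=
  path (fun u v => (u < v) && (v - u < delta)) a s && (last a s == b).

Lemma fine_partition_le delta a b s : fine_partition delta a b s -> a <= b.
Proof.
move=> /andP[+ /eqP<-]; elim: s a => //= u s IHs a /andP[/andP[au _]] /IHs.
exact/le_trans/ltW.
Qed.

Lemma fine_partition_cons delta a b u s : fine_partition delta a b (u :: s) ->
  [/\ a < u, u - a < delta, u <= b & fine_partition delta u b s].
Proof.
rewrite /fine_partition /= -andbA -andbA => /and3P[au ua us]; split => //.
exact: (@fine_partition_le delta _ _ s).
Qed.

Lemma fine_partition_sub delta delta' a b s : delta <= delta' ->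
  fine_partition delta a b s -> fine_partition delta' a b s.
Proof.
move=> dd' /andP[+ sb]; rewrite /fine_partition sb andbT.
by apply: sub_path => u v /andP[-> /=] /lt_le_trans; exact.
Qed.

Lemma itv_partition_finer delta a b s : b - a < delta ->
  itv_partition a b s -> fine_partition delta a b s.
Proof.
move=> bad [+ sb]; rewrite /fine_partition sb andbT.
have lastb (c : R) t : path <%O c t -> c <= last c t.
  by elim: t c => //= v t IHt c /andP[/ltW cv] /IHt; apply: le_trans.
suff H c : a <= c -> last c s <= b -> path <%O c s ->
    path (fun u v => (u < v) && (v - u < delta)) c s.
  by apply: H => //; rewrite (eqP sb).
elim: s c {sb} => //= u s IHs c ac sb /andP[cu us].
have ub : u <= b := le_trans (lastb _ _ us) sb.
by rewrite cu IHs ?(le_trans ac (ltW cu))// andbT/=; lra.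
Qed.

(** No step of a partition reaches the length [b - a + 1], so results on fine partitions also cover
    partitions without a mesh condition. *)
Lemma itv_partition_fine a b s :
  itv_partition a b s -> fine_partition (b - a + 1) a b s.
Proof. by apply: itv_partition_finer; rewrite ltrDl. Qed.

Lemma fine_partition_itv delta a b s :
  fine_partition delta a b s -> itv_partition a b s.
Proof. by move=> /andP[ps ls]; split => //; apply: sub_path ps => u v /andP[]. Qed.

Lemma fine_partition_exists delta a b : 0 < delta -> a <= b ->
  exists s, fine_partition delta a b s.
Proof.
move=> d0 ab.
suff H n : b - a < (delta / 2) *+ n -> exists s, fine_partition delta a b s.
  apply: (H (Num.truncn ((b - a) / (delta / 2))).+1).
  rewrite -mulr_natr -ltr_pdivrMl ?divr_gt0// mulrC.
  by rewrite truncnS_gt.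
elim: n a ab => [|n IHn] a ab; first by rewrite mulr0n; lra.
rewrite mulrS => abn.
have [ba|ab2] := leP (b - a) (delta / 2).
  have [<-|nab] := eqVneq a b; first by exists [::]; rewrite /fine_partition/= eqxx.
  exists [:: b]; rewrite /fine_partition/= eqxx andbT andbT.
  by rewrite lt_neqAle nab ab/=; lra.
have [||s /andP[ps ls]] := IHn (a + delta / 2); [lra|lra|].
by exists (a + delta / 2 :: s); rewrite /fine_partition/= ps ls !andbT; apply/andP; split; lra.
Qed.

Lemma ler_partition_sum delta a b s F G : fine_partition delta a b s ->
  (forall u v, a <= u -> u < v -> v - u < delta -> v <= b -> F u v <= G u v) ->
  partition_sum a b s F <= partition_sum a b s G.
Proof.
elim: s a => [|u s IHs] a; first by rewrite !partition_sum_nil.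
move=> /fine_partition_cons[au ua ub us] FG; rewrite !partition_sum_cons.
rewrite lerD ?FG// IHs// => x y ux; apply: FG; exact: le_trans (ltW au) ux.
Qed.

Lemma additive_partition_sum a b s D : itv_partition a b s ->
  D b b = 0 ->
  (forall u v, a <= u -> u <= v -> v <= b -> D u b = D u v + D v b) ->
  partition_sum a b s D = D a b.
Proof.
move=> /itv_partition_fine; move: (b - a + 1) => delta + Db.
elim: s a => [|u s IHs] a.
  by rewrite partition_sum_nil => /andP[/=_ /eqP->].
move=> /fine_partition_cons[au _ ub us] DD.
rewrite partition_sum_cons (IHs _ us) ?(DD a u) ?(ltW au)// => x y ux.
by apply: DD; exact: le_trans (ltW au) ux.
Qed.

Lemma partition_sum_telescope a b s (V : R -> R) : itv_partition a b s ->
  partition_sum a b s (fun u v => V v - V u) = V b - V a.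
Proof.
by move=> /additive_partition_sum ->; rewrite ?subrr// => u v _ _ _; ring.
Qed.

(** The remainder condition of the sewing lemma in summed form: no rate in [v - u] is asked for,
    only that the absolute sums tend to 0 with the mesh. *)
Definition vanishing a b D : Prop := forall e, 0 < e ->
  exists2 delta, 0 < delta & forall s, fine_partition delta a b s ->
    partition_sum a b s (fun u v => `|D u v|) <= e.

Lemma vanishingD a b D D' : vanishing a b D -> vanishing a b D' ->
  vanishing a b (fun u v => D u v + D' u v).
Proof.
move=> h h' e e0; have e20 : 0 < e / 2 by lra.
have [d d0 hd] := h _ e20; have [d' d'0 hd'] := h' _ e20.
exists (Num.min d d'); first by rewrite lt_min d0.
move=> s sf; rewrite (splitr e).
apply: le_trans (lerD (hd s _) (hd' s _)); last 2 first.
- by apply: fine_partition_sub sf; rewrite ge_min lexx.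
- by apply: fine_partition_sub sf; rewrite ge_min lexx orbT.
by rewrite -partition_sumD; apply: ler_partition_sum sf _ => *; exact: ler_normD.
Qed.

Lemma vanishing_le a b D D' c : vanishing a b D -> 0 <= c ->
  (forall u v, a <= u -> u <= v -> v <= b -> `|D' u v| <= c * `|D u v|) ->
  vanishing a b D'.
Proof.
move=> h c0 DD' e e0.
have [|d d0 hd] := h (e / (c + 1)); first by rewrite divr_gt0// ltr_wpDl.
exists d => // s sf; have := hd _ sf.
rewrite ler_pdivlMr ?ltr_wpDl// => /(le_trans _); apply.
apply: (@le_trans _ _ (partition_sum a b s (fun u v => (c + 1) * `|D u v|))).
  apply: ler_partition_sum sf _ => u v au /ltW uv _ vb.
  by rewrite (le_trans (DD' _ _ au uv vb))// ler_wpM2r// lerDl.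
by rewrite partition_sumZ mulrC.
Qed.

Lemma vanishing_sum (I : Type) (r : seq I) a b (D : I -> R -> R -> R) :
  (forall i, vanishing a b (D i)) ->
  vanishing a b (fun u v => \sum_(i <- r) D i u v).
Proof.
move=> h; elim: r => [|i r IHr].
  move=> e e0; exists 1 => // s _; rewrite /partition_sum big1 ?ltW// => k _.
  by rewrite big_nil normr0.
suff -> : (fun u v => \sum_(i <- i :: r) D i u v) =
    (fun u v => D i u v + \sum_(i <- r) D i u v) by exact: vanishingD.
by apply/funext => u; apply/funext => v; rewrite big_cons.
Qed.

(** Additivity makes every partition sum equal to [D a b], and fine ones are arbitrarily small: the
    uniqueness half of the sewing lemma. Uniqueness of the extension and the quasi-shuffle identity
    both rest on it. *)
Lemma vanishing_additive0 a b D : a <= b -> vanishing a b D ->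
  D b b = 0 ->
  (forall u v, a <= u -> u <= v -> v <= b -> D u b = D u v + D v b) ->
  D a b = 0.
Proof.
move=> ab h Db DD; apply/normr0_eq0/eqP; rewrite eq_le normr_ge0 andbT.
apply/ler_addgt0Pr => e e0; rewrite add0r.
have [d d0 hd] := h _ e0; have [s sf] := fine_partition_exists d0 ab.
rewrite -(additive_partition_sum (fine_partition_itv sf) Db DD).
exact: le_trans (ler_norm_partition_sum _ _ _ _) (hd _ sf).
Qed.

End partitions.

(** * Bounds on products of local increments *)

Section product_bound.
Context {R : realType} {m : nat}.
Variable wt : 'I_m -> nat.
Hypothesis wt_gt0 : forall i, (0 < wt i)%N.
Implicit Types (s t u v a b kappa c : R) (l : seq R) (w : seq 'I_m).
Implicit Types (Xi : R -> R -> tensor_series R m) (V : R -> R).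

Definition weight w : nat := sumn (map wt w).

Lemma weight_cat w w' : weight (w ++ w') = (weight w + weight w')%N.
Proof. by rewrite /weight map_cat sumn_cat. Qed.

Lemma weight_split k w : weight w = (weight (take k w) + weight (drop k w))%N.
Proof. by rewrite -weight_cat cat_take_drop. Qed.

Lemma size_weight w : (size w <= weight w)%N.
Proof.
by elim: w => //= i w IHw; rewrite -add1n leq_add.
Qed.

Lemma weight_proper k w : (0 < k < size w)%N ->
  (0 < weight (take k w))%N /\ (0 < weight (drop k w))%N.
Proof.
move=> /andP[k0 kw]; split; apply: leq_trans (size_weight _).
  by rewrite size_take kw.
by rewrite size_drop subn_gt0.
Qed.

Fixpoint tensor_prod Xi s l : tensor_series R m :=
  if l is u :: l' then tensor_mul (Xi s u) (tensor_prod Xi u l') else tensor1.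

Lemma tensor_prod_cat Xi s l l' : tensor_prod Xi s (l ++ l') =
  tensor_mul (tensor_prod Xi s l) (tensor_prod Xi (last s l) l').
Proof.
by elim: l s => [|u l IHl] s /=; rewrite ?tensor_mul1// IHl tensor_mulA.
Qed.

Lemma tensor_prod_nil Xi s l : (forall u v, Xi u v [::] = 1) ->
  tensor_prod Xi s l [::] = 1.
Proof.
by move=> Xi1; elim: l s => //= u l IHl s; rewrite tensor_mul_nil Xi1 IHl mulr1.
Qed.

Lemma ler_tensor_mul a b w (A B y : R) (x z : tensor_series R m) :
  0 <= y -> 0 <= A -> 0 <= B ->
  (forall k, `|x (take k w)| <= A * y ^+ weight (take k w)) ->
  (forall k, `|z (drop k w)| <= B * y ^+ weight (drop k w)) ->
  `|tensor_mul x z w| <= (size w).+1%:R * (A * B) * y ^+ weight w.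
Proof.
move=> y0 A0 B0 xA zB; rewrite /tensor_mul (le_trans (ler_norm_sum _ _ _))//.
rewrite (@le_trans _ _ (\sum_(k < (size w).+1) A * B * y ^+ weight w))//.
  apply: ler_sum => k _; rewrite normrM [weight w](weight_split k) exprD mulrACA.
  by rewrite ler_pM.
by rewrite sumr_const card_ord -[leRHS]mulrA mulr_natl.
Qed.

Lemma ler_proper_mul_weight w (A B y : R) (x z : tensor_series R m) :
  0 <= y -> 0 <= A -> 0 <= B ->
  (forall k, (0 < k < size w)%N -> `|x (take k w)| <= A * y ^+ weight (take k w)) ->
  (forall k, (0 < k < size w)%N -> `|z (drop k w)| <= B * y ^+ weight (drop k w)) ->
  `|proper_mul x z w| <= (size w)%:R * (A * B) * y ^+ weight w.
Proof.
move=> y0 A0 B0 xA zB; rewrite -mulrA; apply: ler_proper_mul; last first.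
  by rewrite !mulr_ge0 ?exprn_ge0.
move=> k kw; rewrite [weight w](weight_split k) exprD mulrACA.
by rewrite ler_pM// ?xA ?zB.
Qed.

(** Chen's relation is asked only up to weight 2; on heavier words the family need only be bounded.
    The exponent [kappa] plays the role of [1 / p], and [V] is monotone but may jump. *)
Definition almost_rough kappa c V a b Xi : Prop :=
  [/\ forall u v, a <= u -> u <= v -> v <= b -> V u <= V v,
      forall u v, Xi u v [::] = 1,
      forall u v w, a <= u -> u <= v -> v <= b ->
        `|Xi u v w| <= c * ((V v - V u) `^ kappa) ^+ weight w &
      forall s u t w, a <= s -> s <= u -> u <= t -> t <= b ->
        (weight w <= 2)%N -> tensor_mul (Xi s u) (Xi u t) w = Xi s t w].

Lemma lt_path_le_last s l : path <%O s l -> s <= last s l.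
Proof. by elim: l s => //= u l IHl s /andP[/ltW su] /IHl; apply: le_trans. Qed.

Lemma eq_tensor_mul (x x' z z' : tensor_series R m) w :
  (forall k, x (take k w) = x' (take k w)) ->
  (forall k, z (drop k w) = z' (drop k w)) ->
  tensor_mul x z w = tensor_mul x' z' w.
Proof. by move=> xx' zz'; apply: eq_bigr => k _; rewrite xx' zz'. Qed.

Lemma almost_rough_diag kappa c V a b Xi s w : 0 < kappa ->
  almost_rough kappa c V a b Xi -> a <= s -> s <= b -> Xi s s w = tensor1 w.
Proof.
move=> k0 [_ Xi1 Xic _] as_ sb; case: w => [|i w]; first by rewrite Xi1.
have := Xic s s (i :: w) as_ (lexx _) sb.
rewrite subrr powR0 ?gt_eqF// expr0n gtn_eqF/=; last first.
  by rewrite addn_gt0 wt_gt0.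
by rewrite mulr0 normr_le0 => /eqP.
Qed.

Lemma tensor_prod_low kappa c V a b Xi s l w : 0 < kappa ->
  almost_rough kappa c V a b Xi ->
  a <= s -> path <%O s l -> last s l <= b -> (weight w <= 2)%N ->
  tensor_prod Xi s l w = Xi s (last s l) w.
Proof.
move=> k0 rXi; elim: l s w => [|u l IHl] s w as_ /=.
  by move=> _ sb _; rewrite (almost_rough_diag w k0 rXi).
move=> /andP[/ltW su us] lb w2; have au := le_trans as_ su.
case: (rXi) => _ _ _ chen; rewrite -(chen s u)//; last exact: lt_path_le_last.
apply: eq_tensor_mul => // k; apply: IHl => //.
by apply: leq_trans w2; rewrite [leqRHS](weight_split k) leq_addl.
Qed.

(** A discrete intermediate value theorem. As [V] may jump over the level [x], the crossing step
    from [last s l1] to [u] is set apart, and the two remaining blocks lie on either side of the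
    level. *)
Lemma split_at_level V x s l : V s <= x -> x <= V (last s l) -> l != [::] ->
  exists l1 u l2, [/\ l = l1 ++ u :: l2, V (last s l1) <= x & x <= V u].
Proof.
elim: l s => //= y l IHl s Vs Vl _; have [xy|/ltW yx] := leP x (V y).
  by exists [::], y, l.
have [l0|l0] := eqVneq l [::].
  by exists [::], y, l; split => //; move: Vl; rewrite l0.
have [l1 [u [l2 [-> V1 Vu]]]] := IHl y yx Vl l0.
by exists (y :: l1), u, l2.
Qed.

(* Cutting at the point that halves V gives, for the top-weight constant C',
   C' <= 2 * 2 ^ (- kappa N) * C' + (lower weights), which closes because
   3 kappa > 1. *)
Lemma ler_tensor_prod kappa c N : 1 < 3 * kappa -> 1 <= c ->
  exists2 C, 1 <= C & forall Xi V a b, almost_rough kappa c V a b Xi ->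
    forall s l w, a <= s -> path <%O s l -> last s l <= b ->
      (weight w <= N)%N ->
      `|tensor_prod Xi s l w| <= C * ((V (last s l) - V s) `^ kappa) ^+ weight w.
Proof.
move=> k1 c1; have k0 : 0 < kappa by lra.
have c0 : 0 <= c by lra.
elim: N => [|N [C C1 IHN]].
  exists c => // Xi V a b rXi s l w as_ sl lb w0.
  rewrite (tensor_prod_low k0 rXi)//; last by rewrite (leq_trans w0).
  by case: rXi => _ _ + _; apply => //; exact: lt_path_le_last.
have [N1|N2] := leqP N.+1 2.
  exists c => // Xi V a b rXi s l w as_ sl lb w0.
  rewrite (tensor_prod_low k0 rXi)//; last by rewrite (leq_trans w0).
  by case: rXi => _ _ + _; apply => //; exact: lt_path_le_last.
have C0 : 0 <= C by lra.
pose rho : R := (2^-1) `^ kappa.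
have rho0 : 0 <= rho by exact: powR_ge0.
have rho1 : rho <= 1.
  apply: (@le_trans _ _ (1 `^ kappa)); last by rewrite powR1.
  by rewrite ge0_ler_powR ?nnegrE ?(ltW k0)//; lra.
have rho3 : 2 * rho ^+ 3 < 1.
  have -> : rho ^+ 3 = 2^-1 `^ (3 * kappa).
    by rewrite mulrC powRrM powR_mulrn// powR_ge0.
  rewrite -mulr_powRB1//; last by lra.
  rewrite mulrA divff// mul1r.
  apply: (@lt_le_trans _ _ (1 `^ (3 * kappa - 1))); last by rewrite powR1.
  by rewrite gt0_ltr_powR ?nnegrE//; lra.
pose K := c + N.+1%:R * (c * C) + N.+1%:R * (C * (N.+1%:R * (c * C))).
have K0 : 0 <= K by rewrite !addr_ge0 ?mulr_ge0.
pose C' := C + K / (1 - 2 * rho ^+ 3).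
have CC' : C <= C' by rewrite lerDl divr_ge0// subr_ge0 ltW.
have C'0 : 0 <= C' := le_trans C0 CC'.
have C'K : 2 * rho ^+ 3 * C' + K <= C'.
  have : K / (1 - 2 * rho ^+ 3) * (1 - 2 * rho ^+ 3) = K.
    by rewrite divfK// gt_eqF// subr_gt0.
  have : 0 <= C * (1 - 2 * rho ^+ 3) by rewrite mulr_ge0// subr_ge0 ltW.
  rewrite /C'; move: (K / _) => z; nra.
exists C'; first exact: le_trans C1 CC'.
move=> Xi V a b rXi s l w as_ + + wN; have [wN1|wN1] := leqP (weight w) N.
  move=> sl lb; apply: le_trans (IHN _ _ _ _ rXi _ _ _ as_ sl lb wN1) _.
  by rewrite ler_wpM2r// exprn_ge0// powR_ge0.
have {wN}wN : weight w = N.+1 by apply/eqP; rewrite eqn_leq wN.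
(* The constant [C'] has to serve lists of any length, hence an induction on the length of the list
   inside the induction on the weight. *)
rewrite wN; have [n] := ubnP (size l); elim: n s l as_ => // n IHn s l as_ ln sl lb.
have w0 : w != [::] by apply: contra_eq_neq wN => ->.
have [l0|l0] := eqVneq l [::].
  by rewrite l0/= /tensor1 (negPf w0) normr0 mulr_ge0// exprn_ge0// powR_ge0.
case: (rXi) => Vmono Xi1 Xic Xichen.
pose Phi := (V (last s l) - V s) `^ kappa.
have Phi0 : 0 <= Phi by exact: powR_ge0.
have sl' := lt_path_le_last sl.
have Vsl : V s <= V (last s l) by exact: Vmono.
have [||l1 [u [l2 [lE V1 V2]]]] := @split_at_level V ((V s + V (last s l)) / 2) s l _ _ l0.
- lra.
- lra.
rewrite -/Phi; pose x := last s l1.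
have /and3P[sl1 xu ul2] : [&& path <%O s l1, x < u & path <%O u l2].
  by move: sl; rewrite lE cat_path.
have lastE : last s l = last u l2 by rewrite lE last_cat.
have sx := lt_path_le_last sl1; have ul := lt_path_le_last ul2.
rewrite -/x in sx V1; rewrite -lastE in ul.
have xl : x <= last s l by exact: le_trans (ltW xu) ul.
have Phi1 u' v' : s <= u' -> u' <= v' -> v' <= last s l ->
    (V v' - V u') `^ kappa <= Phi.
  move=> su' uv vl; have := Vmono _ _ (le_trans as_ su') uv (le_trans vl lb).
  have := Vmono _ _ as_ su' (le_trans uv (le_trans vl lb)).
  have := Vmono _ _ (le_trans as_ (le_trans su' uv)) vl lb.
  by move=> *; rewrite ge0_ler_powR ?nnegrE ?(ltW k0)//; lra.
have Phi2 v' : 0 <= v' -> v' <= (V (last s l) - V s) / 2 ->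
    v' `^ kappa <= rho * Phi.
  move=> v0 vV; rewrite -powRM//; last by rewrite subr_ge0.
  by rewrite ge0_ler_powR ?nnegrE ?(ltW k0)//; lra.
have low (z z' : R) (k : nat) : 0 <= z -> 0 <= z' -> z <= z' -> z ^+ k <= z' ^+ k.
  by move=> *; exact: lerXn2r.
have P1 (v : seq 'I_m) : (weight v <= N)%N -> `|tensor_prod Xi s l1 v| <= C * Phi ^+ weight v.
  move=> vN; apply: le_trans (IHN _ _ _ _ rXi _ _ _ as_ sl1 (le_trans xl lb) vN) _.
  by rewrite ler_wpM2l// low ?powR_ge0// Phi1.
have au : a <= u by rewrite (le_trans as_)// (le_trans sx)// ltW.
have P2 (v : seq 'I_m) : (weight v <= N)%N -> `|tensor_prod Xi u l2 v| <= C * Phi ^+ weight v.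
  move=> vN; apply: le_trans (IHN _ _ _ _ rXi u l2 v au ul2 _ vN) _.
    by rewrite -lastE.
  by rewrite -lastE ler_wpM2l// low ?powR_ge0// Phi1// (le_trans sx)// ltW.
have PX (v : seq 'I_m) : `|Xi x u v| <= c * Phi ^+ weight v.
  apply: le_trans (Xic _ _ _ (le_trans as_ sx) (ltW xu) (le_trans ul lb)) _.
  by rewrite ler_wpM2l// low ?powR_ge0// Phi1// ltW.
have lw k : (0 < k < size w)%N -> (weight (take k w) <= N)%N /\ (weight (drop k w) <= N)%N.
  move=> /weight_proper[w1 w2]; have wE := weight_split k w.
  by split; [rewrite -ltnS -wN wE -[X in (X < _)%N]addn0 ltn_add2l
            | rewrite -ltnS -wN wE -[X in (X < _)%N]add0n ltn_add2r].
pose Q := tensor_mul (Xi x u) (tensor_prod Xi u l2).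
have Q1 (v : seq 'I_m) : (weight v <= N)%N -> `|Q v| <= N.+1%:R * (c * C) * Phi ^+ weight v.
  move=> vN; apply: (@le_trans _ _ ((size v).+1%:R * (c * C) * Phi ^+ weight v)).
    apply: ler_tensor_mul => // k; apply: P2; apply: leq_trans vN.
    by rewrite [leqRHS](weight_split k) leq_addl.
  rewrite ler_wpM2r ?exprn_ge0// ler_wpM2r ?mulr_ge0// ler_nat ltnS.
  exact: leq_trans (size_weight _) vN.
have sw : (size w)%:R <= N.+1%:R :> R by rewrite ler_nat -wN size_weight.
have PhiN : 0 <= Phi ^+ N.+1 by rewrite exprn_ge0.
(* Each outer block carries at most half of the increase of [V]. As the weight [N.+1] is at least 3
   here, the gain [rho ^+ N.+1] may be weakened to [rho ^+ 3]. *)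
have top l' s' : `|tensor_prod Xi s' l' w| <= C' * ((V (last s' l') - V s') `^ kappa) ^+ N.+1 ->
    0 <= V (last s' l') - V s' -> V (last s' l') - V s' <= (V (last s l) - V s) / 2 ->
    `|tensor_prod Xi s' l' w| <= rho ^+ 3 * C' * Phi ^+ N.+1.
  move=> h V'0 V'1; apply: le_trans h _; rewrite [rho ^+ 3 * _]mulrC -mulrA ler_wpM2l//.
  apply: (@le_trans _ _ ((rho * Phi) ^+ N.+1)).
    by rewrite low ?powR_ge0 ?mulr_ge0// Phi2.
  by rewrite exprMn ler_wpM2r// ler_wiXn2l.
have sizel : (size l1 + size l2 < n)%N by move: ln; rewrite lE size_cat addnS.
have T1 : `|tensor_prod Xi s l1 w| <= rho ^+ 3 * C' * Phi ^+ N.+1.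
  apply: top.
  - apply: IHn => //; first by exact: (leq_ltn_trans (leq_addr _ _) sizel).
    exact: le_trans xl lb.
  - by rewrite subr_ge0 Vmono// (le_trans xl).
  - by rewrite -/x; lra.
have T2 : `|tensor_prod Xi u l2 w| <= rho ^+ 3 * C' * Phi ^+ N.+1.
  apply: top.
  - apply: IHn => //; first by exact: (leq_ltn_trans (leq_addl _ _) sizel).
    by rewrite -lastE.
  - by rewrite -lastE subr_ge0 Vmono.
  - by rewrite -lastE; lra.
have prodE : tensor_prod Xi s l w = tensor_prod Xi s l1 w + (Xi x u w +
    tensor_prod Xi u l2 w + proper_mul (Xi x u) (tensor_prod Xi u l2) w) +
    proper_mul (tensor_prod Xi s l1) Q w.
  rewrite lE tensor_prod_cat/= -/x tensor_mul_proper ?tensor_prod_nil//; last first.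
    by rewrite tensor_mul_nil Xi1 tensor_prod_nil// mulr1.
  by rewrite [X in _ + X + _]tensor_mul_proper ?tensor_prod_nil.
have M1 : `|proper_mul (Xi x u) (tensor_prod Xi u l2) w| <= N.+1%:R * (c * C) * Phi ^+ N.+1.
  apply: (@le_trans _ _ ((size w)%:R * (c * C) * Phi ^+ weight w)).
    by apply: ler_proper_mul_weight => // k /lw[]// _ ?; exact: P2.
  by rewrite wN ler_wpM2r// ler_wpM2r// mulr_ge0.
have M2 : `|proper_mul (tensor_prod Xi s l1) Q w| <=
    N.+1%:R * (C * (N.+1%:R * (c * C))) * Phi ^+ N.+1.
  apply: (@le_trans _ _ ((size w)%:R * (C * (N.+1%:R * (c * C))) * Phi ^+ weight w)).
    apply: ler_proper_mul_weight => //; first by rewrite !mulr_ge0.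
      by move=> k /lw[? _]; exact: P1.
    by move=> k /lw[_ ?]; exact: Q1.
  by rewrite wN ler_wpM2r// ler_wpM2r// !mulr_ge0.
have X1 := PX w; rewrite wN in X1.
rewrite prodE; apply: (@le_trans _ _ ((2 * rho ^+ 3 * C' + K) * Phi ^+ N.+1)).
  rewrite /K; move: T1 T2 M1 M2 X1; rewrite !mulrDl.
  move: (Phi ^+ _) (proper_mul _ _ _) (proper_mul _ _ _) => P Z2 Z1 T1 T2 M1 M2 X1.
  rewrite (le_trans (ler_normD _ _))//.
  have := ler_normD (tensor_prod Xi s l1 w) (Xi x u w + tensor_prod Xi u l2 w + Z1).
  have := ler_normD (Xi x u w + tensor_prod Xi u l2 w) Z1.
  have := ler_normD (Xi x u w) (tensor_prod Xi u l2 w).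
  clear -T1 T2 M1 M2 X1; lra.
by rewrite ler_wpM2r.
Qed.

End product_bound.

(** * Convergence of multiplicative families *)

Section multiplicative_families.
Context {R : realType} {m : nat}.

Lemma cauchy_approx (Y : Type) (F : set_system Y) {FF : ProperFilter F}
    (g : Y -> R) :
  (forall e, 0 < e -> exists (h : Y -> R) (l : R), h @ F --> l /\
     \forall y \near F, `|g y - h y| <= e) ->
  exists l : R, g @ F --> l.
Proof.
move=> gh; suff : cvg (g @ F) by move=> /cvg_ex.
apply: cauchy_cvg; apply: cauchy_exP => e e0.
have [|h [l [hl ghe]]] := gh (e / 2); first by rewrite divr_gt0.
exists l.
have e20 : 0 < e / 2 by rewrite divr_gt0.
have hle : \forall y \near F, `|l - h y| < e / 2 by exact: (cvgr_dist_lt h l hl _ e20).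
change (\forall y \near F, ball l e (g y)); near=> y.
have h1 : `|l - h y| < e / 2 by near: y; exact: hle.
have h2 : `|g y - h y| <= e / 2 by near: y; exact: ghe.
rewrite /ball/=.
have -> : l - g y = (l - h y) - (g y - h y) by ring.
rewrite (le_lt_trans (ler_normB _ _))// [ltRHS](splitr e).
exact: ltr_leD.
Unshelve. all: by end_near. Qed.

Lemma ex_cvg_sum (Y : Type) (F : set_system Y) {FF : ProperFilter F} (I : eqType)
    (r : seq I) (g : I -> Y -> R) :
  (forall i, i \in r -> exists l : R, g i @ F --> l) ->
  exists l : R, (fun y => \sum_(i <- r) g i y) @ F --> l.
Proof.
elim: r => [_|i r IHr gr].
  by exists 0; apply: cvg_near_cst; apply: nearW => y; rewrite big_nil.
have [|l hl] := IHr; first by move=> j jr; apply: gr; rewrite inE jr orbT.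
have [l' hl'] := gr i (mem_head _ _).
exists (l' + l).
under eq_fun do rewrite big_cons.
exact: (cvgD hl' hl).
Qed.

(** Induction on the length of the word. Subtracting from [A y s t w] its sum over a fixed partition
    leaves proper splits, which involve shorter words and converge; the subtracted sum is at most
    [e], and completeness concludes. Algebraic identities are asked only eventually, since grid
    products satisfy them only once the grid contains the points concerned. *)
Lemma multiplicative_cvg (Y : Type) (F : set_system Y) {FF : ProperFilter F}
    (A : Y -> R -> R -> tensor_series R m) (a b : R) (low : pred (seq 'I_m)) :
  (forall s t, a <= s -> s <= t -> t <= b -> \forall y \near F, A y s t [::] = 1) ->
  (forall t, a <= t -> t <= b -> \forall y \near F, A y t t = tensor1) ->
  (forall s u t, a <= s -> s <= u -> u <= t -> t <= b ->
     \forall y \near F, A y s t = tensor_mul (A y s u) (A y u t)) ->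
  (forall s t w, a <= s -> s <= t -> t <= b -> low w ->
     exists l : R, A y s t w @[y --> F] --> l) ->
  (forall s t w, a <= s -> s <= t -> t <= b -> ~~ low w -> forall e, 0 < e ->
     exists2 P, itv_partition s t P & \forall y \near F,
       partition_sum s t P (fun u v => `|A y u v w|) <= e) ->
  forall w s t, a <= s -> s <= t -> t <= b ->
    exists l : R, A y s t w @[y --> F] --> l.
Proof.
move=> A1 Ad Am Al Ah w; have [n] := ubnP (size w); elim: n w => // n IHn w wn.
move=> s t as_ st tb; have [lw|hw] := boolP (low w); first exact: Al.
have [w0|w0] := eqVneq w [::].
  exists 1; apply: cvg_near_cst; rewrite w0; exact: A1.
have cvg_eq (g h : Y -> R) : (\forall y \near F, g y = h y) ->
    (exists l : R, g @ F --> l) -> exists l : R, h @ F --> l.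
  by move=> gh [l gl]; exists l; apply: cvg_trans gl; exact: near_eq_cvg.
have cvgp s' u t' : a <= s' -> s' <= u -> u <= t' -> t' <= b ->
    exists l : R, proper_mul (A y s' u) (A y u t') w @[y --> F] --> l.
  move=> as' su ut tb'; apply: ex_cvg_sum => k; rewrite mem_index_iota => /andP[k0 kw].
  have [|l1 h1] := IHn (take k w) _ s' u as' su (le_trans ut tb').
    by rewrite size_take kw (leq_trans kw).
  have [|l2 h2] := IHn (drop k w) _ u t' (le_trans as' su) ut tb'.
    by rewrite size_drop; apply: leq_trans (wn : (size w <= n)%N); rewrite ltn_subrL k0 (leq_trans k0)// ltnW.
  by exists (l1 * l2); exact: (cvgM h1 h2).
apply: cauchy_approx => e e0; have [P sP Pe] := Ah s t w as_ st tb hw e e0.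
exists (fun y => A y s t w - partition_sum s t P (fun u v => A y u v w)).
suff [l hl] : exists l : R,
    (fun y => A y s t w - partition_sum s t P (fun u v => A y u v w)) @ F --> l.
  exists l; split => //; near=> y.
  rewrite subKr (le_trans (ler_norm_partition_sum _ _ _ _))//; near: y; exact: Pe.
move: sP => /itv_partition_fine; move: (t - s + 1) => delta {Pe}.
elim: P s as_ st => [|u P IHP] s as_ st.
  move=> /andP[/= _ /eqP ts]; exists 0; apply: cvg_near_cst.
  near=> y; rewrite partition_sum_nil subr0 ts.
  have -> : A y t t = tensor1 by near: y; apply: Ad => //; rewrite -ts.
  by rewrite /tensor1 (negPf w0).
move=> /fine_partition_cons[/ltW su _ ut uP].
have au := le_trans as_ su.
have [l1 h1] := IHP u au ut uP.
have [l2 h2] := cvgp s u t as_ su ut tb.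
apply: cvg_eq; last by exists (l1 + l2); exact: (cvgD h1 h2).
near=> y; rewrite partition_sum_cons.
have -> : A y s t = tensor_mul (A y s u) (A y u t) by near: y; exact: Am.
rewrite tensor_mul_proper//=.
- by rewrite addrfctE; ring.
- by near: y; apply: A1 => //; exact: le_trans tb.
- by near: y; apply: A1.
Unshelve. all: by end_near. Qed.

End multiplicative_families.

(** * Controls *)

Section variation_control.
Context {R : realType}.
Implicit Types (a : R -> R -> R) (T r M B : R) (V : R -> R).

Lemma partition_sum_rcons (x y v : R) s F :
  partition_sum x y (rcons s v) F = partition_sum x y s F + F (last x s) v.
Proof.
elim: s x => [|u s IHs] x /=.
  by rewrite partition_sum_cons !partition_sum_nil addr0 add0r.
by rewrite !partition_sum_cons IHs addrA.
Qed.

Lemma partition_sum_default (x y y' : R) s F :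
  partition_sum x y s F = partition_sum x y' s F.
Proof.
elim: s x => [|u s IHs] x; first by rewrite !partition_sum_nil.
by rewrite !partition_sum_cons IHs.
Qed.

Lemma itv_partition_rcons (x u v : R) s : itv_partition x u s -> u < v ->
  itv_partition x v (rcons s v).
Proof.
move=> [xs /eqP su] uv; split; last by rewrite last_rcons.
by rewrite rcons_path xs su.
Qed.

Definition control T V a : Prop :=
  forall u v, 0 <= u -> u <= v -> v <= T -> a u v <= V v - V u.

(** [V t] is the supremum of the partition sums over [[0, t]]. Appending [v] to a partition of
    [[0, u]] raises its sum by [a u v]; the diagonal hypothesis covers [u = v], where nothing can be
    appended. *)
Lemma variation_control T a B : (forall u v, 0 <= a u v) ->
  (forall u, 0 <= u -> u <= T -> a u u = 0) ->
  (forall s, itv_partition 0 T s -> partition_sum 0 T s a <= B) ->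
  0 <= T -> exists2 V, control T V a & V T - V 0 <= B.
Proof.
move=> a0 ad aB T0.
pose S t := [set partition_sum 0 t s a | s in itv_partition 0 t].
have S0 t : 0 <= t -> S t !=set0.
  rewrite le_eqVlt => /predU1P[<-|t0].
    by exists 0; exists [::]; rewrite ?partition_sum_nil//; split; rewrite /= ?eqxx.
  by exists (a 0 t); exists [:: t]; [exact: itv_partition1|
     rewrite partition_sum_cons partition_sum_nil addr0].
have step u v s : itv_partition 0 u s -> u <= v -> 0 <= u -> v <= T ->
    S v (partition_sum 0 u s a + a u v).
  move=> us; rewrite le_eqVlt => /predU1P[<-|uv] u0 vT.
    by rewrite ad// addr0; exists s.
  exists (rcons s v); first exact: itv_partition_rcons us uv.
  by rewrite partition_sum_rcons; case: us => _ /eqP ->; rewrite (partition_sum_default _ _ u).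
have Sub t x : 0 <= t -> t <= T -> S t x -> x <= B.
  move=> t0 tT [s ts <-]; have [s' Ts' E] := step _ _ _ ts tT t0 (lexx _).
  by apply: le_trans (aB _ Ts'); rewrite E lerDl.
have hsS t : 0 <= t -> t <= T -> has_sup (S t).
  by move=> t0 tT; split; [exact: S0|exists B => x; exact: Sub].
exists (fun t => sup (S t)).
  move=> u v u0 uv vT; rewrite lerBrDr addrC -lerBrDr.
  apply: ge_sup; first exact: S0.
  move=> x [s us <-]; rewrite lerBrDr; apply: ub_le_sup.
    by have [] := hsS v (le_trans u0 uv) vT.
  exact: step.
have -> : S 0 = [set 0].
  apply/seteqP; split => x.
    by move=> [s /itv_partitionxx-> <-]; rewrite partition_sum_nil.
  by move=> ->; exists [::]; rewrite ?partition_sum_nil//; split; rewrite /= ?eqxx.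
rewrite sup1 subr0; apply: ge_sup; first exact: S0.
by move=> x; exact: Sub.
Qed.

Lemma pvar_partition_sum T r a M s : 0 < r -> 0 <= M ->
  (pvar T r a <= M%:E)%E -> itv_partition 0 T s ->
  partition_sum 0 T s (fun u v => a u v `^ r) <= M `^ r.
Proof.
move=> r0 M0 aM Ts.
have := le_trans (partition_sum_le_pvar a r0 Ts) aM; rewrite lee_fin => h.
move: h; set y := partition_sum _ _ _ _ => h.
have y0 : 0 <= y by rewrite partition_sum_ge0// => u v; exact: powR_ge0.
have -> : y = (y `^ r^-1) `^ r by rewrite -powRrM mulVf ?gt_eqF// powRr1.
by rewrite ge0_ler_powR ?nnegrE ?powR_ge0// ltW.
Qed.

(** The control function avoids the partition through [u] and [v], which degenerates when some of
    [0], [u], [v], [T] coincide. *)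
Lemma ler_pvar T r a M u v : 0 < r -> 0 <= M ->
  (forall u v, 0 <= a u v) -> (forall u, 0 <= u -> u <= T -> a u u = 0) ->
  (pvar T r a <= M%:E)%E -> 0 <= u -> u <= v -> v <= T -> a u v <= M.
Proof.
move=> r0 M0 a0 ad aM u0 uv vT.
have T0 : 0 <= T by exact: le_trans u0 (le_trans uv vT).
have [||V Va VT] := @variation_control T (fun u v => a u v `^ r) (M `^ r) _ _
   (fun s => pvar_partition_sum r0 M0 aM) T0.
- by move=> *; exact: powR_ge0.
- by move=> x x0 xT; rewrite ad// powR0// gt_eqF.
have h : a u v `^ r <= M `^ r.
  have := Va 0 u (lexx _) u0 (le_trans uv vT).
  have := Va v T (le_trans u0 uv) vT (lexx _).
  have := Va _ _ u0 uv vT; have := powR_ge0 (a v T) r; have := powR_ge0 (a 0 u) r.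
  lra.
by rewrite leNgt; apply/negP => Ma; move: h; rewrite leNgt gt0_ltr_powR ?nnegrE.
Qed.

(** Of the total exponent [kappa * n], one power is kept linear and the rest is bounded through
    [q <= 1] and [x <= B]. The result is linear in [x], hence summable over a partition, and small
    with [q]. *)
Lemma ler_powR_mul (q B x kappa : R) (n : nat) : 0 < kappa -> 1 <= kappa * n%:R ->
  0 <= q -> q <= 1 -> 0 <= x -> x <= B ->
  ((q * x) `^ kappa) ^+ n <= q * (B `^ (kappa * n%:R - 1) * x).
Proof.
move=> k0 kn q0 q1 x0 xB; have qx0 : 0 <= q * x by rewrite mulr_ge0.
rewrite -powR_mulrn ?powR_ge0// -powRrM -mulr_powRB1//; last by lra.
rewrite -mulrA ler_wpM2l// mulrC ler_wpM2r// ge0_ler_powR ?nnegrE//; [lra|lra|nra].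
Qed.

End variation_control.

(** * Continuity on a subset and smallness near the diagonal *)

Section within_continuity.
Context {R : realType}.

Lemma within_continuousP (M : pseudoMetricType R) (D : set M) (g : M -> R) :
  {within D, continuous g} <->
  (forall x, D x -> forall e, 0 < e -> exists2 delta : R, 0 < delta &
     forall y, D y -> ball x delta y -> `|g x - g y| < e).
Proof.
rewrite subspace_continuousP; split => h x Dx.
  move=> e e0; have /cvgrPdist_lt/(_ e e0) := h x Dx.
  move=> /nbhs_ballP[r/= r0 xr]; exists r => // y Dy xy.
  exact: xr.
apply/cvgrPdist_lt => e e0; have [r r0 xr] := h x Dx e e0.
by apply/nbhs_ballP; exists r => // y xy Dy; exact: xr.
Qed.

(** Compactness of [[0, T]], in its near-covering form, makes the continuity at the points [(u, u)]
    uniform. *)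
Lemma diagonal_small (T : R) (g : R -> R -> R) :
  {within Delta T, continuous (fun z : R * R => g z.1 z.2)} ->
  (forall u, 0 <= u -> u <= T -> g u u = 0) ->
  forall e, 0 < e -> exists2 delta : R, 0 < delta &
    forall u v, 0 <= u -> u <= v -> v <= T -> v - u < delta -> `|g u v| < e.
Proof.
move=> /within_continuousP gc gd e e0.
have /compact_near_coveringP K := @segment_compact R 0 T.
have : \forall delta \near 0^'+, `[0, T]%classic `<=` (fun u => forall v,
    0 <= u -> u <= v -> v <= T -> v - u < delta -> `|g u v| < e).
  apply: K.
  move=> u; rewrite /= in_itv/= => /andP[u0 uT].
  have Duu : Delta T (u, u) by split => //; split.
  have [r r0 gr] := gc _ Duu e e0.
  have r20 : 0 < r / 2 by rewrite divr_gt0.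
  exists (ball u (r / 2), [set delta : R | delta < r / 2]).
    split; first exact: nbhsx_ballx.
    exact: nbhs_right_lt.
  move=> [u' delta]/= [uu' dr] v u'0 u'v vT vd.
  have D' : Delta T (u', v) by split => //; split.
  have := gr _ D'; rewrite gd// sub0r normrN; apply; split => /=.
    by apply: le_ball uu'; lra.
  move: uu'; rewrite /ball/= => uu'.
  have -> : u - v = (u - u') - (v - u') by ring.
  rewrite (le_lt_trans (ler_normB _ _))// [ltRHS](splitr r) ltr_leD//.
  by rewrite ger0_norm ?subr_ge0// ltW// (lt_trans vd).
move=> H; have [delta [d0 hd]] := filter_ex (filterI (nbhs_right_gt 0) H).
exists delta => // u v u0 uv vT; apply: hd => //.
by rewrite /= in_itv/= u0 (le_trans uv).
Qed.

Lemma ler_enorm_entry m n (A : 'M[R]_(m, n)) i j : `|A i j| <= enorm A.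
Proof.
rewrite -sqrtr_sqr ler_sqrt.
  rewrite (bigD1 i)//= (bigD1 j)//= -addrA lerDl addr_ge0//.
    by apply: sumr_ge0 => k _; exact: sqr_ge0.
  by apply: sumr_ge0 => k _; apply: sumr_ge0 => l _; exact: sqr_ge0.
by apply: sumr_ge0 => k _; apply: sumr_ge0 => l _; exact: sqr_ge0.
Qed.

Lemma enorm_diagonal_small (T : R) m n (A : R -> R -> 'M[R]_(m, n)) :
  {within Delta T, continuous (fun z : R * R => A z.1 z.2)} ->
  (forall u, 0 <= u -> u <= T -> A u u = 0) ->
  forall e, 0 < e -> exists2 delta : R, 0 < delta &
    forall u v, 0 <= u -> u <= v -> v <= T -> v - u < delta -> enorm (A u v) < e.
Proof.
move=> Ac Ad e e0.
have enc : {within Delta T, continuous (fun z : R * R => enorm (A z.1 z.2))}.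
  move: Ac; rewrite !subspace_continuousP => h z Dz.
  apply: (@cvg_comp _ _ _ (fun z : R * R => A z.1 z.2) (@enorm R m n) _ _ _ (h z Dz)).
  apply: (@cvg_comp _ _ _ (fun B : 'M[R]_(m, n) => \sum_i \sum_j B i j ^+ 2) Num.sqrt).
    2: exact: sqrt_continuous.
  apply: cvg_big => //; first exact: add_continuous.
  move=> i _; apply: cvg_big => //; first exact: add_continuous.
  move=> j _.
  apply: (@cvg_comp _ _ _ (fun B : 'M[R]_(m, n) => B i j) (fun x => x ^+ 2)).
    exact: coord_continuous.
  exact: exprn_continuous.
have [|d d0 hd] := @diagonal_small T (fun u v => enorm (A u v)) enc _ e e0.
  by move=> u u0 uT; rewrite Ad// enorm0.
by exists d => // u v u0 uv vT /(hd u v u0 uv vT); rewrite ger0_norm// enorm_ge0.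
Qed.

End within_continuity.

(** * Homogeneous size of a rough path and its control *)

Section rough_path_size.
Context {R : realType} {T p : R} {m : nat}.
Implicit Types X Y : rough_path T p m.

Definition rp_incr X u v : 'rV[R]_m := rp_path X v - rp_path X u.

Lemma rp_area_diag X u : 0 <= u -> u <= T -> rp_area X u u = 0.
Proof.
move=> u0 uT; have := rp_chen X u0 (lexx u) (lexx u) uT.
rewrite subrr /outer mulmx0 addr0 => /eqP.
by rewrite -subr_eq0 opprD addrA subrr sub0r oppr_eq0 => /eqP.
Qed.

Lemma rp_incr_diag X u : rp_incr X u u = 0.
Proof. exact: subrr. Qed.

Lemma rp_chen_entry X s u t i j : 0 <= s -> s <= u -> u <= t -> t <= T ->
  rp_area X s t i j = rp_area X s u i j + rp_area X u t i j
    + rp_incr X s u ord0 i * rp_incr X u t ord0 j.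
Proof.
move=> s0 su ut tT; rewrite (rp_chen X s0 su ut tT) !mxE big_ord1 !mxE.
by [].
Qed.

(* The homogeneous size of the increment over [u, v]; the time step enters
   with the same homogeneity as the area. *)
Definition rp_size X u v : R :=
  Num.max (enorm (rp_incr X u v))
    (Num.max (Num.sqrt (enorm (rp_area X u v))) (Num.sqrt (v - u))).

Lemma rp_size_ge0 X u v : 0 <= rp_size X u v.
Proof. by rewrite le_max enorm_ge0. Qed.

Lemma rp_size_diag X u : 0 <= u -> u <= T -> rp_size X u u = 0.
Proof.
move=> u0 uT; rewrite /rp_size rp_incr_diag rp_area_diag// !enorm0 subrr sqrtr0.
by rewrite !maxxx.
Qed.

Lemma ler_rp_incr X u v i : `|rp_incr X u v ord0 i| <= rp_size X u v.
Proof.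
by apply: le_trans (ler_enorm_entry _ _ _) _; rewrite le_max lexx.
Qed.

Lemma ler_rp_area X u v i j : `|rp_area X u v i j| <= rp_size X u v ^+ 2.
Proof.
apply: le_trans (ler_enorm_entry _ _ _) _.
rewrite -[leLHS]sqr_sqrtr ?enorm_ge0// lerXn2r ?nnegrE ?sqrtr_ge0 ?rp_size_ge0//.
by rewrite !le_max lexx orbT.
Qed.

Lemma ler_rp_time X u v : u <= v -> v - u <= rp_size X u v ^+ 2.
Proof.
move=> uv; rewrite -[leLHS]sqr_sqrtr ?subr_ge0//.
rewrite lerXn2r ?nnegrE ?sqrtr_ge0 ?rp_size_ge0//.
by rewrite !le_max lexx !orbT.
Qed.

Lemma rp_incr_continuous X :
  {within Delta T, continuous (fun z : R * R => rp_incr X z.1 z.2)}.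
Proof.
have xc : forall t, 0 <= t -> t <= T ->
    rp_path X z @[z --> within `[0, T]%classic (nbhs t)] --> rp_path X t.
  have := @rp_path_continuous _ _ _ _ X; rewrite subspace_continuousP => h t t0 tT.
  by apply: h; rewrite /= in_itv/= t0.
rewrite subspace_continuousP => -[u v] [/= u0 [uv vT]].
apply: cvgB.
  apply: (@cvg_comp _ _ _ snd (rp_path X) _ _ _ _ (xc v (le_trans u0 uv) vT)).
  move=> P /nbhs_ballP[e /= e0 eP]; apply/nbhs_ballP; exists e => // -[u' v'] [/= _ vv] [/= u'0 [uv' v'T]].
  by apply: eP => //=; rewrite in_itv/= v'T (le_trans u'0).
apply: (@cvg_comp _ _ _ fst (rp_path X) _ _ _ _ (xc u u0 (le_trans uv vT))).
move=> P /nbhs_ballP[e /= e0 eP]; apply/nbhs_ballP; exists e => // -[u' v'] [/= uu _] [/= u'0 [uv' v'T]].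
by apply: eP => //=; rewrite in_itv/= u'0 (le_trans uv').
Qed.

Lemma rp_size_small X e : 0 < e -> exists2 delta : R, 0 < delta &
  forall u v, 0 <= u -> u <= v -> v <= T -> v - u < delta -> rp_size X u v < e.
Proof.
move=> e0; have e20 : 0 < e ^+ 2 by rewrite exprn_gt0.
have [|d d0 hd] := enorm_diagonal_small (@rp_incr_continuous X) _ e0.
  by move=> *; exact: rp_incr_diag.
have [|d' d'0 hd'] := enorm_diagonal_small (@rp_area_continuous _ _ _ _ X) _ e20.
  by move=> u u0 uT; exact: rp_area_diag.
have sqrt_lt x : 0 <= x -> x < e ^+ 2 -> Num.sqrt x < e.
  by move=> x0 xe; rewrite -(ger0_norm (ltW e0)) -sqrtr_sqr ltr_sqrt.
exists (Num.min d (Num.min d' (e ^+ 2))); first by rewrite !lt_min d0 d'0.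
move=> u v u0 uv vT; rewrite !lt_min => /and3P[vd vd' ve].
by rewrite !gt_max hd// sqrt_lt ?enorm_ge0 ?hd'//= sqrt_lt ?subr_ge0.
Qed.

(** The bound [B] is chosen before the path and depends only on [M]; this is the source of all
    uniformity over [K]. *)
Lemma rp_control M : 0 < T -> 2 <= p -> exists2 B, 0 <= B &
  forall X, (rp_norm X <= M%:E)%E ->
  exists2 V, control T V (fun u v => rp_size X u v `^ p) & V T - V 0 <= B.
Proof.
move=> T0 p2; have p0 : 0 < p by lra.
(* One summand for each component of [rp_size]; the last one linearizes the power [p / 2 >= 1] of
   the time step, which is at most [T]. *)
exists (M `^ p + M `^ (p / 2) + T `^ (p / 2 - 1) * T).
  by rewrite !addr_ge0 ?mulr_ge0 ?powR_ge0 ?(ltW T0).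
move=> X XM.
have M0 : 0 <= M.
  by rewrite -lee_fin (le_trans _ XM)// adde_ge0 ?pvar_ge0.
have M1 : (pvar T p (fun u v => enorm (rp_incr X u v)) <= M%:E)%E.
  by apply: le_trans XM; rewrite leeDl ?pvar_ge0.
have M2 : (pvar T (p / 2) (fun u v => enorm (rp_area X u v)) <= M%:E)%E.
  by apply: le_trans XM; rewrite leeDr ?pvar_ge0.
apply: variation_control; rewrite ?(ltW T0)//.
- by move=> *; exact: powR_ge0.
- by move=> u u0 uT; rewrite rp_size_diag// powR0// gt_eqF.
move=> s Ts.
pose F u v := enorm (rp_incr X u v) `^ p + enorm (rp_area X u v) `^ (p / 2) +
  T `^ (p / 2 - 1) * (v - u).
apply: (@le_trans _ _ (partition_sum 0 T s F)).
  apply: ler_partition_sum (itv_partition_fine Ts) _ => u v u0 uv _ vT.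
  have sqrtp x : 0 <= x -> Num.sqrt x `^ p = x `^ (p / 2).
    by move=> x0; rewrite -powR12_sqrt// -powRrM mulrC.
  have F1 : 0 <= enorm (rp_incr X u v) `^ p by exact: powR_ge0.
  have F2 : 0 <= enorm (rp_area X u v) `^ (p / 2) by exact: powR_ge0.
  have F3 : (v - u) `^ (p / 2) <= T `^ (p / 2 - 1) * (v - u).
    have vu0 : 0 <= v - u by rewrite subr_ge0 ltW.
    rewrite -mulr_powRB1//; last by rewrite divr_gt0.
    rewrite mulrC ler_wpM2r// ge0_ler_powR ?nnegrE ?(ltW T0)//; lra.
  have F4 : 0 <= (v - u) `^ (p / 2) by exact: powR_ge0.
  have A0 := enorm_ge0 (rp_area X u v); have uv0 : 0 <= v - u by rewrite subr_ge0 ltW.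
  have := sqrtp _ A0; have := sqrtp _ uv0; rewrite /F /rp_size.
  move: (Num.sqrt (v - u)) (Num.sqrt (enorm _)) => x y xp yp.
  rewrite maxEle; case: ifP => _; first by rewrite maxEle; case: ifP => _; lra.
  lra.
rewrite !partition_sumD partition_sumZ partition_sum_telescope// subr0.
rewrite !lerD//; apply: pvar_partition_sum => //; lra.
Qed.

Lemma ler_rp_dist X Y u v M : 2 <= p -> 0 <= M -> (rp_dist X Y <= M%:E)%E ->
  0 <= u -> u <= v -> v <= T ->
  enorm (rp_incr X u v - rp_incr Y u v) <= M /\
  enorm (rp_area X u v - rp_area Y u v) <= M.
Proof.
move=> p2 M0 XY u0 uv vT; split.
  pose a u v := enorm ((rp_path X v - rp_path Y v) - (rp_path X u - rp_path Y u)).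
  have -> : enorm (rp_incr X u v - rp_incr Y u v) = a u v.
    by congr enorm; apply/matrixP => i j; rewrite !mxE; ring.
  apply: (@ler_pvar _ T p a) => //; first lra.
  - by move=> *; exact: enorm_ge0.
  - by move=> *; rewrite /a subrr enorm0.
  - by apply: le_trans XY; rewrite leeDl ?pvar_ge0.
pose a u v := enorm (rp_area X u v - rp_area Y u v).
apply: (@ler_pvar _ T (p / 2) a) => //; first lra.
- by move=> *; exact: enorm_ge0.
- by move=> *; rewrite /a !rp_area_diag// subrr enorm0.
- by apply: le_trans XY; rewrite leeDr ?pvar_ge0.
Qed.

(** Subadditivity of the square root turns an error [M] on the area into an error [Num.sqrt M] on
    the size, whence the maximum. *)
Lemma ler_rp_size_dist X Y u v M : 2 <= p -> 0 <= M -> (rp_dist X Y <= M%:E)%E ->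
  0 <= u -> u <= v -> v <= T ->
  rp_size Y u v <= rp_size X u v + Num.max M (Num.sqrt M).
Proof.
move=> p2 M0 XY u0 uv vT; have [h1 h2] := ler_rp_dist p2 M0 XY u0 uv vT.
have sub (k n : nat) (A B : 'M[R]_(k, n)) : enorm B <= enorm A + enorm (A - B).
  by rewrite -{1}(subKr A B) (le_trans (ler_enormD _ _))// enormN.
rewrite {1}/rp_size ge_max; apply/andP; split.
  by apply: le_trans (sub _ _ (rp_incr X u v) _) _; rewrite lerD// le_max ?lexx ?h1.
rewrite ge_max; apply/andP; split; last first.
  by rewrite -[leLHS]addr0 lerD// !le_max ?lexx ?M0 ?orbT.
apply: (@le_trans _ _ (Num.sqrt (enorm (rp_area X u v)) + Num.sqrt M)).
  have A0 := enorm_ge0 (rp_area X u v).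
  rewrite -[leRHS]ger0_norm ?addr_ge0 ?sqrtr_ge0// -sqrtr_sqr ler_wsqrtr//.
  apply: le_trans (sub _ _ (rp_area X u v) _) _.
  have := sqr_sqrtr A0; have := sqr_sqrtr M0.
  have := sqrtr_ge0 M; have := sqrtr_ge0 (enorm (rp_area X u v)).
  move: (Num.sqrt _) (Num.sqrt M) => x y x0 y0 yM xA; have := mulr_ge0 x0 y0; nra.
by rewrite lerD// !le_max lexx ?orbT.
Qed.

End rough_path_size.

(** * Refinement of partitions *)

Section refinement.
Context {R : realType}.
Implicit Types (s t u : R) (y : seq R).

(** The lists stand for finite sets of times, in any order and not tied to an interval, directed by
    inclusion. One filter thus serves all [[s, t]] at once, which passing to the limit in Chen's
    relation requires. *)
Definition refinement : set_system (seq R) :=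
  [set P | exists A : seq R, forall y, {subset A <= y} -> P y].

#[global] Instance refinement_filter : ProperFilter refinement.
Proof.
split; first by move=> [A /(_ A)]; apply.
split.
- by exists [::].
- move=> P Q [A AP] [B BQ]; exists (A ++ B) => y ABy; split.
    by apply: AP => x xA; rewrite ABy// mem_cat xA.
  by apply: BQ => x xB; rewrite ABy// mem_cat xB orbT.
- by move=> P Q PQ [A AP]; exists A => y /AP/PQ.
Qed.

Lemma near_refinement (A : seq R) : \forall y \near refinement, {subset A <= y}.
Proof. by exists A. Qed.

(** Leaving out [s] matches the convention for partitions and lets grids of adjacent intervals
    concatenate without repetition. For [s < t] the grid reaches [t] only if [t] belongs to [y]. *)
Definition grid y s t := [seq x <- sort <=%R (undup y) | s < x <= t].

Lemma sorted_grid y s t : sorted <%R (grid y s t).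
Proof.
apply: (sorted_filter lt_trans); rewrite sort_lt_sorted.
exact: undup_uniq.
Qed.

Lemma path_grid y s t : path <%R s (grid y s t).
Proof.
rewrite path_min_sorted ?sorted_grid//.
by apply/allP => x; rewrite mem_filter => /andP[/andP[]].
Qed.

Lemma mem_grid y s t x : (x \in grid y s t) = (s < x <= t) && (x \in y).
Proof. by rewrite mem_filter mem_sort mem_undup. Qed.

Lemma grid_diag y s : grid y s s = [::].
Proof.
apply/eqP; rewrite -size_eq0 size_filter -leqn0 leqNgt -has_count.
by apply/hasPn => x _; rewrite negb_and -leNgt -ltNge; case: leP.
Qed.

Lemma grid_cat y s u t : s <= u -> u <= t -> grid y s t = grid y s u ++ grid y u t.
Proof.
move=> su ut; apply: lt_sorted_eq; first exact: sorted_grid.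
  rewrite (sorted_pairwise lt_trans) pairwise_cat -!(sorted_pairwise lt_trans).
  rewrite !sorted_grid !andbT; apply/allrelP => x x'; rewrite !mem_grid.
  by move=> /andP[/andP[_ xu] _] /andP[/andP[ux _] _]; exact: le_lt_trans ux.
move=> x; rewrite mem_cat !mem_grid -andb_orl; congr andb.
apply/idP/idP => [/andP[sx xt]|/orP[] /andP[sx xt]].
- by rewrite sx xt andbT/=; case: leP.
- by rewrite sx (le_trans xt ut).
- by rewrite xt (le_lt_trans su sx).
Qed.

Lemma last_grid y s t : s <= t -> t \in y -> last s (grid y s t) = t.
Proof.
rewrite le_eqVlt => /predU1P[<- _|st ty]; first by rewrite grid_diag.
have tg : t \in grid y s t by rewrite mem_grid st lexx.
apply/le_anti/andP; split.
  have : last s (grid y s t) \in s :: grid y s t by exact: mem_last.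
  rewrite inE => /predU1P[->|]; first exact: ltW.
  by rewrite mem_grid => /andP[/andP[]].
have := path_grid y s t; case/splitPr: tg => l1 l2.
by rewrite cat_path last_cat => /and3P[_ _ /lt_path_le_last].
Qed.

End refinement.

(** * Extended rough paths *)

Section extended_letters.
Context {R : realType} {T p : R} {d : nat}.
Local Notation letter := 'I_(hatd d).
Local Notation rough := (rough_path T p (hatd d)).
Implicit Types (Xh : rough) (a b c : letter).

Definition is_space a : bool := [exists i : 'I_d, a == space_index i].

Definition letter_weight a : nat := if is_space a then 1 else 2.

Lemma letter_weight_gt0 a : (0 < letter_weight a)%N.
Proof. by rewrite /letter_weight; case: ifP. Qed.

Definition time_index : letter := lshift _ (lshift _ ord0).

Lemma is_spaceP a : reflect (exists i, a = space_index i) (is_space a).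
Proof. by apply: (iffP existsP) => -[i]; [move/eqP => ->; exists i|move=> ->; exists i]. Qed.

Lemma space_index_space i : is_space (space_index i).
Proof. by apply/is_spaceP; exists i. Qed.

Lemma time_not_space : ~~ is_space time_index.
Proof.
by apply/is_spaceP => -[i /(congr1 val)].
Qed.

Lemma bracket_not_space k : ~~ is_space (rshift (1 + d) k).
Proof.
apply/is_spaceP => -[i /(congr1 val)] /= E; have := ltn_ord (rshift 1 i).
by rewrite /= -E ltnNge leq_addr.
Qed.

Lemma letter_cases a : [\/ a = time_index, is_space a | exists k, a = rshift (1 + d) k].
Proof.
have [b ->|k ->] := split_ordP (a : 'I_(1 + d + _)); last by constructor 3; exists k.
have [z ->|i ->] := split_ordP b; last by constructor 2; exact: space_index_space.
by constructor 1; rewrite /time_index /= (ord1 z).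
Qed.

Lemma incr_time Xh s t : extended_rough_path Xh -> 0 <= s -> s <= t -> t <= T ->
  rp_incr Xh s t ord0 time_index = t - s.
Proof.
move=> [X [XE _ _]] s0 st tT.
rewrite /rp_incr !XE ?(le_trans s0 st) ?s0 ?(le_trans st tT)//.
by rewrite !mxE /time_index !(unsplitK (inl _)) !mxE !(unsplitK (inl _)) !mxE.
Qed.

(** Chen's relation from [0] through [s] to [t] makes the increment of the bracket local: it
    involves only data over [[s, t]]. Both orders of the pair are allowed because the bracket is
    symmetric. *)
Lemma incr_bracket (k : 'I_((d * d.+1)./2)) (i j : 'I_d) Xh s t :
  nth (i, j) (upper_pairs d) k = (i, j) \/ nth (i, j) (upper_pairs d) k = (j, i) ->
  extended_rough_path Xh -> 0 <= s -> s <= t -> t <= T ->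
  rp_incr Xh s t ord0 (rshift (1 + d) k) =
    rp_incr Xh s t ord0 (space_index i) * rp_incr Xh s t ord0 (space_index j)
    - rp_area Xh s t (space_index i) (space_index j)
    - rp_area Xh s t (space_index j) (space_index i).
Proof.
move=> kij [X [XE XA _]] s0 st tT.
have sD : Delta T (s, t) by split.
have xE u i' : 0 <= u -> u <= T -> rp_path Xh u ord0 (space_index i') = rp_path X u ord0 i'.
  move=> u0 uT; rewrite XE ?u0// /extended_path mxE (unsplitK (inl _)) mxE.
  by rewrite (unsplitK (inr _)).
have qE u : 0 <= u -> u <= T -> rp_path Xh u ord0 (rshift (1 + d) k) = bracket X u i j.
  move=> u0 uT; rewrite XE ?u0// /extended_path mxE (unsplitK (inr _)) mxE.
  rewrite (nth_map (i, j)) ?size_upper_pairs//; case: kij => ->//=.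
  rewrite /bracket /outer !mxE !big_ord1 !mxE; ring.
have t0 := le_trans s0 st; have sT := le_trans st tT.
rewrite !XA// /rp_incr !mxE !qE// !xE// /bracket /outer !mxE !big_ord1 !mxE.
rewrite !(rp_chen_entry X _ _ (lexx 0) s0 st tT) /rp_incr !mxE.
ring.
Qed.

End extended_letters.

Section local_tensor.
Context {R : realType} {T p : R} {d : nat}.
Local Notation letter := 'I_(hatd d).
Local Notation rough := (rough_path T p (hatd d)).
Implicit Types (Xh : rough) (a b c : letter) (w : seq letter).

Definition bracket_relation (a b c : letter) : Prop :=
  forall Xh s t, extended_rough_path Xh -> 0 <= s -> s <= t -> t <= T ->
  rp_incr Xh s t ord0 a * rp_incr Xh s t ord0 b =
  rp_area Xh s t a b + rp_area Xh s t b a + rp_incr Xh s t ord0 c.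

(** Bracket letters exist only for ordered pairs, so the pair is sorted first; [time_index] is a
    dummy value for pairs that are not both spatial. *)
Lemma exists_bracket_letter : exists brk : letter -> letter -> letter,
  forall a b, is_space a -> is_space b ->
    ~~ is_space (brk a b) /\ bracket_relation a b (brk a b).
Proof.
have H (ab : letter * letter) : exists c, is_space ab.1 -> is_space ab.2 ->
    ~~ is_space c /\ bracket_relation ab.1 ab.2 c.
  case: ab => a b /=.
  have [/is_spaceP[i ->]|] := boolP (is_space a); last by exists time_index.
  have [/is_spaceP[j ->]|] := boolP (is_space b); last by exists time_index.
  pose ij := if (i <= j)%N then (i, j) else (j, i).
  have ijU : ij \in upper_pairs d.
    rewrite mem_filter /ij; apply/andP; split.
      by case: ifPn => //=; rewrite -ltnNge => /ltnW.
    by apply/allpairsP; case: ifP => _; [exists (i, j)|exists (j, i)]; rewrite !mem_enum.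
  have kP : (index ij (upper_pairs d) < (d * d.+1)./2)%N.
    by rewrite -size_upper_pairs index_mem.
  exists (rshift (1 + d) (Ordinal kP)) => _ _; split; first exact: bracket_not_space.
  move=> Xh s t XE s0 st tT; rewrite (@incr_bracket _ _ _ _ _ i j)//.
    by ring.
  by rewrite /= nth_index// /ij; case: ifP; [left|right].
have [f hf] := boolp.choice H; exists (fun a b => f (a, b)) => a b.
exact: (hf (a, b)).
Qed.

(** This justifies weight 2 for time and bracket letters. The factor 3 counts the product and the
    two areas that make up a bracket increment. *)
Lemma ler_incr_not_space Xh s t a : extended_rough_path Xh -> ~~ is_space a ->
  0 <= s -> s <= t -> t <= T ->
  `|rp_incr Xh s t ord0 a| <= 3 * rp_size Xh s t ^+ 2.
Proof.
move=> XE aN s0 st tT; have z0 := sqr_ge0 (rp_size Xh s t).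
have [->|aS|[k ->]] := letter_cases a.
- rewrite incr_time// ger0_norm ?subr_ge0// (le_trans (ler_rp_time Xh st))//; lra.
- by rewrite aS in aN.
(* The case split supplies a default element for [nth]; an empty list of pairs would leave no index
   [k]. *)
case E : (upper_pairs d) => [|x l].
  have := size_upper_pairs d; rewrite E => dE; have := ltn_ord k; by rewrite -[X in (_ < X)%N]dE.
have [i [j ijE]] : exists i j, nth x (upper_pairs d) k = (i, j).
  by case: (nth _ _ _) => i j; exists i, j.
rewrite (@incr_bracket _ _ _ _ _ i j)//; last first.
  by left; rewrite -ijE; apply: set_nth_default; rewrite size_upper_pairs.
have h1 := ler_rp_incr Xh s t (space_index i).
have h2 := ler_rp_incr Xh s t (space_index j).
have h3 := ler_rp_area Xh s t (space_index i) (space_index j).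
have h4 := ler_rp_area Xh s t (space_index j) (space_index i).
have h5 : `|rp_incr Xh s t ord0 (space_index i) * rp_incr Xh s t ord0 (space_index j)|
    <= rp_size Xh s t ^+ 2 by rewrite normrM expr2 ler_pM.
rewrite (le_trans (ler_normB _ _))//.
have := ler_normB (rp_incr Xh s t ord0 (space_index i) * rp_incr Xh s t ord0 (space_index j)) (rp_area Xh s t (space_index i) (space_index j)).
lra.
Qed.

Local Notation wght := (weight (@letter_weight d)).

(** The cut is at weight 2, not at length 2: a pair with a time or bracket letter gets 0 although
    its area is a Young integral. That integral reappears as a limit of products. *)
Definition local_tensor Xh (s t : R) : tensor_series R (hatd d) := fun w =>
  match w with
  | [::] => 1
  | [:: a] => rp_incr Xh s t ord0 a
  | [:: a; b] => if is_space a && is_space b then rp_area Xh s t a b else 0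
  | _ => 0
  end.

Lemma weight_ge_size3 a b c w : (2 < wght (a :: b :: c :: w))%N.
Proof. by apply: leq_trans (size_weight (@letter_weight_gt0 d) [:: a, b, c & w]). Qed.

Lemma weight2P a b : (wght [:: a; b] <= 2)%N -> is_space a && is_space b.
Proof. by rewrite /weight/= /letter_weight; case: is_space; case: is_space. Qed.

Lemma almost_rough_local_tensor Xh kappa V s t : extended_rough_path Xh ->
  0 <= s -> s <= t -> t <= T ->
  (forall u v, s <= u -> u <= v -> v <= t -> V u <= V v) ->
  (forall u v, s <= u -> u <= v -> v <= t ->
    rp_size Xh u v <= (V v - V u) `^ kappa) ->
  almost_rough (@letter_weight d) kappa 3 V s t (local_tensor Xh).
Proof.
move=> XE s0 st tT Vm XV; split => //.
- move=> u v w su uv vt; set y := _ `^ _.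
  have y0 : 0 <= y by exact: powR_ge0.
  have Xy : rp_size Xh u v <= y by exact: XV.
  have X0 := rp_size_ge0 Xh u v.
  have Xy2 : rp_size Xh u v ^+ 2 <= y ^+ 2 by rewrite lerXn2r.
  have y20 : 0 <= y ^+ 2 by exact: sqr_ge0.
  have u0 := le_trans s0 su; have vT := le_trans vt tT.
  case: w => [|a [|b [|c w]]] /=.
  + by rewrite expr0 normr1 mulr1; lra.
  + rewrite /weight/= addn0 /letter_weight; case: ifPn => aS.
      by have := ler_rp_incr Xh u v a; rewrite expr1; lra.
    have := ler_incr_not_space XE aS u0 uv vT; lra.
  + case: ifPn => [/andP[aS bS]|_]; last by rewrite normr0 mulr_ge0// exprn_ge0.
    rewrite /weight/= /letter_weight aS bS.
    by have := ler_rp_area Xh u v a b; lra.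
  + by rewrite normr0 mulr_ge0// exprn_ge0.
- move=> u v r w su uv vr rt w2.
  have u0 := le_trans s0 su; have rT := le_trans rt tT.
  case: w w2 => [|a [|b [|c w]]] w2.
  + by rewrite tensor_mul_nil mul1r.
  + rewrite tensor_mul_cons tensor_mul_nil /= mul1r mulr1 /rp_incr !mxE; ring.
  + rewrite !(tensor_mul_cons, tensor_mul_nil) /= (weight2P w2).
    by rewrite (rp_chen_entry _ _ _ u0 uv vr rT); ring.
  + by rewrite leqNgt weight_ge_size3 in w2.
Qed.

End local_tensor.

(** * Uniform bounds for products of local tensors *)

Section rough_bounds.
Context {R : realType} {T p : R} {d : nat}.
Hypothesis T0 : 0 < T.
Hypothesis p23 : 2 < p < 3.
Local Notation letter := 'I_(hatd d).
Local Notation rough := (rough_path T p (hatd d)).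
Local Notation wght := (weight (@letter_weight d)).
Implicit Types (Xh : rough) (a b c : letter) (w : seq letter) (q mm : R).

Definition size_control V Xh := control T V (fun u v => rp_size Xh u v `^ p).

Lemma size_control_mono V Xh u v : size_control V Xh ->
  0 <= u -> u <= v -> v <= T -> V u <= V v.
Proof.
by move=> VX u0 uv vT; rewrite -subr_ge0 (le_trans _ (VX _ _ u0 uv vT))// powR_ge0.
Qed.

(** The power [q] of the size splits into a power [q - p], bounded through [mm], and a power [p],
    bounded by the control. For [q = p] the first factor is 1. *)
Lemma size_control_scaled q mm V Xh u v : p <= q -> 0 < mm -> size_control V Xh ->
  0 <= u -> u <= v -> v <= T -> rp_size Xh u v <= mm ->
  rp_size Xh u v <= (mm `^ (q - p) * (V v - V u)) `^ q^-1.
Proof.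
have /andP[p2 p3] := p23; move=> pq mm0 VX u0 uv vT Xm; have q0 : 0 < q by lra.
have := rp_size_ge0 Xh u v; rewrite le_eqVlt => /predU1P[<-|X0].
  exact: powR_ge0.
have XE : rp_size Xh u v `^ q = rp_size Xh u v `^ (q - p) * rp_size Xh u v `^ p.
  by rewrite -powRD ?subrK// gt_eqF.
have -> : rp_size Xh u v = (rp_size Xh u v `^ q) `^ q^-1.
  by rewrite -powRrM mulfV ?gt_eqF// powRr1// ltW.
rewrite ge0_ler_powR ?nnegrE ?powR_ge0 ?invr_ge0 ?(ltW q0)//.
  by rewrite mulr_ge0 ?powR_ge0// subr_ge0 (size_control_mono VX).
rewrite XE ler_pM ?powR_ge0//; last exact: VX.
by rewrite ge0_ler_powR ?nnegrE ?subr_ge0// ltW.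
Qed.

(* Splitting off m ^ (q - p), m bounding the sizes on [u, v], replaces
   continuity of the control V. *)
Definition rough_bound q C (n : nat) V Xh (D : R -> R -> R) : Prop :=
  forall u v mm, 0 <= u -> u <= v -> v <= T -> 0 < mm ->
    (forall u' v', u <= u' -> u' <= v' -> v' <= v -> rp_size Xh u' v' <= mm) ->
    `|D u v| <= C * ((mm `^ (q - p) * (V v - V u)) `^ q^-1) ^+ n.

Definition prod_bound q C (N : nat) : Prop :=
  forall Xh V s l w mm, extended_rough_path Xh -> size_control V Xh ->
    0 <= s -> path <%R s l -> last s l <= T -> (wght w <= N)%N -> 0 < mm ->
    (forall u v, s <= u -> u <= v -> v <= last s l -> rp_size Xh u v <= mm) ->
    `|tensor_prod (local_tensor Xh) s l w| <=
      C * ((mm `^ (q - p) * (V (last s l) - V s)) `^ q^-1) ^+ wght w.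

(** [ler_tensor_prod] with exponent [q^-1], admissible since [q < 3], and with [V] scaled by the
    power of [mm]. The constant depends on neither the path nor the partition nor [mm]. *)
Lemma exists_prod_bound q N : p <= q -> q < 3 -> exists2 C, 1 <= C & prod_bound q C N.
Proof.
have /andP[p2 p3] := p23; move=> pq q3; have q0 : 0 < q by lra.
have q1 : 1 < 3 * q^-1 by rewrite ltr_pdivlMr// mul1r.
have [|C C1 hC] := @ler_tensor_prod R _ _ (@letter_weight_gt0 d) _ 3 N q1.
  by rewrite ler1n.
exists C => // Xh V s l w mm XE VX s0 sl lT wN mm0 Xm.
have sl' := lt_path_le_last sl.
have mpos : 0 <= mm `^ (q - p) by exact: powR_ge0.
rewrite mulrBr.
apply: (hC (local_tensor Xh) (fun r => mm `^ (q - p) * V r) s (last s l) _ s l w (lexx s) sl (lexx _) wN).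
apply: almost_rough_local_tensor => //.
  move=> u v su uv vt; rewrite ler_wpM2l// (size_control_mono VX)//.
    exact: le_trans su.
  exact: le_trans lT.
move=> u v su uv vt; rewrite -mulrBr size_control_scaled//; last exact: Xm.
  exact: le_trans su.
exact: le_trans lT.
Qed.

(** As [n >= 3 > q], each term is at most linear in the increment of [V], with a factor tending to 0
    with [mm], and these increments add up to at most [B]. The threshold [mm] is fixed before the
    path. *)
Lemma rough_bound_vanishing q C n B e : p < q -> q < 3 -> (3 <= n)%N ->
  0 <= C -> 0 <= B -> 0 < e ->
  exists2 mm, 0 < mm & forall Xh V D, size_control V Xh -> V T - V 0 <= B ->
    rough_bound q C n V Xh D ->
    forall delta, (forall u v, 0 <= u -> u <= v -> v <= T -> v - u < delta ->
      rp_size Xh u v <= mm) ->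
    forall s t P, 0 <= s -> t <= T -> fine_partition delta s t P ->
      partition_sum s t P (fun u v => `|D u v|) <= e.
Proof.
have /andP[p2 p3] := p23; move=> pq q3 n3 C0 B0 e0; have q0 : 0 < q by lra.
have qn : 1 <= q^-1 * n%:R.
  rewrite mulrC ler_pdivlMr// mul1r (le_trans (ltW q3))//.
  by rewrite (ler_nat _ 3).
pose K := C * (B `^ (q^-1 * n%:R - 1) * B).
have K0 : 0 <= K by rewrite !mulr_ge0 ?powR_ge0.
(* [z] will be the power [q - p] of [mm]: at most 1 as [ler_powR_mul] demands, and with
   [K * z <= e]. *)
pose z := Num.min 1 (e / (K + 1)).
have z0 : 0 < z by rewrite lt_min ltr01/= divr_gt0// ltr_wpDl.
have z1 : z <= 1 by rewrite ge_min lexx.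
have zK : K * z <= e.
  have : z <= e / (K + 1) by rewrite ge_min lexx orbT.
  by rewrite ler_pdivlMr ?ltr_wpDl//; move: (ltW z0); nra.
exists (z `^ (q - p)^-1); first exact: powR_gt0.
move=> Xh V D VX VB hD delta Xm s t P s0 tT sP.
have mmE : (z `^ (q - p)^-1) `^ (q - p) = z.
  by rewrite -powRrM mulVf ?powRr1// ?ltW// gt_eqF// subr_gt0.
have st := fine_partition_le sP.
apply: (@le_trans _ _ (partition_sum s t P
    (fun u v => C * (z * B `^ (q^-1 * n%:R - 1)) * (V v - V u)))).
  apply: ler_partition_sum sP _ => u v su /ltW uv vud vt.
  have u0 := le_trans s0 su; have vT := le_trans vt tT.
  apply: le_trans (hD u v _ u0 uv vT (powR_gt0 _ z0) _) _.
    move=> u' v' uu' u'v' v'v; apply: Xm => //; [exact: le_trans uu'|exact: le_trans vT|].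
    by apply: le_lt_trans vud; lra.
  rewrite mmE -!mulrA ler_wpM2l// ler_powR_mul ?invr_gt0// ?(ltW z0)//.
    by rewrite subr_ge0 (size_control_mono VX).
  have := size_control_mono VX (lexx 0) u0 (le_trans uv vT).
  have := size_control_mono VX (le_trans u0 uv) vT (lexx _).
  lra.
rewrite partition_sumZ partition_sum_telescope; last exact: fine_partition_itv sP.
apply: le_trans zK; rewrite /K.
have -> : C * (B `^ (q^-1 * n%:R - 1) * B) * z = C * (z * B `^ (q^-1 * n%:R - 1)) * B by ring.
rewrite ler_wpM2l ?mulr_ge0 ?powR_ge0 ?(ltW z0)//.
have := size_control_mono VX (lexx 0) s0 (le_trans st tT).
have := size_control_mono VX (le_trans s0 st) tT (lexx _).
lra.
Qed.

(** At any positive weight a single term is small, even where partition sums need not be; this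
    serves continuity at the diagonal. *)
Lemma rough_bound_small q C n B e : p < q -> (0 < n)%N -> 0 <= C -> 0 <= B -> 0 < e ->
  exists2 mm, 0 < mm & forall Xh V D, size_control V Xh -> V T - V 0 <= B ->
    rough_bound q C n V Xh D ->
    forall u v, 0 <= u -> u <= v -> v <= T ->
    (forall u' v', u <= u' -> u' <= v' -> v' <= v -> rp_size Xh u' v' <= mm) ->
    `|D u v| <= e.
Proof.
have /andP[p2 p3] := p23; move=> pq n0 C0 B0 e0; have q0 : 0 < q by lra.
pose z := Num.min 1 (e / (C + 1)).
have z0 : 0 < z by rewrite lt_min ltr01/= divr_gt0// ltr_wpDl.
have z1 : z <= 1 by rewrite ge_min lexx.
have zC : C * z <= e.
  have : z <= e / (C + 1) by rewrite ge_min lexx orbT.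
  by rewrite ler_pdivlMr ?ltr_wpDl//; move: (ltW z0); nra.
pose y := z `^ q / (B + 1).
have zq0 : 0 < z `^ q by exact: powR_gt0.
have y0 : 0 < y by rewrite divr_gt0// ltr_wpDl.
exists (y `^ (q - p)^-1); first exact: powR_gt0.
move=> Xh V D VX VB hD u v u0 uv vT Xm.
have mmE : (y `^ (q - p)^-1) `^ (q - p) = y.
  by rewrite -powRrM mulVf ?powRr1// ?ltW// gt_eqF// subr_gt0.
apply: le_trans (hD u v _ u0 uv vT (powR_gt0 _ y0) Xm) (le_trans _ zC).
rewrite ler_wpM2l// mmE.
have dV : 0 <= V v - V u <= B.
  have := size_control_mono VX (lexx 0) u0 (le_trans uv vT).
  have := size_control_mono VX (le_trans u0 uv) vT (lexx _).
  have := size_control_mono VX u0 uv vT.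
  by move=> *; apply/andP; split; lra.
have [dV0 dVB] := andP dV.
have h : (y * (V v - V u)) `^ q^-1 <= z.
  rewrite [leRHS](_ : z = (z `^ q) `^ q^-1); last first.
    by rewrite -powRrM mulfV ?gt_eqF// powRr1// ltW.
  rewrite ge0_ler_powR ?nnegrE ?invr_ge0 ?(ltW q0) ?(ltW zq0)//.
    by rewrite mulr_ge0// ltW.
  by rewrite /y mulrAC ler_pdivrMr ?ltr_wpDl// ler_wpM2l ?(ltW zq0)//; lra.
case: n n0 {hD} => // n _; rewrite exprS.
rewrite -[leRHS]mulr1 ler_pM ?powR_ge0 ?exprn_ge0 ?powR_ge0//.
by rewrite exprn_ile1 ?powR_ge0// (le_trans h).
Qed.

End rough_bounds.

(** * Existence and uniqueness of Lyons' extension *)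

Section limits.
Context {R : realType} (Y : Type) (F : set_system Y) {FF : ProperFilter F}.

Lemma cvg_norm_le (g : Y -> R) (l c : R) : g @ F --> l ->
  (\forall y \near F, `|g y| <= c) -> `|l| <= c.
Proof.
move=> gl gc; apply/ler_addgt0Pr => e e0.
have gle : \forall y \near F, `|l - g y| < e by exact: (cvgr_dist_lt g l gl _ e0).
have [y [h1 h2]] := filter_ex (filterI gle gc).
rewrite -[l](subrK (g y)) (le_trans (ler_normD _ _))// addrC lerD// ltW//.
Qed.

Lemma cvg_eq_lim (g h : Y -> R) (l l' : R) : g @ F --> l -> h @ F --> l' ->
  (\forall y \near F, g y = h y) -> l = l'.
Proof.
move=> gl hl gh; apply/eqP; rewrite -subr_eq0 -normr_le0.
apply: (@cvg_norm_le (g - h)); first exact: cvgB.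
by apply: filterS gh => y ghy; rewrite /= [(g - h) y](_ : _ = g y - h y)// ghy subrr normr0.
Qed.

Lemma cvg_tensor_mul m (a b : Y -> tensor_series R m) (la lb : tensor_series R m) w :
  (forall v, a y v @[y --> F] --> la v) -> (forall v, b y v @[y --> F] --> lb v) ->
  tensor_mul (a y) (b y) w @[y --> F] --> tensor_mul la lb w.
Proof.
move=> al bl; apply: cvg_big => [|k _]; first exact: add_continuous.
exact: cvgM.
Qed.

End limits.

Lemma grid_fine {R : realType} (delta s t : R) (P y : seq R) : 0 < delta ->
  fine_partition delta s t P ->
  {subset P <= y} -> fine_partition delta s t (grid y s t).
Proof.
move=> d0; elim: P s => [|u P IHP] s.
  by move=> /andP[_ /eqP/= <-] _; rewrite grid_diag /fine_partition/= eqxx.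
move=> /fine_partition_cons[su usd ut uP] Py.
rewrite (grid_cat y (ltW su) ut).
have uy : u \in y by rewrite Py ?mem_head.
have lu := last_grid (ltW su) uy.
have /andP[h1 _] : fine_partition delta s u (grid y s u).
  apply: itv_partition_finer => //; split; [exact: path_grid|by rewrite lu].
have /andP[h2 h3] := IHP u uP (fun x xP => Py x (mem_behead (xP : x \in behead (u :: P)))).
by rewrite /fine_partition cat_path last_cat lu h1 h2 h3.
Qed.

Section rough_lift.
Context {R : realType} {T p : R} {d : nat}.
Hypothesis T0 : 0 < T.
Hypothesis p23 : 2 < p < 3.
Local Notation letter := 'I_(hatd d).
Local Notation rough := (rough_path T p (hatd d)).
Local Notation wght := (weight (@letter_weight d)).
Implicit Types (Xh : rough) (a b c : letter) (w : seq letter) (q mm s t u v : R) (y : seq R).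

Definition grid_prod Xh (y : seq R) s t : tensor_series R (hatd d) :=
  tensor_prod (local_tensor Xh) s (grid y s t).

Definition rough_lift Xh (s t : R) : tensor_series R (hatd d) := fun w =>
  lim (grid_prod Xh y s t w @[y --> refinement]).

Lemma exists_control Xh : exists V, size_control V Xh.
Proof.
have /andP[p2 p3] := p23.
have Xfin : (rp_norm Xh < +oo)%E.
  by rewrite lte_add_pinfty ?rp_path_pvar ?rp_area_pvar.
have [|B B0 hB] := @rp_control R T p (hatd d) (fine (rp_norm Xh)) T0; first exact: ltW.
have [|V VX _] := hB Xh; last by exists V.
rewrite fineK// fin_numElt Xfin andbT (lt_le_trans (ltNyr 0))//.
by rewrite adde_ge0 ?pvar_ge0.
Qed.

Lemma grid_prod_nil Xh y s t : grid_prod Xh y s t [::] = 1.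
Proof. exact: tensor_prod_nil. Qed.

Lemma grid_prod_mul Xh y s u t : s <= u -> u <= t -> u \in y ->
  grid_prod Xh y s t = tensor_mul (grid_prod Xh y s u) (grid_prod Xh y u t).
Proof.
by move=> su ut uy; rewrite /grid_prod (grid_cat _ su ut) tensor_prod_cat last_grid.
Qed.

Lemma near_grid_mem (u : R) : \forall y \near refinement, u \in y.
Proof. by exists [:: u] => y; apply; rewrite mem_head. Qed.

Lemma grid_prod_low Xh y s t w : extended_rough_path Xh ->
  0 <= s -> s <= t -> t <= T -> t \in y -> (wght w <= 2)%N ->
  grid_prod Xh y s t w = local_tensor Xh s t w.
Proof.
move=> XE s0 st tT ty w2; have /andP[p2 p3] := p23.
have p0 : 0 < p by lra.
have [V VX] := exists_control Xh.
rewrite /grid_prod (@tensor_prod_low R _ _ (@letter_weight_gt0 d) p^-1 3 V 0 T) ?last_grid//.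
- by rewrite invr_gt0.
- apply: almost_rough_local_tensor => //; first exact: ltW.
    by move=> u v; exact: size_control_mono VX.
  move=> u v u0 uv vT.
  have mm0 : 0 < rp_size Xh u v + 1 by rewrite ltr_wpDl// rp_size_ge0.
  have := size_control_scaled p23 (lexx p) mm0 VX u0 uv vT.
  by rewrite subrr powRr0 mul1r; apply; rewrite lerDl.
exact: path_grid.
Qed.

Lemma prod_bound_grid q C N V Xh y s t w mm : @prod_bound R T p d q C N ->
  extended_rough_path Xh -> size_control V Xh -> (wght w <= N)%N ->
  0 <= s -> s <= t -> t <= T -> t \in y -> 0 < mm ->
  (forall u v, s <= u -> u <= v -> v <= t -> rp_size Xh u v <= mm) ->
  `|grid_prod Xh y s t w| <= C * ((mm `^ (q - p) * (V t - V s)) `^ q^-1) ^+ wght w.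
Proof.
move=> hC XE VX wN s0 st tT ty mm0 Xm.
have lg := last_grid st ty.
have := hC Xh V s (grid y s t) w mm XE VX s0 (path_grid _ _ _) _ wN mm0.
by rewrite lg; apply.
Qed.

Lemma fine_partition_size Xh mm s t : 0 < mm -> 0 <= s -> s <= t -> t <= T ->
  exists delta P, [/\ 0 < delta, fine_partition delta s t P &
    forall u v, 0 <= u -> u <= v -> v <= T -> v - u < delta -> rp_size Xh u v <= mm].
Proof.
move=> mm0 s0 st tT; have [delta d0 hd] := rp_size_small Xh mm0.
have [P sP] := fine_partition_exists d0 st.
by exists delta, P; split => // u v u0 uv vT vud; apply/ltW/hd.
Qed.

Lemma eq_partition_sum_mem delta s t P (D D' : R -> R -> R) :
  fine_partition delta s t P ->
  (forall u v, s <= u -> u < v -> v <= t -> v \in P -> D u v = D' u v) ->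
  partition_sum s t P D = partition_sum s t P D'.
Proof.
elim: P s => [|u P IHP] s; first by rewrite !partition_sum_nil.
move=> /fine_partition_cons[su _ ut uP] DD'; rewrite !partition_sum_cons.
rewrite (DD' s u) ?mem_head// (IHP u)// => x v ux xv vt vP.
by apply: DD' => //; [rewrite (le_trans (ltW su))|rewrite inE vP orbT].
Qed.

(** [multiplicative_cvg] along [refinement]; on words of weight at most 2 the grid products are
    eventually constant. *)
Lemma grid_prod_cvg Xh s t w : extended_rough_path Xh ->
  0 <= s -> s <= t -> t <= T ->
  grid_prod Xh y s t w @[y --> refinement] --> rough_lift Xh s t w.
Proof.
move=> XE s0 st tT; have /andP[p2 p3] := p23.
suff [l hl] : exists l : R, grid_prod Xh y s t w @[y --> refinement] --> l.
  by apply/cvg_ex; exists l.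
have [V VX] := exists_control Xh.
apply: (@multiplicative_cvg _ _ _ refinement _ (grid_prod Xh) 0 T
   (fun w => wght w <= 2)%N) => //.
- by move=> u v *; apply: nearW => y; exact: grid_prod_nil.
- by move=> u *; apply: nearW => y; rewrite /grid_prod grid_diag.
- move=> u v r u0 uv vr rT; have := near_grid_mem v.
  by apply: filterS => y vy; exact: grid_prod_mul.
- move=> u v w' u0 uv vT w2; exists (local_tensor Xh u v w').
  apply: cvg_near_cst; have := near_grid_mem v.
  by apply: filterS => y vy; exact: grid_prod_low.
move=> u v w' u0 uv vT; rewrite -ltnNge => w3 e e0.
pose q := (p + 3) / 2.
have pq : p < q by rewrite /q; lra.
have q3 : q < 3 by rewrite /q; lra.
have [C C1 hC] := @exists_prod_bound R T p d p23 q (wght w') (ltW pq) q3.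
have VT : V T - V 0 <= V T - V 0 by [].
have B0 : 0 <= V T - V 0 by rewrite subr_ge0 (size_control_mono VX)// ltW.
have [mm mm0 hm] := @rough_bound_vanishing R T p d p23 q C (wght w') _ e pq q3 w3 (le_trans ler01 C1) B0 e0.
have [delta [P [d0 uP Xm]]] := fine_partition_size Xh mm0 u0 uv vT.
exists P; first exact: fine_partition_itv uP.
have := near_refinement P; apply: filterS => y Py.
(* The bound on a grid product needs its right end in [y]. Setting [D] to 0 elsewhere makes the
   bound hold for all pairs and changes nothing on the points of [P]. *)
pose D r r' := if r' \in y then grid_prod Xh y r r' w' else 0.
have -> : partition_sum u v P (fun r r' => `|grid_prod Xh y r r' w'|) =
          partition_sum u v P (fun r r' => `|D r r'|).
  apply: eq_partition_sum_mem uP _ => r r' _ _ _ rP.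
  by rewrite /D Py.
apply: (hm Xh V D VX VT _ delta Xm) => //.
move=> r r' mm' r0 rr' r'T mm'0 Xm'; rewrite /D; case: ifP => r'y.
  exact: (prod_bound_grid hC).
by rewrite normr0 mulr_ge0 ?exprn_ge0 ?powR_ge0// (le_trans ler01).
Qed.

Lemma rough_lift_low Xh s t w : extended_rough_path Xh ->
  0 <= s -> s <= t -> t <= T -> (wght w <= 2)%N ->
  rough_lift Xh s t w = local_tensor Xh s t w.
Proof.
move=> XE s0 st tT w2; apply: (@cvg_eq_lim R _ refinement _ (fun y => grid_prod Xh y s t w)
  (fun=> local_tensor Xh s t w)); first exact: grid_prod_cvg.
  exact: cvg_cst.
by have := near_grid_mem t; apply: filterS => y ty; exact: grid_prod_low.
Qed.

Lemma rough_lift_mul Xh s u t : extended_rough_path Xh ->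
  0 <= s -> s <= u -> u <= t -> t <= T ->
  rough_lift Xh s t = tensor_mul (rough_lift Xh s u) (rough_lift Xh u t).
Proof.
move=> XE s0 su ut tT; apply/funext => w.
have u0 := le_trans s0 su; have uT := le_trans ut tT.
apply: (@cvg_eq_lim R _ refinement _ (fun y => grid_prod Xh y s t w)
  (fun y => tensor_mul (grid_prod Xh y s u) (grid_prod Xh y u t) w)).
    exact: grid_prod_cvg (le_trans su ut) tT.
  by apply: cvg_tensor_mul => v; exact: grid_prod_cvg.
by have := near_grid_mem u; apply: filterS => y uy; rewrite (@grid_prod_mul Xh y s u t).
Qed.

Lemma rough_lift_bound q C N V Xh w : @prod_bound R T p d q C N ->
  extended_rough_path Xh -> size_control V Xh -> (wght w <= N)%N ->
  rough_bound q C (wght w) V Xh (fun s t => rough_lift Xh s t w).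
Proof.
move=> hC XE VX wN s t mm s0 st tT mm0 Xm.
apply: (@cvg_norm_le R _ refinement _ (fun y => grid_prod Xh y s t w)).
  exact: grid_prod_cvg.
have := near_grid_mem t; apply: filterS => y ty.
exact: (prod_bound_grid hC).
Qed.

Lemma tensor_prod_letter Xh s l a :
  tensor_prod (local_tensor Xh) s l [:: a] = rp_incr Xh s (last s l) ord0 a.
Proof.
elim: l s => [|u l IHl] s /=; first by rewrite rp_incr_diag mxE.
rewrite tensor_mul_cons tensor_mul_nil tensor_prod_nil// IHl /= /rp_incr !mxE; ring.
Qed.

(** Since the local tensor is 0 on the pair, only splits between different steps survive, and they
    form a left-point Riemann sum. The base point [r] stays fixed while [s] moves along the list in
    the induction. *)
Lemma tensor_prod_pair Xh r s l a b : ~~ (is_space a && is_space b) ->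
  partition_sum s (last s l) l (fun u v => rp_incr Xh r u ord0 a * rp_incr Xh u v ord0 b)
  = rp_incr Xh r s ord0 a * rp_incr Xh s (last s l) ord0 b +
    tensor_prod (local_tensor Xh) s l [:: a; b].
Proof.
move=> abN; elim: l s => [|u l IHl] s /=.
  by rewrite partition_sum_nil rp_incr_diag !mxE mulr0 addr0.
rewrite partition_sum_cons IHl !tensor_mul_cons tensor_mul_nil.
rewrite tensor_prod_letter tensor_prod_nil//= (negPf abN) /rp_incr !mxE; ring.
Qed.

(** On a grid this coordinate is a left-point Riemann sum, and such sums tend to the area entry by
    the definition of an extended rough path. *)
Lemma rough_lift_young Xh s t a b : extended_rough_path Xh ->
  0 <= s -> s <= t -> t <= T -> ~~ (is_space a && is_space b) ->
  rough_lift Xh s t [:: a; b] = rp_area Xh s t a b.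
Proof.
move=> XE s0 st tT abN.
apply: (@cvg_eq_lim R _ refinement _ (fun y => grid_prod Xh y s t [:: a; b])
  (fun y => grid_prod Xh y s t [:: a; b])); last exact: nearW.
  exact: grid_prod_cvg.
case: XE => X [_ _ XY].
have sD : Delta T (s, t) by split.
have {}XY := XY s t sD a b; apply/cvgrPdist_lt => e e0.
have [|delta d0 hd] := XY _ e e0.
  by move=> [/is_spaceP h1 /is_spaceP h2]; rewrite h1 h2 in abN.
have [P sP] := fine_partition_exists d0 st.
have := near_refinement (t :: P); apply: filterS => y tPy.
have ty : t \in y by rewrite tPy// mem_head.
have yP : fine_partition delta s t (grid y s t).
  by apply: grid_fine sP _ => // x xP; rewrite tPy// inE xP orbT.
have := hd _ (fine_partition_itv yP); rewrite distrC.
have := tensor_prod_pair Xh s s (grid y s t) abN.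
rewrite last_grid// rp_incr_diag mxE mul0r add0r -/(grid_prod _ _ _ _) => <-.
have -> : (fun u v => (rp_path Xh u ord0 a - rp_path Xh s ord0 a) *
    (rp_path Xh v ord0 b - rp_path Xh u ord0 b)) =
    (fun u v => rp_incr Xh s u ord0 a * rp_incr Xh u v ord0 b).
  by apply/funext => u; apply/funext => v; rewrite /rp_incr !mxE.
apply => k; have /andP[/(pathP t) h _] := yP => ks.
by have /andP[] := h k ks.
Qed.

End rough_lift.

(** * Joint continuity of multiplicative functions *)

Section diagonal_vanishing.
Context {R : realType} (T : R).
Implicit Types f g : R -> R -> R.

Definition diag_vanishing f : Prop := forall e, 0 < e ->
  exists2 delta : R, 0 < delta & forall u v, 0 <= u -> u <= v -> v <= T ->
    v - u < delta -> `|f u v| <= e.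

Lemma diag_vanishing_sum (I : Type) (r : seq I) (f : I -> R -> R -> R) :
  (forall i, diag_vanishing (f i)) ->
  diag_vanishing (fun u v => \sum_(i <- r) f i u v).
Proof.
move=> h; elim: r => [|i r IHr] e e0.
  by exists 1 => // u v *; rewrite big_nil normr0 ltW.
have e20 : 0 < e / 2 by rewrite divr_gt0.
have [x x0 hx] := h i _ e20; have [y y0 hy] := IHr _ e20.
exists (Num.min x y); first by rewrite lt_min x0.
move=> u v u0 uv vT; rewrite lt_min => /andP[ux uy].
rewrite big_cons (le_trans (ler_normD _ _))// [leRHS](splitr e) lerD//.
  exact: hx.
exact: hy.
Qed.

Lemma diag_vanishingZ c f : diag_vanishing f -> diag_vanishing (fun u v => c * f u v).
Proof.
move=> h e e0; have c0 : 0 < `|c| + 1 by rewrite ltr_wpDl.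
have [x x0 hx] := h (e / (`|c| + 1)) (divr_gt0 e0 c0).
exists x => // u v u0 uv vT uvx; have := hx u v u0 uv vT uvx.
rewrite normrM ler_pdivlMr// => /(le_trans _); apply.
by rewrite mulrC ler_wpM2l// lerDl.
Qed.

(* Two points of Delta are compared through the smallest interval containing
   both. *)
Lemma multiplicative_continuous m (S : R -> R -> tensor_series R m) :
  (forall s u t, 0 <= s -> s <= u -> u <= t -> t <= T ->
     S s t = tensor_mul (S s u) (S u t)) ->
  (forall s t, 0 <= s -> s <= t -> t <= T -> S s t [::] = 1) ->
  (forall w, exists M, forall s t, 0 <= s -> s <= t -> t <= T -> `|S s t w| <= M) ->
  (forall w, w != [::] -> diag_vanishing (fun s t => S s t w)) ->
  forall w, {within Delta T, continuous (fun z : R * R => S z.1 z.2 w)}.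
Proof.
move=> Sm S1 Sb Sv w; have [M hM] := boolp.choice Sb.
have M0 v : 0 <= T -> 0 <= M v.
  by move=> T0; apply: le_trans (hM v 0 0 (lexx _) (lexx _) T0).
(* By Chen's relation [f a s] bounds the effect of moving the left end from [a] to [s], and [g t b]
   that of moving the right end from [t] to [b]. Each summand evaluates [S] on a nonempty word over
   a short interval. *)
pose f u v := \sum_(k < size w) M (drop k.+1 w) * `|S u v (take k.+1 w)|.
pose g u v := \sum_(k < size w) M (take k w) * `|S u v (drop k w)|.
have vabs h : diag_vanishing h -> diag_vanishing (fun u v => `|h u v|).
  by move=> hv e e0; have [x x0 hx] := hv e e0; exists x => // u v *; rewrite normr_id hx.
have fv : diag_vanishing f.
  apply: diag_vanishing_sum => k; apply: diag_vanishingZ; apply/vabs/Sv.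
  by case: w {f g} k => [[]//|].
have gv : diag_vanishing g.
  apply: diag_vanishing_sum => k; apply: diag_vanishingZ; apply/vabs/Sv.
  by rewrite -size_eq0 size_drop subn_eq0 -ltnNge.
have fS a s t : 0 <= a -> a <= s -> s <= t -> t <= T ->
    `|S a t w - S s t w| <= f a s.
  move=> a0 as_ st tT; have s0 := le_trans a0 as_; have sT := le_trans st tT.
  rewrite (Sm a s t)// /tensor_mul big_ord_recl take0 drop0 S1// mul1r addrAC subrr add0r.
  rewrite (le_trans (ler_norm_sum _ _ _))// ler_sum// => k _.
  by rewrite normrM mulrC ler_wpM2r// hM.
have gS s t b : 0 <= s -> s <= t -> t <= b -> b <= T ->
    `|S s b w - S s t w| <= g t b.
  move=> s0 st tb bT; have t0 := le_trans s0 st; have tT := le_trans tb bT.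
  rewrite (Sm s t b)// /tensor_mul big_ord_recr/= take_size drop_size S1// mulr1 addrK.
  rewrite (le_trans (ler_norm_sum _ _ _))// ler_sum// => k _.
  by rewrite normrM ler_wpM2r// hM.
apply/within_continuousP => -[s t] [/= s0 [st tT]] e e0.
have e80 : 0 < e / 8 by rewrite divr_gt0.
have [x x0 hx] := fv _ e80; have [y y0 hy] := gv _ e80.
exists (Num.min x y); first by rewrite lt_min x0.
move=> [s' t'] [/= s'0 [s't' t'T]] [/=]; rewrite /ball/= !lt_min.
move=> /andP[sx sy] /andP[tx ty].
pose a := Num.min s s'; pose b := Num.max t t'.
have a0 : 0 <= a by rewrite le_min s0.
have as_ : a <= s by rewrite ge_min lexx.
have as' : a <= s' by rewrite ge_min lexx orbT.
have tb : t <= b by rewrite le_max lexx.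
have t'b : t' <= b by rewrite le_max lexx orbT.
have bT : b <= T by rewrite ge_max tT.
have aS : s - a < x /\ s' - a < x.
  by rewrite /a; move: sx; case: (leP s s') => ss; rewrite subrr ?x0 ltr_norml => /andP[? ?]; split => //; lra.
have bS : b - t < y /\ b - t' < y.
  by rewrite /b; move: ty; case: (leP t t') => tt; rewrite subrr ?y0 ltr_norml => /andP[? ?]; split => //; lra.
have key u v : 0 <= u -> u <= v -> v <= T -> a <= u -> u - a < x -> v <= b -> b - v < y ->
    `|S a b w - S u v w| <= e / 8 + e / 8.
  move=> u0 uv vT au uax vb bvy.
  have -> : S a b w - S u v w = (S a b w - S a v w) + (S a v w - S u v w) by ring.
  rewrite (le_trans (ler_normD _ _))// lerD//.
    have av := le_trans au uv.
    apply: le_trans (gS _ _ _ a0 av vb bT) _.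
    apply: le_trans (ler_norm _) (hy _ _ _ vb bT bvy); exact: le_trans uv.
  apply: le_trans (fS _ _ _ a0 au uv vT) _.
  by apply: le_trans (ler_norm _) (hx _ _ a0 au (le_trans uv vT) uax).
have h1 := key _ _ s0 st tT as_ aS.1 tb bS.1.
have h2 := key _ _ s'0 s't' t'T as' aS.2 t'b bS.2.
have -> : S s t w - S s' t' w = (S a b w - S s' t' w) - (S a b w - S s t w) by ring.
rewrite (le_lt_trans (ler_normB _ _))//; lra.
Qed.

End diagonal_vanishing.

Section level_norm.
Context {R : realType} {m : nat}.

Lemma ler_level_norm (a : tensor_series R m) w : `|a w| <= level_norm (size w) a.
Proof.
rewrite -sqrtr_sqr ler_wsqrtr//.
rewrite (bigD1 (in_tuple w))//= lerDl; apply: sumr_ge0 => I _; exact: sqr_ge0.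
Qed.

Lemma level_norm_ge0 n (a : tensor_series R m) : 0 <= level_norm n a.
Proof. exact: sqrtr_ge0. Qed.

Lemma level_norm_le n (a : tensor_series R m) (c : R) : 0 <= c ->
  (forall I : n.-tuple 'I_m, `|a I| <= c) ->
  level_norm n a <= Num.sqrt #|{: n.-tuple 'I_m}|%:R * c.
Proof.
move=> c0 ac; rewrite -[X in _ <= _ * X]ger0_norm// -sqrtr_sqr -sqrtrM//.
rewrite ler_wsqrtr// (@le_trans _ _ (\sum_(I : n.-tuple 'I_m) c ^+ 2))//.
  by apply: ler_sum => I _; rewrite -real_normK ?num_real// lerXn2r ?nnegrE.
by rewrite sumr_const mulr_natl.
Qed.

(** If [a] vanishes on the shorter nonempty words, idempotency at [w] reads [a w + a w = a w].
    Chen's relation supplies idempotency on the diagonal. *)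
Lemma tensor_mul_idem (a : tensor_series R m) : a [::] = 1 -> tensor_mul a a = a ->
  a = tensor1.
Proof.
move=> a1 aa; apply/funext => w; have [n] := ubnP (size w); elim: n w => // n IHn w wn.
have [->//|w0] := eqVneq w [::].
have := congr1 (fun f => f w) aa; rewrite /= tensor_mul_proper//.
have -> : proper_mul a a w = 0.
  rewrite /proper_mul big_nat_cond big1// => k /andP[/andP[k0 kw] _].
  rewrite IHn; last by rewrite size_take kw (leq_trans kw).
  by rewrite /tensor1 -size_eq0 size_take kw eqn0Ngt k0 mul0r.
by rewrite /tensor1 (negPf w0) addr0 -[RHS]addr0 => /addrI.
Qed.

End level_norm.

(** * Uniqueness of Lyons' extension *)

Section lyons.
Context {R : realType} {T p : R} {m : nat}.
Hypothesis T0 : 0 < T.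
Hypothesis p23 : 2 < p < 3.

Section any_extension.
Variables (X : rough_path T p m) (S : R -> R -> tensor_series R m).
Hypothesis XS : is_lyons_extension X S.

Lemma lyons_nil s t : 0 <= s -> s <= t -> t <= T -> S s t [::] = 1.
Proof. by move=> s0 st tT; case: XS => h _ _ _; have [] := h s t (conj s0 (conj st tT)). Qed.

Lemma lyons_diag s : 0 <= s -> s <= T -> S s s = tensor1.
Proof.
move=> s0 sT; apply: tensor_mul_idem; first exact: lyons_nil.
by case: XS => _ h _ _; rewrite -h.
Qed.

(** With [r = p / size w < 1], the value splits into its power [1 - r], uniformly small near the
    diagonal by continuity, and its power [r], summable by finite variation. *)
Lemma lyons_vanishing w s t : (3 <= size w)%N -> 0 <= s -> s <= t -> t <= T ->
  vanishing s t (fun u v => S u v w).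
Proof.
move=> w3 s0 st tT e e0; have /andP[p2 p3] := p23.
have w0 : (0 < size w)%N by exact: leq_trans w3.
have [_ _ /(_ w) Sc /(_ _ w0)] := XS; set r := p / _ => Sp.
have w30 : 3 <= (size w)%:R :> R by rewrite (ler_nat _ 3).
have r0 : 0 < r by rewrite divr_gt0 ?ltr0n//; lra.
have r1 : r < 1 by rewrite ltr_pdivrMr ?ltr0n// mul1r (lt_le_trans p3).
pose a u v := level_norm (size w) (S u v).
have aw u v : `|S u v w| <= a u v by exact: ler_level_norm.
have [M M0 hM] : exists2 M, 0 <= M & (pvar T r a <= M%:E)%E.
  exists (fine (pvar T r a)); first by rewrite fine_ge0// pvar_ge0.
  by rewrite fineK// ge0_fin_numE ?pvar_ge0.
have ad u : 0 <= u -> u <= T -> a u u `^ r = 0.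
  move=> u0 uT; rewrite /a lyons_diag// /level_norm big1 ?sqrtr0 ?powR0 ?gt_eqF//.
  move=> I _; rewrite /tensor1 -size_eq0 size_tuple gtn_eqF//.
  by rewrite expr0n.
have [V Va VM] := variation_control (fun u v => powR_ge0 (a u v) r) ad
  (fun s => pvar_partition_sum r0 M0 hM) (ltW T0).
have Mr0 : 0 <= M `^ r by exact: powR_ge0.
pose z := (e / (M `^ r + 1)) `^ (1 - r)^-1.
have z0 : 0 < z by rewrite powR_gt0// divr_gt0// ltr_wpDl.
have zr : z `^ (1 - r) = e / (M `^ r + 1).
  rewrite -powRrM mulVf ?powRr1// ?gt_eqF ?subr_gt0//.
  by rewrite divr_ge0 ?(ltW e0)// addr_ge0.
have [|delta d0 hd] := @diagonal_small R T (fun u v => S u v w) Sc _ z z0.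
  by move=> u u0 uT; rewrite lyons_diag// /tensor1 -size_eq0 gtn_eqF.
exists delta => // P sP; have st' := fine_partition_le sP.
apply: (@le_trans _ _ (partition_sum s t P (fun u v => z `^ (1 - r) * (V v - V u)))).
  apply: ler_partition_sum sP _ => u v su /ltW uv uvd vt.
  have u0 := le_trans s0 su; have vT := le_trans vt tT.
  have Sz := ltW (hd u v u0 uv vT uvd).
  apply: le_trans (_ : _ <= z `^ (1 - r) * a u v `^ r) _; last first.
    by rewrite ler_wpM2l ?powR_ge0// Va.
  have [->|S0] := eqVneq `|S u v w| 0; first by rewrite mulr_ge0 ?powR_ge0.
  rewrite -[leLHS]powRr1// -{1}(subrK r 1) powRD; last by rewrite S0 implybT.
  by rewrite ler_pM ?powR_ge0// ge0_ler_powR ?nnegrE ?level_norm_ge0 ?subr_ge0 ?(ltW r0) ?(ltW r1) ?(ltW z0).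
rewrite partition_sumZ partition_sum_telescope; last exact: fine_partition_itv sP.
have Vm u v : 0 <= u -> u <= v -> v <= T -> V u <= V v.
  by move=> u0 uv vT; rewrite -subr_ge0 (le_trans _ (Va _ _ u0 uv vT))// powR_ge0.
have := Vm _ _ (lexx 0) s0 (le_trans st tT); have := Vm _ _ (le_trans s0 st) tT (lexx _).
move=> h1 h2; rewrite zr mulrAC ler_pdivrMr ?ltr_wpDl// ler_wpM2l ?(ltW e0)//.
lra.
Qed.

End any_extension.

(** Words of length at most 2 are prescribed. For a longer word, once the extensions agree on all
    shorter ones, Chen's relation makes their difference additive, and it is vanishing. *)
Lemma lyons_extension_unique (X : rough_path T p m) (S S' : R -> R -> tensor_series R m) :
  is_lyons_extension X S -> is_lyons_extension X S' ->
  forall s t, 0 <= s -> s <= t -> t <= T -> S s t = S' s t.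
Proof.
move=> XS XS' s t s0 st tT; apply/funext => w.
have [n] := ubnP (size w); elim: n w s t s0 st tT => // n IHn w s t s0 st tT wn.
have [w3|w3] := leqP 3 (size w); last first.
  have [h _ _ _] := XS; have [h' _ _ _] := XS'.
  have D : Delta T (s, t) by split.
  have [h0 h1 h2] := h _ _ D; have [h0' h1' h2'] := h' _ _ D.
  case: w w3 {wn} => [|i [|j [|k w]]]// _; first by rewrite h0 h0'.
    by rewrite h1 h1'.
  by rewrite h2 h2'.
apply/eqP; rewrite -subr_eq0; apply/eqP.
have w0 : w != [::] by rewrite -size_eq0 gtn_eqF// (leq_trans _ w3).
have D0 u : 0 <= u -> u <= T -> S u u w - S' u u w = 0.
  by move=> u0 uT; rewrite (lyons_diag XS)// (lyons_diag XS')// subrr.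
apply: (@vanishing_additive0 R s t (fun u v => S u v w - S' u v w)) => //.
- apply: (@vanishingD R s t (fun u v => S u v w) (fun u v => - S' u v w)).
    exact: (lyons_vanishing XS).
  apply: (@vanishing_le R s t (fun u v => S' u v w) _ 1) => //; first exact: (lyons_vanishing XS').
  move=> u v *.
  by rewrite mul1r normrN.
- by rewrite D0// (le_trans s0).
- move=> u v su uv vt; have u0 := le_trans s0 su; have v0 := le_trans u0 uv.
  have vT := le_trans vt tT.
  have [_ Sm _ _] := XS; have [_ S'm _ _] := XS'.
  rewrite (Sm u v t)// (S'm u v t)// !tensor_mul_proper ?(lyons_nil XS) ?(lyons_nil XS')//.
  suff -> : proper_mul (S u v) (S v t) w = proper_mul (S' u v) (S' v t) w by ring.
  apply: eq_big_nat => k /andP[k0 kw]; congr (_ * _); apply: IHn => //.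
    by rewrite size_take kw (leq_trans kw).
  by rewrite size_drop; apply: leq_trans (wn : (size w <= n)%N); rewrite ltn_subrL k0 (leq_trans k0)// ltnW.
Qed.

End lyons.

(** * The limit of products is Lyons' extension *)

Section lift_lyons.
Context {R : realType} {T p : R} {d : nat}.
Hypothesis T0 : 0 < T.
Hypothesis p23 : 2 < p < 3.
Local Notation letter := 'I_(hatd d).
Local Notation rough := (rough_path T p (hatd d)).
Local Notation wght := (weight (@letter_weight d)).
Implicit Types (Xh : rough) (a b c : letter) (w : seq letter).

Lemma control_total V Xh u v : size_control V Xh -> 0 <= u -> u <= v -> v <= T ->
  0 <= V v - V u <= V T - V 0.
Proof.
move=> VX u0 uv vT.
have := size_control_mono VX (lexx 0) u0 (le_trans uv vT).
have := size_control_mono VX (le_trans u0 uv) vT (lexx _).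
have := size_control_mono VX u0 uv vT.
by move=> *; apply/andP; split; lra.
Qed.

Lemma rough_lift_ler_control V Xh N : extended_rough_path Xh -> size_control V Xh ->
  exists2 C, 0 <= C & forall w s t, (wght w <= N)%N -> 0 <= s -> s <= t -> t <= T ->
    `|rough_lift Xh s t w| <= C * ((V t - V s) `^ p^-1) ^+ wght w.
Proof.
move=> XE VX; have /andP[p2 p3] := p23; have p0 : 0 < p by lra.
have [C C1 hC] := @exists_prod_bound R T p d p23 p N (lexx p) p3.
exists C => [|w s t wN s0 st tT]; first exact: le_trans C1.
pose mm := (V T - V 0) `^ p^-1 + 1.
have mm0 : 0 < mm by rewrite ltr_wpDl// powR_ge0.
have := rough_lift_bound T0 p23 hC XE VX wN s0 st tT mm0.
rewrite subrr powRr0 mul1r; apply => u v su uv vt.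
have u0 := le_trans s0 su; have vT := le_trans vt tT.
have X0 := rp_size_ge0 Xh u v.
have /andP[V0 VT] := control_total VX u0 uv vT.
apply: le_trans (_ : _ <= (V T - V 0) `^ p^-1) _; last by rewrite lerDl.
have -> : rp_size Xh u v = (rp_size Xh u v `^ p) `^ p^-1.
  by rewrite -powRrM mulfV ?gt_eqF// powRr1.
have VX' := VX _ _ u0 uv vT.
by rewrite ge0_ler_powR ?nnegrE ?powR_ge0 ?invr_ge0 ?(ltW p0)//; lra.
Qed.

Lemma rough_lift_bounded Xh w : extended_rough_path Xh ->
  exists M, forall s t, 0 <= s -> s <= t -> t <= T -> `|rough_lift Xh s t w| <= M.
Proof.
move=> XE; have [V VX] := exists_control T0 p23 Xh.
have /andP[p2 p3] := p23; have p0 : 0 < p by lra.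
have [C C0 hC] := rough_lift_ler_control (wght w) XE VX.
exists (C * ((V T - V 0) `^ p^-1) ^+ wght w) => s t s0 st tT.
apply: le_trans (hC w s t (leqnn _) s0 st tT) _.
have /andP[V0 VT] := control_total VX s0 st tT.
rewrite ler_wpM2l// lerXn2r ?nnegrE ?powR_ge0// ge0_ler_powR ?nnegrE ?invr_ge0 ?(ltW p0)//; lra.
Qed.

Lemma rough_lift_diag_vanishing Xh w : extended_rough_path Xh -> w != [::] ->
  diag_vanishing T (fun s t => rough_lift Xh s t w).
Proof.
move=> XE w0 e e0; have [V VX] := exists_control T0 p23 Xh.
have /andP[p2 p3] := p23.
pose q := (p + 3) / 2.
have pq : p < q by rewrite /q; lra.
have q3 : q < 3 by rewrite /q; lra.
have [C C1 hC] := @exists_prod_bound R T p d p23 q (wght w) (ltW pq) q3.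
have B0 : 0 <= V T - V 0 by have /andP[] := control_total VX (lexx 0) (ltW T0) (lexx T).
have wt0 : (0 < wght w)%N.
  by apply: leq_trans (size_weight (@letter_weight_gt0 d) w); rewrite lt0n size_eq0.
have [mm mm0 hm] := @rough_bound_small R T p d p23 q C (wght w) _ e pq wt0 (le_trans ler01 C1) B0 e0.
have [delta d0 hd] := rp_size_small Xh mm0.
exists delta => // u v u0 uv vT uvd.
apply: (hm Xh V (fun s t => rough_lift Xh s t w) VX (lexx _) (rough_lift_bound T0 p23 hC XE VX (leqnn _)) u v u0 uv vT).
move=> u' v' uu' u'v' v'v; apply: ltW; apply: hd => //.
- exact: le_trans uu'.
- exact: le_trans vT.
- by apply: le_lt_trans uvd; lra.
Qed.

Lemma weight_le_double w : (wght w <= 2 * size w)%N.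
Proof.
elim: w => // a w IHw; rewrite /weight/= mulnS leq_add//.
by rewrite /letter_weight; case: ifP.
Qed.

(** Lyons' extension is graded by length, the bounds by weight. A word of length [n] weighs between
    [n] and [2 * n], so [n] powers of the control are kept and the surplus is absorbed into powers
    of [Y]. *)
Lemma rough_lift_pvar Xh n : extended_rough_path Xh -> (0 < n)%N ->
  (pvar T (p / n%:R) (fun u v => level_norm n (rough_lift Xh u v)) < +oo)%E.
Proof.
move=> XE n0; have [V VX] := exists_control T0 p23 Xh.
have /andP[p2 p3] := p23; have p0 : 0 < p by lra.
have nR : 0 < n%:R :> R by rewrite ltr0n.
set r := p / n%:R; have r0 : 0 < r by rewrite divr_gt0.
have [C C0 hC] := rough_lift_ler_control (2 * n) XE VX.
pose Y := 1 + (V T - V 0) `^ p^-1.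
have Y1 : 1 <= Y by rewrite lerDl powR_ge0.
have Y0 : 0 <= Y by rewrite (le_trans ler01).
pose K := Num.sqrt #|{: n.-tuple letter}|%:R * (C * Y ^+ (2 * n)).
have K0 : 0 <= K by rewrite !mulr_ge0 ?sqrtr_ge0 ?exprn_ge0.
have lK u v : 0 <= u -> u <= v -> v <= T ->
    level_norm n (rough_lift Xh u v) `^ r <= K `^ r * (V v - V u).
  move=> u0 uv vT; have /andP[dV0 dVT] := control_total VX u0 uv vT.
  pose y := (V v - V u) `^ p^-1; have y0 : 0 <= y by exact: powR_ge0.
  have yY : y <= Y.
    apply: (@le_trans _ _ ((V T - V 0) `^ p^-1)); last by rewrite lerDr.
    by rewrite ge0_ler_powR ?nnegrE ?invr_ge0 ?(ltW p0)//; lra.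
  have yn : (y ^+ n) `^ r = V v - V u.
    rewrite -powR_mulrn// /y -!powRrM /r.
    have -> : p^-1 * (n%:R * (p / n%:R)) = 1.
      by field; apply/andP; split; rewrite gt_eqF.
    by rewrite powRr1.
  have h : level_norm n (rough_lift Xh u v) <= K * y ^+ n.
    rewrite /K -mulrA; apply: level_norm_le; first by rewrite !mulr_ge0 ?exprn_ge0.
    move=> I; have wn : (n <= wght I)%N.
      by rewrite -{1}(size_tuple I) (size_weight (@letter_weight_gt0 d)).
    have w2n : (wght I <= 2 * n)%N by rewrite -{2}(size_tuple I) weight_le_double.
    apply: le_trans (hC _ _ _ w2n u0 uv vT) _; rewrite -mulrA ler_wpM2l//.
    rewrite -/y -(subnKC wn) exprD mulrC ler_wpM2r ?exprn_ge0//.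
    apply: (@le_trans _ _ (Y ^+ (wght I - n))); first by rewrite lerXn2r.
    by rewrite ler_weXn2l// (leq_trans (leq_subr _ _)).
  apply: (@le_trans _ _ ((K * y ^+ n) `^ r)).
    by rewrite ge0_ler_powR ?nnegrE ?(ltW r0) ?level_norm_ge0 ?mulr_ge0 ?exprn_ge0.
  by rewrite powRM ?exprn_ge0// yn.
have VT0 : 0 <= V T - V 0 by have /andP[] := control_total VX (lexx 0) (ltW T0) (lexx T).
apply: (@le_lt_trans _ _ ((K `^ r * (V T - V 0)) `^ r^-1)%:E); last exact: ltry.
apply: pvar_le => //; first exact: powR_ge0.
move=> s Ts; rewrite ge0_ler_powR ?nnegrE ?invr_ge0 ?(ltW r0) ?mulr_ge0 ?powR_ge0//.
  by apply: partition_sum_ge0 => *; exact: powR_ge0.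
rewrite -(partition_sum_telescope V Ts) -partition_sumZ.
apply: ler_partition_sum (itv_partition_fine Ts) _ => u v u0 uv _ vT.
by apply: lK => //; exact: ltW.
Qed.

Lemma rough_lift_lyons Xh : extended_rough_path Xh -> is_lyons_extension Xh (rough_lift Xh).
Proof.
move=> XE.
have l1 s t : 0 <= s -> s <= t -> t <= T -> rough_lift Xh s t [::] = 1.
  by move=> s0 st tT; rewrite (rough_lift_low T0 p23).
split.
- move=> s t [/= s0 [st tT]]; split; first exact: l1.
    move=> a; rewrite (rough_lift_low T0 p23)//= ?mxE// /weight/= addn0 /letter_weight.
      by case: ifP.
  move=> a b; have [abS|abN] := boolP (is_space a && is_space b); last first.
    exact: rough_lift_young.
  rewrite (rough_lift_low T0 p23)//= ?abS//.
  by case/andP: abS => aS bS; rewrite /weight/= /letter_weight aS bS.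
- by move=> s u t *; exact: rough_lift_mul.
- apply: multiplicative_continuous => //.
  + by move=> s u t *; exact: rough_lift_mul.
  + by move=> w; exact: rough_lift_bounded.
  + by move=> w; exact: rough_lift_diag_vanishing.
- by move=> n n0; exact: rough_lift_pvar.
Qed.

(** Existence makes the value chosen by [xget] an extension; uniqueness then identifies it on
    [Delta T]. *)
Lemma lyons_extensionE Xh : extended_rough_path Xh ->
  forall s t, 0 <= s -> s <= t -> t <= T -> lyons_extension Xh s t = rough_lift Xh s t.
Proof.
move=> XE; apply: (lyons_extension_unique T0 p23 (X := Xh)); last exact: rough_lift_lyons.
exact: xgetPex (ex_intro _ _ (rough_lift_lyons XE)).
Qed.

End lift_lyons.

(** * Quasi-shuffle *)

Section quasi_shuffle.
Context {R : realType} {m : nat}.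
Local Notation letter := 'I_m.
Variables (sp : pred letter) (brk : letter -> letter -> letter).
Implicit Types (I J w : seq letter) (a b : tensor_series R m).

(** The inner fixpoint recurses on the second word with the first one fixed. Words are listed with
    multiplicity; the third family, contracting two space letters, is what distinguishes this from
    the shuffle product. *)
Fixpoint quasi_shuffle I : seq letter -> seq (seq letter) :=
  match I with
  | [::] => fun J => [:: J]
  | i :: I' => fix shuffle_i J := match J with
    | [::] => [:: i :: I']
    | j :: J' => map (cons i) (quasi_shuffle I' (j :: J')) ++
        map (cons j) (shuffle_i J') ++
        if sp i && sp j then map (cons (brk i j)) (quasi_shuffle I' J') else [::]
    end
  end.

Definition quasi_sum a I J : R := \sum_(w <- quasi_shuffle I J) a w.

Lemma quasi_sum0l a J : quasi_sum a [::] J = a J.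
Proof. by rewrite /quasi_sum big_seq1. Qed.

Lemma quasi_sum0r a I : quasi_sum a I [::] = a I.
Proof. by case: I => [|i I]; rewrite /quasi_sum big_seq1. Qed.

Lemma quasi_sum_cons a i I j J : quasi_sum a (i :: I) (j :: J) =
  quasi_sum (fun w => a (i :: w)) I (j :: J) +
  quasi_sum (fun w => a (j :: w)) (i :: I) J +
  if sp i && sp j then quasi_sum (fun w => a (brk i j :: w)) I J else 0.
Proof.
rewrite /quasi_sum /= !big_cat !big_map/= addrA; congr (_ + _).
by case: ifP => _; rewrite ?big_map// big_nil.
Qed.

Lemma quasi_sum_lin a b x I J :
  quasi_sum (fun w => x * a w + b w) I J = x * quasi_sum a I J + quasi_sum b I J.
Proof. by rewrite /quasi_sum big_split mulr_sumr. Qed.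

Definition split_sum I (G : seq letter -> seq letter -> R) : R :=
  \sum_(k < (size I).+1) G (take k I) (drop k I).

Lemma tensor_mul_split a b I :
  tensor_mul a b I = split_sum I (fun A B => a A * b B).
Proof. by []. Qed.

Lemma split_sum0 G : split_sum [::] G = G [::] [::].
Proof. by rewrite /split_sum big_ord1. Qed.

Lemma split_sum_cons i I G : split_sum (i :: I) G =
  G [::] (i :: I) + split_sum I (fun A B => G (i :: A) B).
Proof. by rewrite /split_sum big_ord_recl. Qed.

Lemma split_sumD I G G' :
  split_sum I (fun A B => G A B + G' A B) = split_sum I G + split_sum I G'.
Proof. exact: big_split. Qed.

Lemma eq_split_sum I G G' : (forall A B, G A B = G' A B) ->
  split_sum I G = split_sum I G'.
Proof. by move=> GG'; apply: eq_bigr => k _; exact: GG'. Qed.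

(** The bialgebra law: deconcatenation is multiplicative for the quasi-shuffle product. Being valid
    for arbitrary series, it lets Chen's relation act on a quasi-shuffle sum. *)
Lemma quasi_sum_tensor_mul a b I J : quasi_sum (tensor_mul a b) I J =
  split_sum I (fun I1 I2 => split_sum J (fun J1 J2 =>
    quasi_sum a I1 J1 * quasi_sum b I2 J2)).
Proof.
have [n] := ubnP (size I + size J); elim: n a I J => // n IHn a I J IJn.
case: I IJn => [|i I] IJn.
  rewrite split_sum0 quasi_sum0l tensor_mul_split.
  apply: eq_split_sum => A B.
  by rewrite !quasi_sum0l.
case: J IJn => [|j J] IJn.
  rewrite quasi_sum0r tensor_mul_split.
  apply: eq_split_sum => A B.
  by rewrite split_sum0 !quasi_sum0r.
have shift c : (fun w => tensor_mul a b (c :: w)) =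
    (fun w => a [::] * b (c :: w) + tensor_mul (fun v => a (c :: v)) b w).
  by apply/funext => w; rewrite tensor_mul_cons.
rewrite quasi_sum_cons !shift !quasi_sum_lin.
have IJ1 : (size I + size (j :: J) < n)%N by [].
have IJ2 : (size (i :: I) + size J < n)%N by move: IJn; rewrite /= addnS.
have IJ3 : (size I + size J < n)%N by apply: leq_ltn_trans IJ2; rewrite leq_add2r leqnSn.
rewrite (IHn _ _ _ IJ1) (IHn _ _ _ IJ2).
transitivity (a [::] * quasi_sum b (i :: I) (j :: J) +
  split_sum I (fun I1 I2 => split_sum (j :: J) (fun J1 J2 =>
    quasi_sum (fun v => a (i :: v)) I1 J1 * quasi_sum b I2 J2)) +
  split_sum (i :: I) (fun I1 I2 => split_sum J (fun J1 J2 =>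
    quasi_sum (fun v => a (j :: v)) I1 J1 * quasi_sum b I2 J2)) +
  if sp i && sp j then split_sum I (fun I1 I2 => split_sum J (fun J1 J2 =>
    quasi_sum (fun v => a (brk i j :: v)) I1 J1 * quasi_sum b I2 J2)) else 0).
  rewrite quasi_sum_cons; case: ifP => _; last by ring.
  by rewrite (IHn _ _ _ IJ3); ring.
rewrite !split_sum_cons quasi_sum0l -!addrA; congr (_ + _).
rewrite [RHS]addrC -[X in _ = X + _]addr0.
have -> : split_sum J (fun A B => quasi_sum a [::] (j :: A) * quasi_sum b (i :: I) B)
  = split_sum J (fun A B => quasi_sum (fun v => a (j :: v)) [::] A * quasi_sum b (i :: I) B).
  by apply: eq_split_sum => A B; rewrite !quasi_sum0l.
have -> : split_sum I (fun A B => split_sum (j :: J) (fun J1 J2 =>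
      quasi_sum a (i :: A) J1 * quasi_sum b B J2)) =
   split_sum I (fun I1 I2 => split_sum (j :: J) (fun J1 J2 =>
    quasi_sum (fun v => a (i :: v)) I1 J1 * quasi_sum b I2 J2)) +
  (split_sum I (fun A B => split_sum J (fun J1 J2 =>
    quasi_sum (fun v => a (j :: v)) (i :: A) J1 * quasi_sum b B J2)) +
  if sp i && sp j then split_sum I (fun I1 I2 => split_sum J (fun J1 J2 =>
    quasi_sum (fun v => a (brk i j :: v)) I1 J1 * quasi_sum b I2 J2)) else 0).
  have -> : (if sp i && sp j then split_sum I (fun I1 I2 => split_sum J (fun J1 J2 =>
    quasi_sum (fun v => a (brk i j :: v)) I1 J1 * quasi_sum b I2 J2)) else 0) =
    split_sum I (fun I1 I2 => split_sum J (fun J1 J2 =>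
    (if sp i && sp j then quasi_sum (fun v => a (brk i j :: v)) I1 J1 else 0) * quasi_sum b I2 J2)).
    case: ifP => // _; rewrite /split_sum big1// => k _.
    by rewrite big1// => l _; rewrite mul0r.
  rewrite -!split_sumD; apply: eq_split_sum => A B.
  rewrite !split_sum_cons !quasi_sum0r -!addrA; congr (_ + _).
  rewrite -!split_sumD; apply: eq_split_sum => A' B'.
  by rewrite quasi_sum_cons; ring.
ring.
Qed.

(** Interleaving keeps all letters and contraction preserves weight by the hypothesis on [brk]. *)
Lemma quasi_shuffle_weight (wt : letter -> nat) I J w :
  (forall i j, sp i -> sp j -> wt (brk i j) = (wt i + wt j)%N) ->
  w \in quasi_shuffle I J -> weight wt w = (weight wt I + weight wt J)%N.
Proof.
move=> wtb; have [n] := ubnP (size I + size J); elim: n I J w => // n IHn.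
case=> [|i I] [|j J] w IJn; rewrite ?inE.
- by move=> /eqP->.
- by move=> /eqP->.
- by move=> /eqP->; rewrite addn0.
have IJ1 : (size I + size (j :: J) < n)%N by [].
have IJ2 : (size (i :: I) + size J < n)%N by move: IJn; rewrite /= addnS.
have IJ3 : (size I + size J < n)%N by apply: leq_ltn_trans IJ2; rewrite leq_add2r leqnSn.
rewrite /= !mem_cat => /or3P[/mapP[v vI ->]|/mapP[v vI ->]|].
- rewrite /weight/= -/(weight _ _) (IHn _ _ _ IJ1 vI) /weight/= -!/(weight _ _); lia.
- rewrite /weight/= -/(weight _ _) (IHn _ _ _ IJ2 vI) /weight/= -!/(weight _ _); lia.
case: ifP => // /andP[si sj] /mapP[v vI ->].
rewrite /weight/= -/(weight _ _) (IHn _ _ _ IJ3 vI) (wtb _ _ si sj) /weight/=; lia.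
Qed.

End quasi_shuffle.

(** * The quasi-shuffle identity for the lift *)

Section quasi_shuffle_lift.
Context {R : realType} {T p : R} {d : nat}.
Hypothesis T0 : 0 < T.
Hypothesis p23 : 2 < p < 3.
Local Notation letter := 'I_(hatd d).
Local Notation rough := (rough_path T p (hatd d)).
Local Notation wght := (weight (@letter_weight d)).
Implicit Types (Xh : rough) (a b c : letter) (w I J : seq letter).

Lemma vanishing_rough_bound q C n V Xh D s t : p < q -> q < 3 -> (3 <= n)%N -> 0 <= C ->
  size_control V Xh -> rough_bound q C n V Xh D ->
  0 <= s -> s <= t -> t <= T -> vanishing s t D.
Proof.
move=> pq q3 n3 C0 VX hD s0 st tT e e0.
have B0 : 0 <= V T - V 0 by have /andP[] := control_total VX (lexx 0) (ltW T0) (lexx T).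
have [mm mm0 hm] := @rough_bound_vanishing R T p d p23 q C n _ e pq q3 n3 C0 B0 e0.
have [delta d0 hd] := rp_size_small Xh mm0.
exists delta => // P sP; apply: (hm Xh V D VX (lexx _) hD delta) sP => //.
by move=> u v u0 uv vT uvd; apply/ltW/hd.
Qed.

Lemma rough_boundM q C C' n n' V Xh D D' : 0 <= C -> 0 <= C' ->
  rough_bound q C n V Xh D -> rough_bound q C' n' V Xh D' ->
  rough_bound q (C * C') (n + n') V Xh (fun u v => D u v * D' u v).
Proof.
move=> C0 C'0 hD hD' u v mm u0 uv vT mm0 Xm.
by rewrite normrM exprD mulrACA ler_pM// ?hD ?hD'.
Qed.

Variable brk : letter -> letter -> letter.
Hypothesis brkP : forall a b, is_space a -> is_space b ->
  ~~ is_space (brk a b) /\ @bracket_relation R T p d a b (brk a b).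
Local Notation qsum := (quasi_sum (@is_space d) brk).

Lemma letter_weight_bracket a b : is_space a -> is_space b ->
  letter_weight (brk a b) = (letter_weight a + letter_weight b)%N.
Proof.
by move=> aS bS; have [cN _] := brkP aS bS; rewrite /letter_weight aS bS (negPf cN).
Qed.

Lemma rough_lift_nil Xh s t : extended_rough_path Xh -> 0 <= s -> s <= t -> t <= T ->
  rough_lift Xh s t [::] = 1.
Proof. by move=> XE s0 st tT; rewrite (rough_lift_low T0 p23). Qed.

(** Two nonempty words of total weight at most 2 are single space letters, for which the identity is
    the bracket relation. *)
Lemma quasi_shuffle_low Xh s t I J : extended_rough_path Xh ->
  0 <= s -> s <= t -> t <= T -> I != [::] -> J != [::] ->
  (wght I + wght J <= 2)%N ->
  rough_lift Xh s t I * rough_lift Xh s t J = qsum (rough_lift Xh s t) I J.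
Proof.
move=> XE s0 st tT; case: I => // a I _; case: J => // b J _ IJ2.
have h1 := size_weight (@letter_weight_gt0 d) I.
have h2 := size_weight (@letter_weight_gt0 d) J.
have a0 := letter_weight_gt0 a; have b0 := letter_weight_gt0 b.
have wI : wght (a :: I) = (letter_weight a + wght I)%N by [].
have wJ : wght (b :: J) = (letter_weight b + wght J)%N by [].
have [I0 J0] : I = [::] /\ J = [::].
  move: IJ2 h1 h2 a0 b0; rewrite wI wJ.
  move: (wght I) (wght J) (letter_weight a) (letter_weight b) => x y z t'.
  by case: I {wI} => [|i I] /=; case: J {wJ} => [|j J] //=; lia.
rewrite {}I0 {}J0 in wI wJ IJ2 *.
have aS : is_space a.
  by move: IJ2 wI wJ; rewrite /weight/= /letter_weight; do 2 case: ifP => //; lia.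
have bS : is_space b.
  by move: IJ2 wI wJ; rewrite /weight/= /letter_weight; do 2 case: ifP => //; lia.
have [_ rel] := brkP aS bS.
rewrite quasi_sum_cons !(quasi_sum0l, quasi_sum0r) aS bS/=.
rewrite !(rough_lift_low T0 p23)//=; try by rewrite /weight/= /letter_weight ?aS ?bS//; case: ifP.
by rewrite aS bS/= rel.
Qed.

(* The defect of the quasi-shuffle identity is additive once the identity
   holds for shorter words, and it is of order weight >= 3. *)
Lemma quasi_shuffle_rough_lift Xh s t I J : extended_rough_path Xh ->
  0 <= s -> s <= t -> t <= T ->
  rough_lift Xh s t I * rough_lift Xh s t J = qsum (rough_lift Xh s t) I J.
Proof.
move=> XE; have [n] := ubnP (size I + size J); elim: n s t I J => // n IHn s t I J IJn s0 st tT.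
have [->|I0] := eqVneq I [::]; first by rewrite quasi_sum0l rough_lift_nil// mul1r.
have [->|J0] := eqVneq J [::]; first by rewrite quasi_sum0r rough_lift_nil// mulr1.
have [IJ2|IJ3] := leqP (wght I + wght J) 2; first exact: quasi_shuffle_low.
pose D u v := rough_lift Xh u v I * rough_lift Xh u v J - qsum (rough_lift Xh u v) I J.
have [V VX] := exists_control T0 p23 Xh.
have /andP[p2 p3] := p23.
pose q := (p + 3) / 2.
have pq : p < q by rewrite /q; lra.
have q3 : q < 3 by rewrite /q; lra.
have [C C1 hC] := @exists_prod_bound R T p d p23 q (wght I + wght J) (ltW pq) q3.
have C0 : 0 <= C by rewrite (le_trans ler01).
apply/eqP; rewrite -subr_eq0; apply/eqP.
have Dadd u v r : 0 <= u -> u <= v -> v <= r -> r <= T -> D u r = D u v + D v r.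
  move=> u0 uv vr rT; have v0 := le_trans u0 uv; have vT := le_trans vr rT.
  rewrite /D (rough_lift_mul T0 p23 XE u0 uv vr rT) quasi_sum_tensor_mul.
  pose S := rough_lift Xh u v; pose S' := rough_lift Xh v r.
  rewrite -/S -/S' /tensor_mul mulr_suml.
  pose E (k : 'I_(size I).+1) (l : 'I_(size J).+1) :=
    S (take k I) * S (take l J) * (S' (drop k I) * S' (drop l J)) -
    qsum S (take k I) (take l J) * qsum S' (drop k I) (drop l J).
  transitivity (\sum_k \sum_l E k l).
    rewrite /split_sum -sumrB; apply: eq_bigr => k _.
    rewrite mulr_sumr -sumrB; apply: eq_bigr => l _.
    by rewrite /E; ring.
  (* The extreme pairs of splits give [D v r] and [D u v]. In every other pair the two prefixes, and
     likewise the two suffixes, are shorter in total than [I] and [J], so the induction hypothesis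
     cancels the term. *)
  rewrite pair_big/= (bigD1 (ord0, ord0))//= (bigD1 (ord_max, ord_max))//=; last first.
    by rewrite xpair_eqE -val_eqE/= size_eq0 (negPf I0).
  rewrite big1 => [|[k l]].
    rewrite addr0 /E/= !take0 !drop0 !take_size !drop_size !quasi_sum0l.
    rewrite /S /S' !rough_lift_nil//; ring.
  move=> /andP[/= kl0 klm].
  have [k0|k0] := boolP ((k == ord_max) && (l == ord_max)).
    by move: klm; rewrite xpair_eqE k0.
  have sub : (size (take k I) + size (take l J) < n)%N.
    apply: leq_trans (IJn : (_ <= n)%N).
    have := ltn_ord k; have := ltn_ord l; rewrite !ltnS => lJ kI.
    rewrite !size_takel//; move: k0; rewrite -!val_eqE/= => k0.
    move: k0; rewrite negb_and => /orP[] /eqP h; clear - h lJ kI; lia.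
  have sub' : (size (drop k I) + size (drop l J) < n)%N.
    apply: leq_trans (IJn : (_ <= n)%N).
    have := ltn_ord k; have := ltn_ord l; rewrite !ltnS => lJ kI.
    rewrite !size_drop; move: kl0; rewrite xpair_eqE -!val_eqE/= negb_and.
    move=> /orP[] /eqP h; clear - h lJ kI; lia.
  by rewrite /E (IHn _ _ _ _ sub u0 uv vT) (IHn _ _ _ _ sub' v0 vr rT) subrr.
have D0 u : 0 <= u -> u <= T -> D u u = 0.
  move=> u0 uT; have := Dadd u u u u0 (lexx u) (lexx u) uT.
  by rewrite -[LHS]addr0 => /addrI.
apply: (@vanishing_additive0 R s t D) => //.
- apply: (@vanishingD R s t (fun u v => rough_lift Xh u v I * rough_lift Xh u v J)
    (fun u v => - qsum (rough_lift Xh u v) I J)).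
    apply: (vanishing_rough_bound pq q3 IJ3 (mulr_ge0 C0 C0) VX) => //.
    apply: rough_boundM => //.
      exact: (rough_lift_bound T0 p23 hC XE VX (leq_addr _ _)).
    exact: (rough_lift_bound T0 p23 hC XE VX (leq_addl _ _)).
  apply: (@vanishing_le R s t (fun u v => qsum (rough_lift Xh u v) I J) _ 1) => //; last first.
    by move=> u v *; rewrite mul1r normrN.
  (* [vanishing_sum] treats every index, so membership in the quasi-shuffle, which determines the
     weight, is written into the summand. *)
  have -> : (fun u v => qsum (rough_lift Xh u v) I J) = (fun u v =>
      \sum_(w <- quasi_shuffle (@is_space d) brk I J)
        if w \in quasi_shuffle (@is_space d) brk I J then rough_lift Xh u v w else 0).
    by apply/funext => u; apply/funext => v; apply: eq_big_seq => w ->.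
  apply: vanishing_sum => w; case wIJ : (w \in quasi_shuffle _ _ I J); last first.
    move=> e e0; exists 1 => // P _; rewrite /partition_sum big1 ?ltW// => k _.
    by rewrite normr0.
  have wE : wght w = (wght I + wght J)%N.
    exact: (quasi_shuffle_weight letter_weight_bracket wIJ).
  have wle : (wght w <= wght I + wght J)%N by rewrite wE.
  have := rough_lift_bound T0 p23 hC XE VX wle; rewrite wE => hw.
  exact: (vanishing_rough_bound pq q3 IJ3 C0 VX hw).
- by rewrite D0// (le_trans s0).
- by move=> u v su uv vt; apply: Dadd => //; exact: le_trans su.
Qed.

End quasi_shuffle_lift.

(** * Continuity of the signature *)

Section lift_continuity.
Context {R : realType} {T p : R} {d : nat}.
Hypothesis T0 : 0 < T.
Hypothesis p23 : 2 < p < 3.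
Local Notation letter := 'I_(hatd d).
Local Notation rough := (rough_path T p (hatd d)).
Local Notation wght := (weight (@letter_weight d)).
Implicit Types (Xh Yh : rough) (a b c : letter) (w I J : seq letter).
Variables (K : set rough) (M : R).
Hypothesis KE : K `<=` extended_rough_path.
Hypothesis KM : forall X, K X -> (rp_norm X <= M%:E)%E.

Lemma near_within_dist Xh e : 0 < e ->
  \forall Y \near within K (nbhs Xh), K Y /\ (rp_dist Xh Y <= e%:E)%E.
Proof.
move=> e0; apply/nbhs_ballP; exists e => // Y; rewrite /ball/= /rp_ball/= => XY KY.
by split => //; exact: ltW.
Qed.

Lemma local_tensor_cvg Xh s t w : 0 <= s -> s <= t -> t <= T ->
  local_tensor Y s t w @[Y --> within K (nbhs Xh)] --> local_tensor Xh s t w.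
Proof.
move=> s0 st tT; have /andP[p2 p3] := p23.
apply/cvgrPdist_le => e e0; have := near_within_dist Xh e0.
apply: filterS => Y [KY XY]; have [h1 h2] := ler_rp_dist (ltW p2) (ltW e0) XY s0 st tT.
case: w => [|a [|b [|c w]]] /=; rewrite ?subrr ?normr0 ?(ltW e0)//.
  apply: le_trans h1; apply: le_trans (ler_enorm_entry _ ord0 a).
  by rewrite !mxE.
case: ifP => _; last by rewrite subrr normr0 ltW.
apply: le_trans h2; apply: le_trans (ler_enorm_entry _ a b).
by rewrite !mxE.
Qed.

(* The limit of a function along the neighborhoods of X in K, X included, can
   only be its value at X; so it is enough that the limit exists. *)
Lemma rough_lift_continuous w : {within K, continuous (fun Xh => rough_lift Xh 0 T w)}.
Proof.
apply/subspace_continuousP => X KX; have /andP[p2 p3] := p23.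
have FF : ProperFilter (within K (nbhs X)) by apply: within_nbhs_proper; exact: subset_closure.
suff [l hl] : exists l : R,
    rough_lift Y 0 T w @[Y --> within K (nbhs X)] --> l.
  suff E : rough_lift X 0 T w = l by move: hl; rewrite -E.
  apply/eqP; rewrite eq_sym -subr_eq0 -normr_le0; apply/ler_addgt0Pr => e e0.
  have h : \forall Y \near within K (nbhs X), `|l - rough_lift Y 0 T w| < e.
    exact: (cvgr_dist_lt (fun Y => rough_lift Y 0 T w) l hl _ e0).
  by rewrite add0r ltW//; exact: (nbhs_singleton h KX).
have near_ext : \forall Y \near within K (nbhs X), K Y.
  by apply/nbhs_ballP; exists 1 => //= Y _.
apply: (@multiplicative_cvg _ _ _ (within K (nbhs X)) _ (@rough_lift R T p d) 0 T
   (fun w => wght w <= 2)%N) => //; last exact: ltW.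
- move=> s t s0 st tT; apply: filterS near_ext => Y /KE YE.
  exact: (rough_lift_nil T0 p23).
- move=> t t0 tT; apply: filterS near_ext => Y /KE YE.
  apply: tensor_mul_idem; first exact: (rough_lift_nil T0 p23).
  by rewrite -(rough_lift_mul T0 p23).
- move=> s u t s0 su ut tT; apply: filterS near_ext => Y /KE YE.
  exact: (rough_lift_mul T0 p23).
- move=> s t v s0 st tT v2; exists (local_tensor X s t v).
  apply: cvg_trans (@local_tensor_cvg X s t v s0 st tT).
  apply: near_eq_cvg; apply: filterS near_ext => Y /KE YE.
  by rewrite (rough_lift_low T0 p23).
move=> s t v s0 st tT; rewrite -ltnNge => v3 e e0.
pose q := (p + 3) / 2.
have pq : p < q by rewrite /q; lra.
have q3 : q < 3 by rewrite /q; lra.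
have [C C1 hC] := @exists_prod_bound R T p d p23 q (wght v) (ltW pq) q3.
have [B B0 hB] := @rp_control R T p (hatd d) M T0 (ltW p2).
have [mm mm0 hm] := @rough_bound_vanishing R T p d p23 q C (wght v) B e pq q3 v3 (le_trans ler01 C1) B0 e0.
have mm2 : 0 < mm / 2 by rewrite divr_gt0.
have [delta d0 hd] := rp_size_small X mm2.
have [P sP] := fine_partition_exists d0 st.
exists P; first exact: fine_partition_itv sP.
(* A distance [z] moves the size by at most [mm / 2], so every such [Y] has sizes at most [mm]
   wherever [X] stays below [mm / 2], and the same [P] serves. *)
pose z := Num.min (mm / 2) ((mm / 2) ^+ 2).
have z0 : 0 < z by rewrite lt_min mm2 exprn_gt0.
apply: filterS (near_within_dist X z0) => Y [KY XY].
have [V VY VB] := hB Y (KM KY).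
apply: (hm Y V (fun s t => rough_lift Y s t v) VY VB _ delta _ _ _ _ s0 tT sP).
  exact: (rough_lift_bound T0 p23 hC (KE KY) VY (leqnn _)).
move=> u r u0 ur rT urd.
apply: le_trans (ler_rp_size_dist (ltW p2) (ltW z0) XY u0 ur rT) _.
rewrite [leRHS](splitr mm) lerD//; first by apply/ltW/hd.
rewrite ge_max; apply/andP; split; first by rewrite ge_min lexx.
rewrite -(ger0_norm (ltW mm2)) -sqrtr_sqr ler_wsqrtr//.
by rewrite ge_min lexx orbT.
Qed.

End lift_continuity.

(** * Stone-Weierstrass *)

(** Finitely many local indices have a common majorant in [D]. This one form of compactness gives
    bounds of continuous functions as well as the maxima and minima in Stone-Weierstrass. *)
Lemma compact_directed (X : topologicalType) (K : set X) (I : Type) (D : set I)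
    (P : I -> X -> Prop) :
  compact K -> D !=set0 ->
  (forall i j, D i -> D j -> exists2 k, D k &
     (forall x, P i x -> P k x) /\ (forall x, P j x -> P k x)) ->
  (forall x, K x -> exists2 i, D i & \forall y \near within K (nbhs x), P i y) ->
  exists2 i, D i & forall x, K x -> P i x.
Proof.
move=> /compact_near_coveringP cK [i0 Di0] Ddir Ploc.
pose F : set_system I := [set S | exists2 i, D i &
  forall k, D k -> (forall x, P i x -> P k x) -> S k].
have FF : Filter F.
  split; first by exists i0.
  - move=> S S' [i Di iS] [j Dj jS']; have [k Dk [ik jk]] := Ddir _ _ Di Dj.
    exists k => // l Dl kl; split.
      by apply: iS => // x /ik/kl.
    by apply: jS' => // x /jk/kl.
  - by move=> S S' SS' [i Di iS]; exists i => // k Dk ik; apply/SS'/iS.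
have /(_ _)[|i Di iP] := cK I F (fun k y => K y -> P k y) FF.
  move=> x Kx; have [i Di iP] := Ploc x Kx.
  exists ([set y | K y -> P i y], [set k | forall x, P i x -> P k x]).
    by split => //; exists i.
  by move=> [y k]/= [iy ik] Ky; apply/ik/iy.
by exists i => // x Kx; exact: iP.
Qed.

Section stone_weierstrass.
Context {R : realType}.

(** The classical iteration for the square root of [h * h]. Only sums, products and constants occur,
    hence the factor [-1], so that applied to a function it stays in the algebra. *)
Fixpoint abs_approx (h : R) (n : nat) : R :=
  if n is n'.+1 then abs_approx h n' + 2^-1 * (h * h + -1 * (abs_approx h n' * abs_approx h n'))
  else 0.

(** With [t = |h|], one step multiplies the error by [1 - (t + q) / 2], at most [1 - t / 2]; the
    third bound propagates because [(1 - t / 2) * (2 + (n + 1) * t) <= 2 + n * t]. *)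
Lemma abs_approx_bound h n : `|h| <= 1 ->
  [/\ 0 <= abs_approx h n, abs_approx h n <= `|h| &
      (`|h| - abs_approx h n) * (2 + n%:R * `|h|) <= 2 * `|h|].
Proof.
move=> h1; have h0 := normr_ge0 h.
have hh : h * h = `|h| * `|h| by rewrite -!expr2 real_normK// num_real.
elim: n => [|n [q0 qh IHn]] /=; first by split => //; rewrite mul0r; lra.
rewrite hh -[n.+1%:R]natr1; move: (abs_approx h n) q0 qh IHn => q q0 qh IHn.
have n0 : 0 <= n%:R :> R by [].
move: `|h| (n%:R) h0 h1 qh IHn n0 => t N t0 t1 qh IHn N0.
have e0 : 0 <= t - q by rewrite subr_ge0.
pose q' := q + 2^-1 * (t * t + -1 * (q * q)).
have tq : t - q' = (t - q) * (1 - (t + q) / 2) by rewrite /q'; field.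
have tq1 : t - q' <= (t - q) * (1 - t / 2) by rewrite tq ler_wpM2l//; lra.
have tN : 0 <= 2 + (N + 1) * t by nra.
split; rewrite -/q'.
- by have := mulr_ge0 e0 (addr_ge0 t0 q0); rewrite /q'; nra.
- by rewrite -subr_ge0 tq mulr_ge0//; lra.
apply: le_trans IHn; apply: (@le_trans _ _ ((t - q) * (1 - t / 2) * (2 + (N + 1) * t))).
  by rewrite ler_wpM2r.
by rewrite -mulrA ler_wpM2l//; nra.
Qed.

Lemma abs_approx_cvg h n : `|h| <= 1 -> `| `|h| - abs_approx h n.+1| <= 2 / n.+1%:R.
Proof.
move=> h1; have [q0 qh qe] := abs_approx_bound n.+1 h1.
have n0 : 0 < n.+1%:R :> R by [].
rewrite ger0_norm ?subr_ge0// ler_pdivlMr//.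
have [h0|h0] := eqVneq `|h| 0; first by move: q0 qh; rewrite h0; nra.
have hp : 0 < `|h| by rewrite lt0r h0/=.
rewrite -(ler_pM2r hp); nra.
Qed.

Variables (X : pseudoMetricType R) (K : set X).
Hypothesis cK : compact K.

Lemma compact_bounded_fun (g : X -> R) : {within K, continuous g} ->
  exists2 M, 0 < M & forall x, K x -> `|g x| <= M.
Proof.
move=> /within_continuousP gc.
apply: (@compact_directed X K R [set M | 0 < M] (fun M x => `|g x| <= M)) => //.
- by exists 1 => /=.
- move=> M M' /= M0 M'0; exists (Num.max M M'); first by rewrite /= lt_max M0.
  by split => x gx; rewrite le_max gx ?orbT.
move=> x Kx; exists (`|g x| + 1); first by rewrite /= ltr_wpDl.
have [r r0 xr] := gc x Kx 1 ltr01.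
apply/nbhs_ballP; exists r => // y xy Ky.
have := xr y Ky xy; have := ler_normB (g x) (g x - g y); rewrite subKr; lra.
Qed.

Variable A : set (X -> R).
Hypothesis A_cst : forall c : R, A (fun=> c).
Hypothesis A_add : forall g h, A g -> A h -> A (fun x => g x + h x).
Hypothesis A_mul : forall g h, A g -> A h -> A (fun x => g x * h x).
Hypothesis A_cont : forall g, A g -> {within K, continuous g}.

Definition unif_closure : set (X -> R) :=
  [set g | {within K, continuous g} /\
     forall e, 0 < e -> exists2 a, A a & forall x, K x -> `|g x - a x| <= e].

Lemma subset_unif_closure a : A a -> unif_closure a.
Proof.
by move=> Aa; split => [|e e0]; [exact: A_cont|exists a => // x _; rewrite subrr normr0 ltW].
Qed.

Lemma unif_closureD g h : unif_closure g -> unif_closure h ->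
  unif_closure (fun x => g x + h x).
Proof.
move=> [gc gA] [hc hA]; split.
  by move=> x; apply: cvgD; [exact: gc|exact: hc].
move=> e e0; have e20 : 0 < e / 2 by rewrite divr_gt0.
have [a Aa ga] := gA _ e20; have [b Ab hb] := hA _ e20.
exists (fun x => a x + b x) => [|x Kx]; first exact: A_add.
rewrite (_ : _ - _ = (g x - a x) + (h x - b x)); last by ring.
by rewrite (le_trans (ler_normD _ _))// [leRHS](splitr e) lerD ?ga ?hb.
Qed.

Lemma unif_closureZ c g : unif_closure g -> unif_closure (fun x => c * g x).
Proof.
move=> [gc gA]; split; first by move=> x; apply: cvgM; [exact: cvg_cst|exact: gc].
move=> e e0; have c0 : 0 < `|c| + 1 by rewrite ltr_wpDl.
have [a Aa ga] := gA _ (divr_gt0 e0 c0).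
exists (fun x => c * a x) => [|x Kx]; first by apply: A_mul.
rewrite -mulrBr normrM; have := ga x Kx; rewrite ler_pdivlMr// => /(le_trans _); apply.
by rewrite mulrC ler_wpM2l// lerDl.
Qed.

Lemma unif_closure_abs g : unif_closure g -> unif_closure (fun x => `|g x|).
Proof.
move=> [gc gA]; split.
  by move=> x; apply: cvg_norm; exact: gc.
move=> e e0; have e20 : 0 < e / 2 by rewrite divr_gt0.
have [a Aa ga] := gA _ e20.
have [M M0 aM] := compact_bounded_fun (A_cont Aa).
pose h x := M^-1 * a x.
have Ah : A h by apply: A_mul.
have h1 x : K x -> `|h x| <= 1.
  by move=> Kx; rewrite normrM ger0_norm ?invr_ge0 ?(ltW M0)// ler_pdivrMl// mulr1 aM.
have Aq n : A (fun x => abs_approx (h x) n).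
  elim: n => [|n IHn] /=; first exact: A_cst.
  apply: A_add => //; apply: A_mul; first exact: A_cst.
  by apply: A_add; [exact: A_mul|apply: A_mul; [exact: A_cst|exact: A_mul]].
(* This [n] makes the rescaled error [M * (2 / n.+1)] at most [e / 2]. *)
pose n := Num.truncn (4 * M / e).
have nM : 4 * M / e < n.+1%:R by rewrite truncnS_gt.
exists (fun x => M * abs_approx (h x) n.+1) => [|x Kx]; first by apply: A_mul.
have aE : `|a x| = M * `|h x|.
  by rewrite /h normrM ger0_norm ?invr_ge0 ?(ltW M0)// mulrA divff ?mul1r// gt_eqF.
rewrite (_ : _ - _ = (`|g x| - `|a x|) + M * (`|h x| - abs_approx (h x) n.+1)); last first.
  by rewrite aE; ring.
rewrite (le_trans (ler_normD _ _))// [leRHS](splitr e) lerD//.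
  exact: le_trans (ler_dist_dist _ _) (ga x Kx).
rewrite normrM (ger0_norm (ltW M0)).
apply: (@le_trans _ _ (M * (2 / n.+1%:R))).
  by rewrite ler_wpM2l ?(ltW M0)// abs_approx_cvg// h1.
rewrite mulrA ler_pdivrMr//; move: nM; rewrite ltr_pdivrMr//; lra.
Qed.

Lemma unif_closure_max g h : unif_closure g -> unif_closure h ->
  unif_closure (fun x => Num.max (g x) (h x)).
Proof.
move=> gA hA.
rewrite (_ : (fun x => _) =
    (fun x => 2^-1 * (g x + h x + `|g x + -1 * h x|))); last first.
  by apply/funext => x; rewrite maxr_absE mulN1r mulrC.
by apply/unif_closureZ/unif_closureD; [exact: unif_closureD|
  apply/unif_closure_abs/unif_closureD => //; exact: unif_closureZ].
Qed.

Lemma unif_closure_min g h : unif_closure g -> unif_closure h ->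
  unif_closure (fun x => Num.min (g x) (h x)).
Proof.
move=> gA hA.
rewrite (_ : (fun x => _) = (fun x => -1 * Num.max (-1 * g x) (-1 * h x))).
  by apply/unif_closureZ/unif_closure_max; exact: unif_closureZ.
by apply/funext => x; rewrite !mulN1r oppr_max !opprK.
Qed.

Lemma near_close (g : X -> R) x e : {within K, continuous g} -> K x -> 0 < e ->
  \forall y \near within K (nbhs x), `|g x - g y| < e.
Proof.
move=> /within_continuousP gc Kx e0; have [r r0 xr] := gc x Kx e e0.
by apply/nbhs_ballP; exists r => // y xy Ky; exact: xr.
Qed.

(** Separation is asked only where [f] differs, which suits a pseudometric space: continuous
    functions, [f] included, cannot tell apart points of [K] at distance zero. *)
Lemma stone_weierstrass (f : X -> R) : {within K, continuous f} ->
  (forall x y, K x -> K y -> f x <> f y -> exists2 a, A a & a x <> a y) ->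
  forall e, 0 < e -> exists2 a, A a & forall x, K x -> `|f x - a x| < e.
Proof.
move=> fc sep e e0.
have [K0|/set0P[x0 Kx0]] := eqVneq K set0.
  by exists (fun=> 0) => // x; rewrite K0.
have interp x y : K x -> K y -> exists2 a, A a & a x = f x /\ a y = f y.
  move=> Kx Ky; have [fxy|/eqP fxy] := eqVneq (f x) (f y).
    by exists (fun=> f x).
  have [b Ab /eqP bxy] := sep x y Kx Ky fxy.
  have bxy0 : b y - b x != 0 by rewrite subr_eq0 eq_sym.
  exists (fun z => f x + (f y - f x) / (b y - b x) * (b z + - b x)).
    by apply: A_add => //; apply: A_mul => //; exact: A_add.
  by split; [ring|field].
have e40 : 0 < e / 4 by rewrite divr_gt0.
(* For fixed [x], the functions interpolating [f] at [x] and at a second point are joined by maxima;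
   all of them equal [f x] at [x]. *)
have lower x : K x -> exists2 h, unif_closure h & h x = f x /\
    forall y, K y -> f y - e / 4 < h y.
  move=> Kx.
  pose D := [set h | unif_closure h /\ h x = f x].
  have [||||h [hA hx] hy] := @compact_directed X K (X -> R) D (fun h y => f y - e / 4 < h y).
  - exact: cK.
  - have [a Aa [ax _]] := interp x x Kx Kx.
    by exists a; split => //; exact: subset_unif_closure.
  - move=> g h [gA gx] [hA hx]; exists (fun y => Num.max (g y) (h y)).
      by split; [exact: unif_closure_max|rewrite gx hx maxxx].
    by split => y hy; rewrite lt_max hy ?orbT.
  - move=> y Ky; have [a Aa [ax ay]] := interp x y Kx Ky.
    exists a; first by split => //; exact: subset_unif_closure.
    have e80 : 0 < e / 8 by rewrite divr_gt0.
    have := near_close fc Ky e80; have := near_close (A_cont Aa) Ky e80.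
    apply: filterS2 => z; rewrite ay !ltr_norml => /andP[? ?] /andP[? ?]; lra.
  by exists h.
(* Minima over [x] preserve the global lower bound, and near each [x] the equality [h x = f x] gives
   the upper one. *)
pose D := [set h | unif_closure h /\ forall y, K y -> f y - e / 4 < h y].
have [||||h [[hc hA] hl] hu] := @compact_directed X K (X -> R) D (fun h y => h y < f y + e / 4).
- exact: cK.
- by have [h hA [_ hl]] := lower x0 Kx0; exists h.
- move=> g h [gA gl] [hA hl]; exists (fun y => Num.min (g y) (h y)).
    by split; [exact: unif_closure_min|move=> y Ky; rewrite lt_min gl ?hl].
  by split => y hy; rewrite gt_min hy ?orbT.
- move=> x Kx; have [h hA [hx hl]] := lower x Kx; exists h => //.
  have e80 : 0 < e / 8 by rewrite divr_gt0.
  have := near_close fc Kx e80; have := near_close hA.1 Kx e80.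
  apply: filterS2 => z; rewrite hx !ltr_norml => /andP[? ?] /andP[? ?]; lra.
have [a Aa ha] := hA _ e40; exists a => // x Kx.
have := hl x Kx; have := hu x Kx; have := ha x Kx.
rewrite ler_norml ltr_norml => /andP[? ?] ? ?; apply/andP; split; lra.
Qed.

End stone_weierstrass.

(** * Separation of points *)

Section moments.
Context {R : realType} (T : R).
Hypothesis T0 : 0 < T.
Implicit Types (f h : R -> R).

(** Comparison with left-point sums: where [h] is within [e] of [c], the increment of [f] over
    [[s, r]] is within [e * (r - s)] of [c * (r - s)]. *)
Lemma is_derive_of_vanishing f h :
  {within `[0, T], continuous h} ->
  (forall s t, 0 <= s -> s <= t -> t <= T ->
     vanishing s t (fun u v => f v - f u - h u * (v - u))) ->
  forall t, 0 < t -> t < T -> is_derive t 1 f (h t).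
Proof.
move=> /within_continuousP hc fv t t0 tT.
have key c e s r : 0 <= s -> s <= r -> r <= T ->
    (forall u, s <= u -> u <= r -> `|h u - c| <= e) ->
    `|f r - f s - c * (r - s)| <= e * (r - s).
  move=> s0 sr rT hce; apply/ler_addgt0Pr => z z0.
  have [delta d0 hd] := fv s r s0 sr rT z z0.
  have [P sP] := fine_partition_exists d0 sr.
  have sP' := fine_partition_itv sP.
  have -> : f r - f s - c * (r - s) = partition_sum s r P (fun u v => f v - f u - h u * (v - u))
      + partition_sum s r P (fun u v => (h u - c) * (v - u)).
    rewrite -partition_sumD -(partition_sum_telescope f sP').
    rewrite -(partition_sum_telescope id sP') -mulNr -partition_sumZ -partition_sumD.
    by apply: eq_bigr => k _; ring.
  rewrite (le_trans (ler_normD _ _))// addrC lerD//; last first.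
    exact: le_trans (ler_norm_partition_sum _ _ _ _) (hd _ sP).
  rewrite (le_trans (ler_norm_partition_sum _ _ _ _))//.
  rewrite -(partition_sum_telescope id sP') -partition_sumZ.
  apply: ler_partition_sum sP _ => u v su uv _ vr.
  rewrite normrM (ger0_norm (_ : 0 <= v - u)) ?subr_ge0 ?(ltW uv)//.
  by rewrite ler_wpM2r ?subr_ge0 ?(ltW uv)// hce// (le_trans (ltW uv)).
have tI : `[0, T]%classic t by rewrite /= in_itv/= !ltW.
suff D : (k^-1 *: ((f \o shift t) (k *: (1 : R)) - f t)) @[k --> 0^'] --> h t.
  by apply: DeriveDef; [apply/cvg_ex; exists (h t)|exact/cvg_lim].
apply/cvgrPdist_le => e e0; have [r r0 hr] := hc t tI e e0.
pose z := Num.min r (Num.min t (T - t)).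
have z0 : 0 < z by rewrite !lt_min r0 t0 subr_gt0.
apply/nbhs_ballP; exists z => // k; rewrite /ball/= sub0r normrN => kz k0.
have /and3P[kr kt kT] : [&& `|k| < r, `|k| < t & `|k| < T - t] by rewrite -!lt_min.
rewrite /GRing.scale/= mulr1.
have kE : `|k^-1| * `|f (k + t) - f t - h t * k| <= e ->
    `|h t - k^-1 * (f (k + t) - f t)| <= e.
  rewrite (_ : h t - _ = - (k^-1 * (f (k + t) - f t - h t * k))).
    by rewrite normrN normrM.
  by field.
apply: kE; rewrite normfV ler_pdivrMl ?normr_gt0// [leRHS]mulrC.
have hle s' u : 0 <= u -> u <= T -> `|t - u| <= `|k| -> s' = h t -> `|h u - s'| <= e.
  move=> u0 uT tu ->; rewrite distrC; apply/ltW/hr; first by rewrite /= in_itv/= u0.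
  by rewrite /ball/=; exact: le_lt_trans kr.
have [k1|k1] := ltP 0 k.
  rewrite (gtr0_norm k1) in kr kt kT *.
  have := key (h t) e t (k + t); rewrite addrK; apply; try lra.
  move=> u tu ut; apply: hle => //; try lra.
  by rewrite (gtr0_norm k1) ler_norml; apply/andP; split; lra.
have k2 : k < 0 by rewrite lt_neqAle k0.
rewrite (ltr0_norm k2) in kr kt kT *.
have := key (h t) e (k + t) t; rewrite opprD addrCA subrr addr0.
rewrite -normrN (_ : - (_ - _) = f (k + t) - f t - h t * k); last by ring.
apply; try lra.
move=> u tu ut; apply: hle => //; try lra.
by rewrite (ltr0_norm k2) ler_norml; apply/andP; split; lra.
Qed.

(** Integration by parts: [q] times [g k.+1], minus the primitive found for the derivative of [q] at
    index [k.+1], is a primitive of [q] times [g k]. Vanishing at both ends says that [q] and [g k]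
    are orthogonal. *)
Lemma polynomial_primitive (g : nat -> R -> R) :
  (forall k, {within `[0, T], continuous (g k)}) ->
  (forall k t, 0 < t -> t < T -> is_derive t 1 (g k.+1) (g k t)) ->
  (forall k, g k.+1 0 = 0) -> (forall k, g k.+1 T = 0) ->
  forall (q : {poly R}) k, exists H : R -> R,
    [/\ {within `[0, T], continuous H},
        forall t, 0 < t -> t < T -> is_derive t 1 H (q.[t] * g k t),
        H 0 = 0 & H T = 0].
Proof.
move=> gc gd g0 gT q; have [n] := ubnP (size q); elim: n q => // n IHn q qn k.
have [->|q0] := eqVneq q 0.
  exists (fun=> 0); split => //; first by move=> x; exact: cvg_cst.
  by move=> t _ _; rewrite horner0 mul0r; exact: is_derive_cst.
have [|H [Hc Hd H0 HT]] := IHn q^`() _ k.+1; first exact: leq_trans (lt_size_deriv q0) qn.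
exists (horner q * g k.+1 - H); split.
- move=> x; apply: cvgB; last exact: Hc.
  apply: cvgM; last exact: gc.
  by apply: (@continuous_subspaceT _ _ _ (horner q)); exact: continuous_horner.
- move=> t t0 tT.
  have -> : q.[t] * g k t = (q.[t] *: g k t + g k.+1 t *: q^`().[t]) - q^`().[t] * g k.+1 t.
    by rewrite /GRing.scale/=; ring.
  apply: is_deriveB; last exact: Hd.
  by apply: is_deriveM; exact: gd.
- by rewrite !fctE g0 H0 mulr0 subr0.
- by rewrite !fctE gT HT mulr0 subr0.
Qed.

Lemma polynomial_dense (g : R -> R) e : {within `[0, T], continuous g} -> 0 < e ->
  exists q : {poly R}, forall t, 0 <= t -> t <= T -> `|g t - q.[t]| < e.
Proof.
move=> gc e0; have cI := @segment_compact R 0 T.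
have [|||||a [q ->] ga] := @stone_weierstrass R R `[0, T]%classic cI
  [set a | exists q : {poly R}, a = horner q] _ _ _ _ g gc _ e e0.
- by move=> c; exists c%:P; apply/funext => x; rewrite hornerC.
- by move=> _ _ [q ->] [q' ->]; exists (q + q'); apply/funext => x; rewrite hornerD.
- by move=> _ _ [q ->] [q' ->]; exists (q * q'); apply/funext => x; rewrite hornerM.
- by move=> _ [q ->]; apply: continuous_subspaceT; exact: continuous_horner.
- move=> x y _ _ gxy; exists (horner 'X); first by exists 'X.
  by rewrite !hornerX => xy; apply: gxy; rewrite xy.
by exists q => t t0 tT; apply: ga; rewrite /= in_itv/= t0.
Qed.

(* Integrating by parts, g 0 is orthogonal to every polynomial. *)
Lemma moments_eq0 (g : nat -> R -> R) :
  (forall k, {within `[0, T], continuous (g k)}) ->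
  (forall k t, 0 < t -> t < T -> is_derive t 1 (g k.+1) (g k t)) ->
  (forall k, g k.+1 0 = 0) -> (forall k, g k.+1 T = 0) ->
  forall t, 0 <= t -> t <= T -> g 0%N t = 0.
Proof.
move=> gc gd g0 gT t t0 tT; apply/eqP/negPn/negP => gt0.
have c0 : 0 < `|g 0%N t| / 2 by rewrite divr_gt0// normr_gt0.
have [B B0 gB] := compact_bounded_fun (@segment_compact R 0 T) (gc 0%N).
have /within_continuousP gc0 := gc 0%N.
have tI : `[0, T]%classic t by rewrite /= in_itv/= t0.
have [delta d0 hd] := gc0 t tI _ c0.
pose a := Num.max 0 (t - delta / 2); pose b := Num.min T (t + delta / 2).
have ab : a < b by rewrite gt_max !lt_min T0/=; apply/and3P; split; lra.
have a0 : 0 <= a by rewrite le_max lexx.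
have bT : b <= T by rewrite ge_min lexx.
have aT : t - delta / 2 <= a by rewrite le_max lexx orbT.
have bt : b <= t + delta / 2 by rewrite ge_min lexx orbT.
pose c := `|g 0%N t| / 2.
have gab x : a <= x -> x <= b -> c ^+ 2 <= g 0%N x ^+ 2.
  move=> ax xb; have xI : `[0, T]%classic x by rewrite /= in_itv/= (le_trans a0)// (le_trans xb).
  have := hd x xI; rewrite /ball/= ltr_norml => h.
  have gx : `|g 0%N t - g 0%N x| < c by apply: h; apply/andP; split; lra.
  rewrite -[leRHS]real_normK ?num_real// lerXn2r ?nnegrE ?(ltW c0)//.
  have := ler_normB (g 0%N t) (g 0%N t - g 0%N x); rewrite subKr.
  have := ler_normB (g 0%N t - g 0%N x) (- g 0%N x); rewrite opprK subrK normrN.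
  by rewrite /c in gx *; lra.
(* With this [e] the total loss [e * B * T] is half of the gain [c ^+ 2 * (b - a)], which
   contradicts [H 0 = H T = 0]. *)
pose e := c ^+ 2 * (b - a) / (2 * B * T).
have ba0 : 0 < b - a by rewrite subr_gt0.
have cc : 0 < c ^+ 2 by rewrite exprn_gt0.
have e0 : 0 < e by apply: divr_gt0; apply: mulr_gt0 => //; apply: mulr_gt0.
have [q hq] := polynomial_dense (gc 0%N) e0.
have [H [Hc Hd H0 HT]] := polynomial_primitive gc gd g0 gT q 0%N.
(* The derivative of [H] differs from the square of [g 0] by at most [e * B], so a lower bound [m]
   on that square becomes growth of [H]. It is used on the three intervals cut out by [a] and
   [b]. *)
have mvt x y m : 0 <= x -> x <= y -> y <= T ->
    (forall z, x <= z -> z <= y -> m <= g 0%N z ^+ 2) ->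
    (m - e * B) * (y - x) <= H y - H x.
  move=> x0 xy yT mg.
  have [||z + ->] := @MVT_segment R H (fun z => q.[z] * g 0%N z) x y xy.
  - move=> z; rewrite in_itv/= => /andP[xz zy].
    by apply: Hd; [exact: le_lt_trans xz|exact: lt_le_trans yT].
  - apply: continuous_subspaceW Hc => z /=; rewrite !in_itv/= => /andP[xz zy].
    by rewrite (le_trans x0)// (le_trans zy).
  rewrite in_itv/= => /andP[xz zy].
  have z0 := le_trans x0 xz; have zT := le_trans zy yT.
  rewrite ler_wpM2r ?subr_ge0//.
  have gzB := gB z; rewrite /= in_itv/= z0 zT in gzB; have {}gzB := gzB isT.
  have : `|(g 0%N z - q.[z]) * g 0%N z| <= e * B.
    by rewrite normrM ler_pM// ltW// hq.
  have := ler_norm ((g 0%N z - q.[z]) * g 0%N z); have := mg z xz zy.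
  rewrite expr2; lra.
have h1 := mvt 0 a 0 (lexx 0) a0 (le_trans (ltW ab) bT) (fun z _ _ => sqr_ge0 _).
have h2 := mvt a b (c ^+ 2) a0 (ltW ab) bT gab.
have h3 := mvt b T 0 (le_trans a0 (ltW ab)) bT (lexx T) (fun z _ _ => sqr_ge0 _).
have eE : e * B * T = c ^+ 2 * (b - a) / 2.
  by rewrite /e; field; apply/andP; split; rewrite gt_eqF.
have := mulr_gt0 cc ba0.
move: h1 h2 h3; rewrite H0 HT; move: eE; move: (H a) (H b) (c ^+ 2) => Ha Hb cc'; nra.
Qed.

End moments.

(** * The signature determines the rough path *)

Section separation.
Context {R : realType} {T p : R} {d : nat}.
Hypothesis T0 : 0 < T.
Hypothesis p23 : 2 < p < 3.
Local Notation letter := 'I_(hatd d).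
Local Notation rough := (rough_path T p (hatd d)).
Local Notation wght := (weight (@letter_weight d)).
Local Notation time := (@time_index d).
Implicit Types (Xh Yh : rough) (w : seq letter).

Lemma rough_lift_vanishing Xh w s t : extended_rough_path Xh -> (3 <= wght w)%N ->
  0 <= s -> s <= t -> t <= T -> vanishing s t (fun u v => rough_lift Xh u v w).
Proof.
move=> XE w3 s0 st tT; have [V VX] := exists_control T0 p23 Xh.
have /andP[p2 p3] := p23.
pose q := (p + 3) / 2.
have pq : p < q by rewrite /q; lra.
have q3 : q < 3 by rewrite /q; lra.
have [C C1 hC] := @exists_prod_bound R T p d p23 q (wght w) (ltW pq) q3.
exact: (vanishing_rough_bound T0 p23 pq q3 w3 (le_trans ler01 C1) VX
  (rough_lift_bound T0 p23 hC XE VX (leqnn _))).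
Qed.

(* S(w 0) is the integral of S(w) against time: the remaining terms of Chen's
   relation end with the time letter and have weight >= 3. *)
Lemma rough_lift_time_vanishing Xh w s t : extended_rough_path Xh ->
  0 <= s -> s <= t -> t <= T ->
  vanishing s t (fun u v => rough_lift Xh 0 v (rcons w time) -
    rough_lift Xh 0 u (rcons w time) - rough_lift Xh 0 u w * (v - u)).
Proof.
move=> XE s0 st tT.
pose D (k : 'I_(size w)) u v := rough_lift Xh 0 u (take k w) * rough_lift Xh u v (rcons (drop k w) time).
have Dv : vanishing s t (fun u v => \sum_(k < size w) D k u v).
  apply: vanishing_sum => k.
  have [M hM] := rough_lift_bounded T0 p23 (take k w) XE.
  have M0 : 0 <= M by apply: le_trans (hM 0 0 (lexx _) (lexx _) (ltW T0)).
  apply: (@vanishing_le R s t (fun u v => rough_lift Xh u v (rcons (drop k w) time)) _ M) => //.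
    apply: rough_lift_vanishing => //; rewrite -cats1 weight_cat.
    have h1 : (0 < wght (drop k w))%N.
      by apply: leq_trans (size_weight (@letter_weight_gt0 d) _); rewrite size_drop subn_gt0.
    have h2 : wght [:: time] = 2 by rewrite /weight/= /letter_weight (negPf (@time_not_space d)).
    by rewrite h2 -[3%N]/(1 + 2)%N leq_add2r.
  move=> u v su uv vt; rewrite normrM ler_wpM2r// hM//.
    exact: le_trans su.
  by rewrite (le_trans uv)// (le_trans vt).
apply: (vanishing_le Dv ler01) => u v su uv vt.
have u0 := le_trans s0 su; have vT := le_trans vt tT; have uT := le_trans uv vT.
rewrite mul1r; suff -> : rough_lift Xh 0 v (rcons w time) - rough_lift Xh 0 u (rcons w time)
    - rough_lift Xh 0 u w * (v - u) = \sum_(k < size w) D k u v by [].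
rewrite (rough_lift_mul T0 p23 XE (lexx 0) u0 uv vT) /tensor_mul size_rcons.
rewrite big_ord_recr/= big_ord_recr/=.
have -> : take (size w).+1 (rcons w time) = rcons w time by rewrite take_oversize ?size_rcons.
have -> : drop (size w).+1 (rcons w time) = [::] by rewrite drop_oversize ?size_rcons.
have takeE k : (k <= size w)%N -> take k (rcons w time) = take k w.
  by move=> kw; rewrite -cats1 takel_cat.
have dropE k : (k <= size w)%N -> drop k (rcons w time) = rcons (drop k w) time.
  move=> kw; rewrite -cats1 drop_cat -cats1 ltn_neqAle kw andbT.
  by have [->|//] := eqVneq k (size w); rewrite subnn drop0 drop_size.
rewrite takeE// dropE// take_size drop_size (rough_lift_nil T0 p23)// mulr1.
have -> : rough_lift Xh u v (rcons [::] time) = v - u.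
  rewrite (rough_lift_low T0 p23)//= ?incr_time// /weight/= /letter_weight.
  by case: ifP.
rewrite (eq_bigr (fun k : 'I_(size w) => D k u v)); last first.
  by move=> k _; rewrite /D /= takeE ?dropE// ltnW.
ring.
Qed.

Lemma rough_lift_path_continuous Xh w : extended_rough_path Xh ->
  {within `[0, T], continuous (fun t => rough_lift Xh 0 t w)}.
Proof.
move=> XE; have [_ _ /(_ w)/within_continuousP Sc _] := rough_lift_lyons T0 p23 XE.
apply/within_continuousP => t; rewrite /= in_itv/= => /andP[t0 tT] e e0.
have [r r0 hr] := Sc (0, t) (conj (lexx 0) (conj t0 tT)) e e0.
exists r => // u; rewrite /= in_itv/= => /andP[u0 uT] tu.
by apply: (hr (0, u) (conj (lexx 0) (conj u0 uT))); split => //=; exact: ballxx.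
Qed.

(** [g k], the difference at [w] followed by [k] time letters, is the derivative of [g k.+1]. These
    functions vanish at 0 since lifts are trivial on the diagonal, and at [T] by hypothesis, so
    [moments_eq0] applies. *)
Lemma rough_lift_determined Xh Yh : extended_rough_path Xh -> extended_rough_path Yh ->
  (forall w, rough_lift Xh 0 T w = rough_lift Yh 0 T w) ->
  forall w t, 0 <= t -> t <= T -> rough_lift Xh 0 t w = rough_lift Yh 0 t w.
Proof.
move=> XE YE XY w t t0 tT; apply/eqP; rewrite -subr_eq0; apply/eqP.
pose wk k := w ++ nseq k time.
have wkS k : wk k.+1 = rcons (wk k) time.
  by rewrite /wk -addn1 nseqD catA cats1.
pose g k t := rough_lift Xh 0 t (wk k) - rough_lift Yh 0 t (wk k).
have -> : rough_lift Xh 0 t w - rough_lift Yh 0 t w = g 0%N t by rewrite /g /wk cats0.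
apply: (moments_eq0 T0) => //.
- move=> k x; apply: cvgB; exact: rough_lift_path_continuous.
- move=> k x x0 xT; apply: (@is_deriveB _ _ _ (fun t => rough_lift Xh 0 t (wk k.+1)) (fun t => rough_lift Yh 0 t (wk k.+1))
      x 1 (rough_lift Xh 0 x (wk k)) (rough_lift Yh 0 x (wk k))).
    apply: (@is_derive_of_vanishing R T (fun t => rough_lift Xh 0 t (wk k.+1))
      (fun t => rough_lift Xh 0 t (wk k))) => //.
      exact: rough_lift_path_continuous.
    move=> s r s0 sr rT.
    by rewrite wkS; exact: rough_lift_time_vanishing.
  apply: (@is_derive_of_vanishing R T (fun t => rough_lift Yh 0 t (wk k.+1))
      (fun t => rough_lift Yh 0 t (wk k))) => //.
      exact: rough_lift_path_continuous.
    move=> s r s0 sr rT.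
  by rewrite wkS; exact: rough_lift_time_vanishing.
- move=> k; rewrite /g !(lyons_diag (rough_lift_lyons T0 p23 _)) ?(ltW T0)//.
  by rewrite subrr.
- by move=> k; rewrite /g XY subrr.
Qed.

Lemma pvar_eq0 r (a : R -> R -> R) : 0 < r ->
  (forall u v, 0 <= u -> u <= v -> v <= T -> a u v = 0) -> pvar T r a = 0%E.
Proof.
move=> r0 a0; apply/eqP; rewrite eq_le pvar_ge0 andbT.
apply: pvar_le => // s Ts.
have -> : partition_sum 0 T s (fun u v => a u v `^ r) = 0.
  apply/eqP; rewrite eq_le; apply/andP; split; last first.
    by apply: partition_sum_ge0 => *; exact: powR_ge0.
  rewrite -[leRHS](mul0r (partition_sum 0 T s (fun _ _ => 0))) -partition_sumZ.
  apply: ler_partition_sum (itv_partition_fine Ts) _ => u v u0 /ltW uv _ vT.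
  by rewrite a0// powR0 ?mulr0// gt_eqF.
by rewrite powR0// invr_eq0 gt_eqF.
Qed.

(** Agreement from [0] to every [t] passes to all [[u, v]] by Chen's relation. The conclusion is
    distance zero and not equality, as values outside [[0, T]] are arbitrary. *)
Lemma rp_dist0_of_lift Xh Yh : extended_rough_path Xh -> extended_rough_path Yh ->
  (forall w, rough_lift Xh 0 T w = rough_lift Yh 0 T w) -> rp_dist Xh Yh = 0%E.
Proof.
move=> XE YE XY; have /andP[p2 p3] := p23.
have det := rough_lift_determined XE YE XY.
have lev (Zh : rough) (ZE : extended_rough_path Zh) t : 0 <= t -> t <= T ->
    (forall i, rough_lift Zh 0 t [:: i] = rp_incr Zh 0 t ord0 i) /\
    (forall i j, rough_lift Zh 0 t [:: i; j] = rp_area Zh 0 t i j).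
  move=> t0 tT; have [h _ _ _] := rough_lift_lyons T0 p23 ZE.
  by have [_ h1 h2] := h _ _ (conj (lexx 0) (conj t0 tT)); split.
have inc t i : 0 <= t -> t <= T -> rp_incr Xh 0 t ord0 i = rp_incr Yh 0 t ord0 i.
  by move=> t0 tT; rewrite -(lev _ XE t t0 tT).1 -(lev _ YE t t0 tT).1 det.
have are t i j : 0 <= t -> t <= T -> rp_area Xh 0 t i j = rp_area Yh 0 t i j.
  by move=> t0 tT; rewrite -(lev _ XE t t0 tT).2 -(lev _ YE t t0 tT).2 det.
have incr u v i : 0 <= u -> u <= v -> v <= T ->
    rp_incr Xh u v ord0 i = rp_incr Yh u v ord0 i.
  move=> u0 uv vT; have := inc v i (le_trans u0 uv) vT; have := inc u i u0 (le_trans uv vT).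
  rewrite /rp_incr !mxE; lra.
rewrite /rp_dist !pvar_eq0 ?adde0//; first by rewrite divr_gt0//; lra.
- move=> u v u0 uv vT; suff -> : rp_area Xh u v - rp_area Yh u v = 0 by rewrite enorm0.
  apply/matrixP => i j; rewrite !mxE.
  have := rp_chen_entry Xh i j (lexx 0) u0 uv vT.
  have := rp_chen_entry Yh i j (lexx 0) u0 uv vT.
  rewrite (are v)// ?(le_trans u0)// (are u)// ?(le_trans uv)//.
  by rewrite (incr 0 u)// ?(incr u v)// ?(le_trans uv)//; lra.
- lra.
move=> u v u0 uv vT.
rewrite (_ : _ - _ = 0) ?enorm0//; apply/matrixP => i j; rewrite (ord1 i).
by have := incr u v j u0 uv vT; rewrite /rp_incr !mxE; lra.
Qed.

End separation.

(** * The algebra of signature functionals *)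

Section signature_algebra.
Context {R : realType} {T p : R} {d : nat}.
Hypothesis T0 : 0 < T.
Hypothesis p23 : 2 < p < 3.
Local Notation letter := 'I_(hatd d).
Local Notation rough := (rough_path T p (hatd d)).
Variable K : set rough.
Hypothesis KE : K `<=` extended_rough_path.

Lemma signatureE (Xh : rough) : extended_rough_path Xh -> signature Xh T = rough_lift Xh 0 T.
Proof. by move=> XE; rewrite /signature (lyons_extensionE T0 p23)// ltW. Qed.

(* Functions are compared on K only, because the quasi-shuffle identity needs
   extended rough paths. *)
Definition signature_functional (a : rough -> R) : Prop :=
  exists ls : seq (R * seq letter), forall X, K X ->
    a X = \sum_(cw <- ls) cw.1 * rough_lift X 0 T cw.2.

Lemma signature_functional_ext a b : (forall X, K X -> a X = b X) ->
  signature_functional a -> signature_functional b.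
Proof. by move=> ab [ls als]; exists ls => X KX; rewrite -ab// als. Qed.

Lemma signature_functional_coord w : signature_functional (fun X : rough => rough_lift X 0 T w).
Proof. by exists [:: (1, w)] => X KX; rewrite big_seq1 mul1r. Qed.

Lemma signature_functional_cst c : signature_functional (fun=> c).
Proof.
exists [:: (c, [::])] => X KX; rewrite big_seq1.
by rewrite (rough_lift_nil T0 p23 (KE KX) (lexx 0) (ltW T0) (lexx T)) mulr1.
Qed.

Lemma signature_functionalD a b : signature_functional a -> signature_functional b ->
  signature_functional (fun X => a X + b X).
Proof.
move=> [la ha] [lb hb]; exists (la ++ lb) => X KX.
by rewrite big_cat/= ha// hb.
Qed.

Lemma signature_functionalZ c a : signature_functional a ->
  signature_functional (fun X => c * a X).
Proof.
move=> [la ha]; exists [seq (c * cw.1, cw.2) | cw <- la] => X KX.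
by rewrite big_map ha// mulr_sumr; apply: eq_bigr => cw _; rewrite mulrA.
Qed.

Lemma signature_functional_sum (I : Type) (r : seq I) (a : I -> rough -> R) :
  (forall i, signature_functional (a i)) ->
  signature_functional (fun X => \sum_(i <- r) a i X).
Proof.
move=> h; elim: r => [|i r IHr].
  by exists [::] => X _; rewrite !big_nil.
apply: signature_functional_ext (signature_functionalD (h i) IHr) => X _.
by rewrite big_cons.
Qed.

Lemma signature_functionalM a b : signature_functional a -> signature_functional b ->
  signature_functional (fun X => a X * b X).
Proof.
move=> [la ha] [lb hb]; have [brk brkP] := @exists_bracket_letter R T p d.
apply: (@signature_functional_ext (fun X : rough => \sum_(cw <- la) cw.1 * \sum_(cw' <- lb)
    cw'.1 * \sum_(w <- quasi_shuffle (@is_space d) brk cw.2 cw'.2) rough_lift X 0 T w)).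
  move=> X KX; rewrite ha// hb// mulr_suml; apply: eq_bigr => cw _.
  rewrite -mulrA; congr (_ * _); rewrite mulr_sumr; apply: eq_bigr => cw' _.
  rewrite mulrCA (quasi_shuffle_rough_lift T0 p23 brkP)//; [exact: KE|exact: ltW].
apply: signature_functional_sum => cw; apply: signature_functionalZ.
apply: signature_functional_sum => cw'; apply: signature_functionalZ.
by apply: signature_functional_sum => w; exact: signature_functional_coord.
Qed.

(** A list may repeat words, so the coefficients of equal words are added up; cancellation may make
    the support smaller than [W]. *)
Lemma signature_functional_pairing a : signature_functional a ->
  exists l : tensor_algebra R (hatd d), forall X, K X ->
    a X = tensor_pairing l (signature X T).
Proof.
move=> [ls als].
pose W := [fset cw.2 | cw in ls]%fset.
pose l : tensor_algebra R (hatd d) :=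
  [fsfun w in W => \sum_(cw <- ls | cw.2 == w) cw.1 | 0].
exists l => X KX; rewrite als// signatureE; last exact: KE.
rewrite /tensor_pairing.
have lW : (finsupp l `<=` W)%fset by exact: finsupp_sub.
rewrite (big_fset_incl _ lW); last first.
  by move=> w _; rewrite memNfinsupp => /eqP ->; rewrite mul0r.
transitivity (\sum_(w <- W) \sum_(cw <- ls | cw.2 == w) cw.1 * rough_lift X 0 T cw.2).
  rewrite (exchange_big_dep predT)//= big_seq [RHS]big_seq; apply: eq_bigr => cw cwls.
  have cwW : cw.2 \in W by apply/imfsetP; exists cw.
  rewrite big_mkcond (bigD1_seq cw.2) ?fset_uniq// eqxx big1 => [|w]; first by rewrite /= addr0.
  by rewrite eq_sym => /negPf ->.
rewrite big_seq [RHS]big_seq; apply: eq_bigr => w wW.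
by rewrite fsfunE wW mulr_suml; apply: eq_bigr => cw /eqP ->.
Qed.

End signature_algebra.

Theorem theorem2p8 (R : realType) (T : R) (d : nat) (p : R)
    (K : set (rough_path T p (hatd d))) (f : rough_path T p (hatd d) -> R) :
  0 < T -> 2 < p < 3 ->
  K `<=` extended_rough_path ->
  compact K ->
  (exists M : R, forall X, K X -> (rp_norm X <= M%:E)%E) ->
  {within K, continuous f} ->
  forall L : R, 0 < L ->
  forall eps : R, 0 < eps ->
  exists l : tensor_algebra R (hatd d),
    (ereal_sup [set `|f X - tensor_pairing l (signature X T)|%:E
               | X in [set X | K X /\
                               (rp_norm X + bracket_norm X <= L%:E)%E]]
     < eps%:E)%E.
Proof.
move=> T0 p23 KE cK [M KM] fc L L0 eps eps0.
have coordc w : {within K, continuous (fun X : rough_path T p (hatd d) => rough_lift X 0 T w)}.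
  exact: (rough_lift_continuous T0 p23 KE KM).
have [||||||a Aa fa] := @stone_weierstrass R _ K cK (signature_functional K)
    _ _ _ _ f fc _ (eps / 2).
- by move=> c; exact: signature_functional_cst.
- by move=> a b; exact: signature_functionalD.
- by move=> a b; exact: signature_functionalM.
- move=> a [ls als]; apply/subspace_continuousP => X KX.
  have aE : \forall Y \near within K (nbhs X),
      \sum_(cw <- ls) cw.1 * rough_lift Y 0 T cw.2 = a Y.
    by apply/nbhs_ballP; exists 1 => //= Y _ KY; rewrite als.
  suff : \sum_(cw <- ls) cw.1 * rough_lift Y 0 T cw.2 @[Y --> within K (nbhs X)] -->
      \sum_(cw <- ls) cw.1 * rough_lift X 0 T cw.2.
    by rewrite -(als X KX); apply: cvg_trans; exact: near_eq_cvg aE.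
  apply: cvg_big => [|cw _]; first exact: add_continuous.
  apply: cvgM; first exact: cvg_cst.
  by have := coordc cw.2; rewrite subspace_continuousP; apply.
- move=> X Y KX KY fXY.
  (* If all coordinates agree, the distance is zero and continuity of [f] forces [f X = f Y];
     otherwise some coordinate separates the two points. *)
  have [XY|] := pselect (forall w, rough_lift X 0 T w = rough_lift Y 0 T w).
    exfalso; apply: fXY; apply/eqP; rewrite -subr_eq0 -normr_le0.
    apply/ler_addgt0Pr => e e0; rewrite add0r.
    have /within_continuousP/(_ X KX e e0)[r r0 hr] := fc.
    apply/ltW/hr => //; rewrite /ball/= /rp_ball/= (rp_dist0_of_lift T0 p23 (KE _ KX) (KE _ KY) XY).
    by rewrite lte_fin.
  move=> /existsNP[w Xw]; exists (fun X : rough_path T p (hatd d) => rough_lift X 0 T w) => //.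
  exact: signature_functional_coord.
- by rewrite divr_gt0.
have [l hl] := signature_functional_pairing T0 p23 KE Aa.
(* A supremum preserves only a weak bound, so the approximation is made within [eps / 2]. *)
exists l; apply: (@le_lt_trans _ _ (eps / 2)%:E); last by rewrite lte_fin; lra.
apply: ge_ereal_sup => _ [X [KX _] <-]; rewrite lee_fin ltW// -hl//.
exact: fa.
Qed.
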